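(* Let $L>0$, $b>0$, $\omega\in(-1,1)$, $k\in(0,1/\sqrt2)$, $a=c=-b$, $d=b$, and let $(\varphi,\psi)=(\varphi_{b,\omega,k},B\varphi_{b,\omega,k})$ be the pair of $L$-periodic functions defined in the context (for either choice of $B$). The operator $\mathcal{L}:H^2_{per}\times H^2_{per}\subset L^2_{per}\times L^2_{per}\to L^2_{per}\times L^2_{per}$ given by $$\mathcal{L}=\begin{pmatrix}1+c\partial_x^2 & b\omega\partial_x^2+\psi-\omega\\ b\omega\partial_x^2+\psi-\omega & 1+a\partial_x^2+\varphi\end{pmatrix}$$ has exactly one negative eigenvalue, which is simple, and zero is a simple eigenvalue with associated eigenfunction $(\varphi',B\varphi')$. Moreover, the remainder of the spectrum is constituted by a discrete set of eigenvalues.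
   Context: $L^2_{per}=L^2_{per}([0,L])$ and $H^2_{per}=H^2_{per}([0,L])$ are the $L$-periodic Lebesgue and Sobolev spaces. $K(k)$ is the complete elliptic integral of the first kind with modulus $k$, and $\mathrm{cn}(\cdot,k)$ is the Jacobi cnoidal function. The functions are $$\varphi(x)=b_0+b_2\,\mathrm{cn}^2\left(\frac{2K(k)}{L}x,k\right),\qquad \psi=B\varphi,$$ where $B=-\frac{\omega}{2}+\frac12\sqrt{\omega^2+8}$ or $B=-\frac{\omega}{2}-\frac12\sqrt{\omega^2+8}$, and $$b_0=\frac{-64(B\omega-1)^2\,b\,(k^2-\frac12)K(k)^2+2\left((\omega^2+\frac12)B-\frac32\omega\right)BL^2}{2B^2L^2(B\omega-1)},\qquad b_2=\frac{48\,b\,k^2(B\omega-1)K(k)^2}{B^2L^2}.$$ *)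

(* Defs.v *)
From HB Require Import structures.
From mathcomp Require Import all_boot all_order all_algebra.
From mathcomp Require Import complex.
From mathcomp Require Import all_classical all_reals all_analysis.

Set Implicit Arguments.
Unset Strict Implicit.
Unset Printing Implicit Defensive.

Import Order.TTheory GRing.Theory Num.Theory.
Import numFieldNormedType.Exports.
Export numFieldNormedType.Exports.

Local Open Scope classical_set_scope.
Local Open Scope ring_scope.
Local Open Scope complex_scope.

Section Elliptic.
Context {R : realType}.
Local Notation mu := (@lebesgue_measure R).
Implicit Types k u phi : R.

(* F(phi, k) = \int_0^phi (1 - k^2 sin^2 t)^(-1/2) dt, as an oriented integral;
   k is the modulus (not the parameter m = k^2). *)
Definition ellipticF k phi : R :=
  let f t : R := (Num.sqrt (1 - k ^+ 2 * sin t ^+ 2))^-1 in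
  if 0 <= phi then \int[mu]_(t in `[0, phi]) f t
  else - \int[mu]_(t in `[phi, 0]) f t.

Definition ellipticK k : R := ellipticF k (pi / 2).

(* For 0 <= k < 1, ellipticF k is a bijection of R, and jacobi_am _ k is its
   inverse; the default value 0 is irrelevant for such k. *)
Definition jacobi_am u k : R := xget 0 [set phi | ellipticF k phi = u].

Definition jacobi_cn u k : R := cos (jacobi_am u k).

End Elliptic.

Section PeriodicSpaces.
Context {R : realType}.
Local Notation mu := (@lebesgue_measure R).
Variable L : R.

(* R[i]^o is the field of complex numbers R[i], regarded as a normed vector
   space over itself. *)
Implicit Types f g v w : R -> R[i]^o.

Definition periodic (T : Type) (f : R -> T) : Prop := forall x, f (x + L) = f x.

(* Elements of L^2_per are represented by functions; equality in L^2_per is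
   equality almost everywhere on [0, L]. *)
Definition L2per f : Prop :=
  [/\ periodic f,
      measurable_fun setT (fun x => complex.Re (f x)),
      measurable_fun setT (fun x => complex.Im (f x)) &
      (\int[mu]_(x in `[0%R, L]) (ComplexField.Normc.normc (f x) ^+ 2)%:E < +oo)%E].

Definition smooth_per (theta : R -> R) : Prop :=
  periodic theta /\
  forall (n : nat) (x : R), derivable (theta^`(n)%classic) x 1.

Definition cintegral f : R[i] :=
  (\int[mu]_(x in `[0, L]) complex.Re (f x)) +i*
  (\int[mu]_(x in `[0, L]) complex.Im (f x)).

(* v is the derivative of f in the sense of periodic distributions. *)
Definition weak_deriv f v : Prop :=
  [/\ L2per f, L2per v &
      forall theta : R -> R, smooth_per theta ->
        cintegral (fun x => f x * (theta^`()%classic x)%:C) =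
        - cintegral (fun x => v x * (theta x)%:C)].

Definition weak_deriv2 f w : Prop :=
  exists2 v, weak_deriv f v & weak_deriv v w.

Definition H2per f : Prop := exists w, weak_deriv2 f w.

End PeriodicSpaces.

Section Spectrum.
Context {R : realType}.
Local Notation mu := (@lebesgue_measure R).
Local Notation X := ((R -> R[i]^o) * (R -> R[i]^o))%type.
Variable L : R.
Implicit Types (u v g : X) (z : R[i]).

Definition L2per2 u : Prop := L2per L u.1 /\ L2per L u.2.

Definition eq_L2 u v : Prop :=
  u.1 = v.1 %[ae mu in [set` `[0, L]]] /\ u.2 = v.2 %[ae mu in [set` `[0, L]]].

Definition norm_L2 u : R :=
  Num.sqrt (\int[mu]_(x in `[0, L])
    (ComplexField.Normc.normc (u.1 x) ^+ 2 + ComplexField.Normc.normc (u.2 x) ^+ 2)).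

(* An unbounded linear operator on L^2_per x L^2_per is given by its graph:
   T u g means that u is in the domain of T and that T u = g. *)
Variable T : X -> X -> Prop.

Definition eigenvector z u : Prop := T u (z *: u) /\ ~ eq_L2 u 0.

Definition is_eigenvalue z : Prop := exists u, eigenvector z u.

(* The operator of interest is self-adjoint, so that its algebraic and
   geometric multiplicities agree; simple means dim ker (T - z) = 1. *)
Definition simple_eigenvalue z : Prop :=
  exists2 u, eigenvector z u &
    forall v, T v (z *: v) -> exists s : R[i], eq_L2 v (s *: u).

(* T - z is a bijection from the domain onto L^2_per x L^2_per with a bounded
   inverse; T u (z *: u + g) means (T - z) u = g. *)
Definition resolvent_set : set R[i]^o := [set z |
  [/\ forall g, L2per2 g -> exists u, T u (z *: u + g),
      forall u, T u (z *: u) -> eq_L2 u 0 &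
      exists M : R, forall u g, L2per2 g -> T u (z *: u + g) ->
        norm_L2 u <= M * norm_L2 g]].

Definition spectrum : set R[i]^o := ~` resolvent_set.

End Spectrum.

Section Wave.
Context {R : realType}.
Implicit Types L b omega k B x : R.

Definition wave_b0 L b omega k B : R :=
  (- 64 * (B * omega - 1) ^+ 2 * b * (k ^+ 2 - 1 / 2) * ellipticK k ^+ 2
   + 2 * ((omega ^+ 2 + 1 / 2) * B - 3 / 2 * omega) * B * L ^+ 2)
  / (2 * B ^+ 2 * L ^+ 2 * (B * omega - 1)).

Definition wave_b2 L b omega k B : R :=
  48 * b * k ^+ 2 * (B * omega - 1) * ellipticK k ^+ 2 / (B ^+ 2 * L ^+ 2).

Definition wave L b omega k B x : R :=
  wave_b0 L b omega k B
  + wave_b2 L b omega k B * jacobi_cn (2 * ellipticK k / L * x) k ^+ 2.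

End Wave.

Section LinearizedOperator.
Context {R : realType}.
Local Notation mu := (@lebesgue_measure R).
Local Notation X := ((R -> R[i]^o) * (R -> R[i]^o))%type.

(* Graph of
     ( 1 + c d^2                b omega d^2 + psi - omega )
     ( b omega d^2 + psi - omega      1 + a d^2 + phi     )
   with domain H^2_per x H^2_per. *)
Definition calL (L a b c omega : R) (phi psi : R -> R) (u g : X) : Prop :=
  [/\ H2per L u.1, H2per L u.2, L2per2 L g &
    exists w1 w2 : R -> R[i]^o,
    [/\ weak_deriv2 L u.1 w1, weak_deriv2 L u.2 w2,
      g.1 = (fun x =>
        (u.1 x + c%:C * w1 x)
        + ((b * omega)%:C * w2 x + (psi x - omega)%:C * u.2 x))
        %[ae mu in [set` `[0, L]]] &
      g.2 = (fun x =>
        ((b * omega)%:C * w1 x + (psi x - omega)%:C * u.1 x)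
        + (u.2 x + a%:C * w2 x + (phi x)%:C * u.2 x))
        %[ae mu in [set` `[0, L]]]]].

End LinearizedOperator.

(* Main.v *)
Require Import Defs.
From mathcomp Require Import all_boot all_order all_algebra.
From mathcomp Require Import complex.
From mathcomp Require Import all_classical all_reals all_analysis.
From mathcomp Require Import measurable_realfun ring lra.

Set Implicit Arguments.
Unset Strict Implicit.
Unset Printing Implicit Defensive.

Import Order.TTheory GRing.Theory Num.Theory.
Import numFieldNormedType.Exports.

Local Open Scope classical_set_scope.
Local Open Scope ring_scope.

(** Why the theorem holds. Write the operator as T u = A (u - b u'') + phi P u with
    the constant matrices A = ((1, -w), (-w, 1)) and P = ((0, B), (B, 1)). As
    B^2 = 2 - w B, the vectors (1, B) and (B - w, w B - 1) are orthogonal for A and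
    P is diagonal in them relative to A. Hence the quadratic form of T is a sum, with
    positive weights, of the forms of two scalar Hill operators - b f'' + V f
    ([form_split]). The second potential is at least 1. The first one is
    W = 1 + B^2 / (1 - w B) phi, and the constants of the wave are such that W is a
    Lame potential: in the variable 2 K x / L, it is 12 k^2 sn^2 - 4 - 4 k^2 up to a
    factor ([wave_lame]). It is negative because k^2 < 1/2.

    Two Lame functions are explicit ([lame_hill_data]): the odd function sn cn dn, a
    multiple of phi', solves the homogeneous equation and vanishes only at the ends
    of the half period; an even function of the form dn (1 - alpha sn^2), with a
    single zero x2 in the half period, has a positive eigenvalue. Applying Picone's
    identity to the odd and even parts of f separately shows that the form of the
    first Hill operator is nonnegative as soon as f (x2) + f (- x2) = 0, and controls
    the even part of f ([hill_form_bound]). This single linear condition bounds the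
    number of negative eigenvalues by one, with multiplicity ([negative_unique],
    [negative_trace]). Together with the negativity of the integral of W, it also
    shows that the kernel is spanned by phi' ([kernel_spanned]). A negative eigenvalue
    exists: the constant pair (1, B) makes the infimum of the Rayleigh quotient
    negative, and this infimum is an eigenvalue since otherwise T minus it would be
    boundedly invertible ([negative_exists]).

    The spectrum. If z is not an eigenvalue, the Fredholm alternative for the periodic
    boundary value problem of a linear differential system solves T u = z u + g with a
    bound ([resolvent_of_not_eigenvalue]); so the spectrum consists of eigenvalues.
    These are real by symmetry ([eigen_real]), and only finitely many lie below a given
    level ([eigen_finite]): otherwise some combination of eigenfunctions vanishes on a
    fine grid, and Poincare's inequality on the grid contradicts the bound on the form.

    All this concerns classical solutions. The passage from weak solutions in L^2 is
    the du Bois-Reymond lemma ([du_bois_reymond]), which turns the weak equations into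
    integral equations with continuous solutions ([calL_classical]). *)

(** * Derivatives, continuity and primitives on the real line *)

Section Calculus.
Context {R : realType}.
Local Notation mu := (@lebesgue_measure R).
Implicit Types (f g F G : R -> R) (a b x y : R).

Lemma derD f g x (df dg : R) : is_derive x 1 f df -> is_derive x 1 g dg ->
  is_derive x 1 (fun t => f t + g t) (df + dg).
Proof. by move=> hf hg; exact: is_deriveD. Qed.

Lemma derN f x (df : R) : is_derive x 1 f df ->
  is_derive x 1 (fun t => - f t) (- df).
Proof. by move=> hf; exact: is_deriveN. Qed.

Lemma derB f g x (df dg : R) : is_derive x 1 f df -> is_derive x 1 g dg ->
  is_derive x 1 (fun t => f t - g t) (df - dg).
Proof. by move=> hf hg; exact: is_deriveB. Qed.

Lemma derM f g x (df dg : R) : is_derive x 1 f df -> is_derive x 1 g dg ->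
  is_derive x 1 (fun t => f t * g t) (f x * dg + g x * df).
Proof. by move=> hf hg; exact: is_deriveM. Qed.

Lemma derC (c x : R) : is_derive x 1 (fun _ : R => c : R) 0.
Proof. exact: is_derive_cst. Qed.

Lemma derid x : is_derive x 1 (fun t : R => t) 1.
Proof. exact: is_derive_id. Qed.

Lemma derX f n x (df : R) : is_derive x 1 f df ->
  is_derive x 1 (fun t => f t ^+ n) (n%:R * f x ^+ n.-1 * df).
Proof.
move=> hf; have h := is_deriveX n hf.
have -> : (fun t => f t ^+ n) = f ^+ n.
  apply/funext => t; elim: n {h} => [|n ih]; first by rewrite !expr0.
  by rewrite !exprS ih.
by apply: is_derive_eq; rewrite mulr_natl.
Qed.

Lemma dercomp f g x (df dg : R) : is_derive (g x) 1 f df -> is_derive x 1 g dg ->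
  is_derive x 1 (fun t => f (g t)) (df * dg).
Proof. by move=> hf hg; exact: is_derive1_comp. Qed.

Lemma derV f x (df : R) : f x != 0 -> is_derive x 1 f df ->
  is_derive x 1 (fun t => (f t)^-1) (- df / f x ^+ 2).
Proof.
move=> f0 hf; have h := is_deriveV f0 hf.
by apply: is_derive_eq; rewrite /GRing.scale/= mulNr mulrC mulNr.
Qed.

Lemma der_eq f x (d d' : R) : is_derive x 1 f d -> d = d' -> is_derive x 1 f d'.
Proof. by move=> h <-. Qed.

Lemma der_ext f g x (d : R) : (forall t, f t = g t) -> is_derive x 1 f d ->
  is_derive x 1 g d.
Proof. by move=> /funext ->. Qed.

Lemma derScale f x (df c : R) : is_derive x 1 f df ->
  is_derive x 1 (fun t => c * f t) (c * df).
Proof.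
by move=> h; apply: (der_eq (derM (derC c x) h)); rewrite mulr0 addr0.
Qed.

Lemma der_sum (I : finType) (f : I -> R -> R) x (df : I -> R) :
  (forall i, is_derive x 1 (f i) (df i)) ->
  is_derive x 1 (fun t => \sum_i f i t) (\sum_i df i).
Proof.
move=> h; elim: (index_enum I) => [|i s ih].
  rewrite big_nil; apply: der_ext (derC 0 x) => t; by rewrite big_nil.
rewrite big_cons; apply: der_ext (derD (h i) ih) => t; by rewrite big_cons.
Qed.

Lemma der_cont f x (df : R) : is_derive x 1 f df -> {for x, continuous f}.
Proof.
by move=> h; apply: differentiable_continuous; apply/derivable1_diffP; exact: ex_derive.
Qed.

Lemma der_contT f f' : (forall x, is_derive x 1 f (f' x)) -> continuous f.
Proof. by move=> h x; exact: (der_cont (h x)). Qed.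

Lemma der_val f x (df : R) : is_derive x 1 f df -> (f^`())%classic x = df.
Proof. by move=> h; rewrite derive1E; exact: derive_val. Qed.

Lemma der_uniq f x (df dg : R) : is_derive x 1 f df -> is_derive x 1 f dg -> df = dg.
Proof. by move=> h1 h2; rewrite -(der_val h1) -(der_val h2). Qed.

Lemma contD f g : continuous f -> continuous g -> continuous (fun x => f x + g x).
Proof. by move=> hf hg x; apply: cvgD; [exact: hf|exact: hg]. Qed.

Lemma contM f g : continuous f -> continuous g -> continuous (fun x => f x * g x).
Proof. by move=> hf hg x; apply: cvgM; [exact: hf|exact: hg]. Qed.

Lemma contN f : continuous f -> continuous (fun x => - f x).
Proof. by move=> hf x; apply: cvgN; exact: hf. Qed.

Lemma contB f g : continuous f -> continuous g -> continuous (fun x => f x - g x).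
Proof. by move=> hf hg; apply: contD => //; exact: contN. Qed.

Lemma contC (c : R) : continuous (fun _ : R => c : R).
Proof. by move=> x; exact: cvg_cst. Qed.

Lemma contX f n : continuous f -> continuous (fun x => f x ^+ n).
Proof.
move=> hf; elim: n => [|n ih].
  by under eq_fun do rewrite expr0; exact: contC.
by under eq_fun do rewrite exprS; exact: contM.
Qed.

Lemma cont_comp f g : continuous f -> continuous g -> continuous (fun x => f (g x)).
Proof. by move=> hf hg x; apply: continuous_comp; [exact: hg|exact: hf]. Qed.

Lemma cont_sum (I : finType) (f : I -> R -> R) : (forall i, continuous (f i)) ->
  continuous (fun t => \sum_i f i t).
Proof.
move=> h; elim: (index_enum I) => [|i s ih].
  by under eq_fun do rewrite big_nil; exact: contC.
by under eq_fun do rewrite big_cons; exact: contD.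
Qed.

Lemma nondecr_der f f' a b : (forall x, a <= x <= b -> is_derive x 1 f (f' x)) ->
  (forall x, a < x < b -> 0 <= f' x) -> a <= b -> f a <= f b.
Proof.
move=> hd hp ab.
apply: (@ger0_derive1_ndecr R f a b) => //.
- by move=> x /[!in_itv]/= /andP[ax xb]; apply: ex_derive; apply: hd; rewrite !ltW.
- move=> x /[!in_itv]/= /andP[ax xb]; have h := hd x.
  by rewrite !ltW// in h; rewrite (der_val (h isT)); apply: hp; rewrite ax xb.
- apply: derivable_within_continuous => x /[!in_itv]/= h.
  by apply: ex_derive; exact: hd.
Qed.

(** Integrability on every bounded interval: the class on which primitives are
    taken, wide enough for the square integrable data cut off outside a period. *)
Definition locint f := forall a b, mu.-integrable `[a, b] (EFin \o f).

Lemma cont_locint f : continuous f -> locint f.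
Proof.
move=> cf a b; apply: continuous_compact_integrable; first exact: segment_compact.
by apply: continuous_subspaceT.
Qed.

(** The oriented integral from 0 to [x]; one of the two terms always vanishes. *)
Definition prim f x : R :=
  \int[mu]_(t in `[0, x]) f t - \int[mu]_(t in `[x, 0]) f t.

Lemma Rint_chasles f a b c : locint f -> a <= b -> b <= c ->
  \int[mu]_(t in `[a, c]) f t =
  \int[mu]_(t in `[a, b]) f t + \int[mu]_(t in `[b, c]) f t.
Proof.
move=> hf ab bc.
have <- : \int[mu]_(t in `]b, c]) f t = \int[mu]_(t in `[b, c]) f t.
  apply: Rintegral_itv_obnd_cbnd; apply: integrableS (hf b c) => //.
  exact: subset_itv_oc_cc.
rewrite -(@Rintegral_itvB R f (BLeft a) (BRight c) b) ?bnd_simp//.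
by rewrite addrC subrK.
Qed.

Lemma Rint_aa f a : \int[mu]_(t in `[a, a]) f t = 0.
Proof. by rewrite set_itv1 Rintegral_set1. Qed.

Lemma Rint_rev f a b : b < a -> \int[mu]_(t in `[a, b]) f t = 0.
Proof. by move=> h; rewrite set_itv_ge ?bnd_simp -?ltNge// Rintegral_set0. Qed.

Lemma primE f a x : locint f -> a <= 0 -> a <= x ->
  prim f x = \int[mu]_(t in `[a, x]) f t - \int[mu]_(t in `[a, 0]) f t.
Proof.
move=> hf a0 ax; rewrite /prim.
have [x0|x0] := leP 0 x.
  rewrite (Rint_chasles hf a0 x0); move: x0; rewrite le_eqVlt => /predU1P[<-|x0].
    by rewrite Rint_aa; lra.
  by rewrite (Rint_rev f x0); lra.
by rewrite (Rint_chasles hf ax (ltW x0)) (Rint_rev f x0); lra.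
Qed.

Lemma prim0 f : prim f 0 = 0.
Proof. by rewrite /prim Rint_aa subrr. Qed.

Lemma prim_pos f x : 0 <= x -> prim f x = \int[mu]_(t in `[0, x]) f t.
Proof.
rewrite /prim le_eqVlt => /predU1P[<-|x0]; first by rewrite Rint_aa subr0.
by rewrite (Rint_rev f x0) subr0.
Qed.

Lemma prim_continuous f : locint f -> continuous (prim f).
Proof.
move=> hf x; pose a := Num.min x 0 - 1; pose b := x + 1.
have ax : a < x by rewrite /a; have := ge_min x x 0; rewrite lexx => /= h; lra.
have a0 : a <= 0 by rewrite /a; have := ge_min 0 x 0; rewrite lexx orbT => /= h; lra.
have xb : x < b by rewrite /b; lra.
have ab : a <= b by lra.
have := @parameterized_integral_continuous R a b f ab (hf a b).
move=> /(continuous_within_itvP _ (lt_trans ax xb))[h _ _].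
have {}h := h x; rewrite in_itv/= ax xb in h; have {}h := h isT.
rewrite /parameterized_integral in h.
have h2 : (fun y => \int[mu]_(t in `[a, y]) f t - \int[mu]_(t in `[a, 0]) f t) y
    @[y --> x] --> prim f x.
  rewrite (primE hf a0 (ltW ax)).
  exact: (@cvgB _ _ _ (nbhs x) _ _ (cst (\int[mu]_(t in `[a, 0]) f t)) _ _ h (cvg_cst _)).
apply: cvg_trans h2; apply: near_eq_cvg.
near=> y; rewrite /= (@primE f a y)//.
by near: y; exact: lt_le_nbhsr.
Unshelve. all: by end_near. Qed.

(** The fundamental theorem of calculus, on both sides of 0. *)
Lemma prim_der f : continuous f -> forall x, is_derive x 1 (prim f) (f x).
Proof.
move=> cf x; have hf := cont_locint cf.
pose a := Num.min x 0 - 1; pose b := x + 1.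
have ax : a < x by rewrite /a; have := ge_min x x 0; rewrite lexx => /= h; lra.
have a0 : a <= 0 by rewrite /a; have := ge_min 0 x 0; rewrite lexx orbT => /= h; lra.
have xb : x < b by rewrite /b; lra.
have [d1 d2] := @continuous_FTC1_closed R f a x b xb (hf a b) ax (cf x).
have h : is_derive x 1 (fun y => \int[mu]_(t in `[a, y]) f t -
    \int[mu]_(t in `[a, 0]) f t) (f x).
  apply: (der_eq (derB (derivableP d1) (derC (\int[mu]_(t in `[a, 0]) f t) x))).
  by rewrite subr0 -derive1E d2.
apply: near_eq_is_derive h.
near=> y; rewrite (@primE f a y)//.
by near: y; exact: lt_le_nbhsr.
Unshelve. all: by end_near. Qed.

Lemma prim_unique f F : continuous f -> (forall x, is_derive x 1 F (f x)) ->
  forall x, prim f x = F x - F 0.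
Proof.
move=> cf hF x.
have h : forall t : R, is_derive t 1 (fun s => prim f s - F s) 0.
  by move=> t; apply: (der_eq (derB (prim_der cf t) (hF t))); rewrite subrr.
have := is_derive_0_is_cst x 0 h; rewrite prim0 => hx; lra.
Qed.

Lemma prim_eq f F x : continuous f -> (forall y : R, is_derive y 1 F (f y)) ->
  F 0 = 0 -> prim f x = F x.
Proof. by move=> cf hF F0; rewrite (prim_unique cf hF) F0 subr0. Qed.

Lemma nondecrT f f' : (forall x : R, is_derive x 1 f (f' x)) -> (forall x, 0 <= f' x) ->
  {homo f : x y / x <= y}.
Proof. by move=> hd hp x y xy; apply: (@nondecr_der f f'). Qed.

Lemma prim_cst (c x : R) : prim (fun _ : R => c) x = c * x.
Proof.
apply: (@prim_eq _ (fun t => c * t)); [exact: contC| |exact: mulr0].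
by move=> t; apply: (der_eq (derScale c (derid t))); rewrite mulr1.
Qed.

Lemma prim_cst0 x : prim (fun _ : R => 0 : R) x = 0.
Proof. by rewrite prim_cst mul0r. Qed.

Lemma locintD f g : locint f -> locint g -> locint (fun x => f x + g x).
Proof.
move=> hf hg a b.
have /(_ (measurable_itv _) _ _ (hf a b) (hg a b)) := @integrableD _ _ R mu `[a, b].
by congr (integrable _ _ _); apply/funext => x /=; rewrite EFinD.
Qed.

Lemma locintZ f (c : R) : locint f -> locint (fun x => c * f x).
Proof.
move=> hf a b.
have /(_ (measurable_itv _) c _ (hf a b)) := @integrableZl _ _ R mu `[a, b].
by congr (integrable _ _ _); apply/funext => x /=; rewrite EFinM.
Qed.

Lemma primD f g x : locint f -> locint g ->
  prim (fun t => f t + g t) x = prim f x + prim g x.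
Proof.
by move=> hf hg; rewrite /prim !RintegralD//; lra.
Qed.

Lemma primZ f (c : R) x : locint f -> prim (fun t => c * f t) x = c * prim f x.
Proof. by move=> hf; rewrite /prim !RintegralZl// mulrBr. Qed.

Lemma prim_sum (I : finType) (f : I -> R -> R) x : (forall i, locint (f i)) ->
  prim (fun t => \sum_i f i t) x = \sum_i prim (f i) x.
Proof.
move=> hf; pose P s := locint (fun t => \sum_(i <- s) f i t) /\
  prim (fun t => \sum_(i <- s) f i t) x = \sum_(i <- s) prim (f i) x.
suff : P (index_enum I) by case.
elim: (index_enum I) => [|i s [ih1 ih2]]; rewrite /P.
  have -> : (fun t : R => \sum_(i <- [::]) f i t) = (fun=> 0).
    by apply/funext => t; rewrite big_nil.
  split; first by apply: cont_locint; exact: contC.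
  by rewrite big_nil (prim_unique (@contC 0) (@derC 0)) subrr.
have -> : (fun t : R => \sum_(j <- i :: s) f j t) =
          (fun t => f i t + \sum_(j <- s) f j t).
  by apply/funext => t; rewrite big_cons.
split; first exact: locintD.
by rewrite primD// big_cons ih2.
Qed.

Lemma prim_le f g x : 0 <= x -> continuous f -> continuous g ->
  (forall t, 0 <= t <= x -> f t <= g t) -> prim f x <= prim g x.
Proof.
move=> x0 cf cg fg; rewrite !prim_pos//; apply: le_Rintegral => //.
- exact: (cont_locint cf).
- exact: (cont_locint cg).
Qed.

Lemma prim_ge0 f x : 0 <= x -> (forall t, 0 <= t <= x -> 0 <= f t) -> 0 <= prim f x.
Proof.
move=> x0 h; rewrite prim_pos//; apply: Rintegral_ge0 => t /=.
by rewrite in_itv/=; exact: h.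
Qed.

(** A nonnegative continuous function with zero integral vanishes: its primitive
    is nondecreasing with equal end values, so it is constant. *)
Lemma prim_eq0 f (L : R) : 0 < L -> continuous f ->
  (forall t : R, 0 <= t <= L -> 0 <= f t) ->
  prim f L <= 0 -> forall t : R, 0 <= t <= L -> f t = 0.
Proof.
move=> L0 cf f0 hL.
have P0 (t : R) : 0 <= t <= L -> prim f t = 0.
  move=> /andP[t0 tL]; apply/eqP; rewrite eq_le prim_ge0 ?andbT//; last first.
    by move=> s /andP[s0 st]; apply: f0; rewrite s0 (le_trans st).
  apply: le_trans hL; apply: (@nondecr_der _ f) => // x; last first.
    by move=> /andP[tx xL]; apply: f0; rewrite (le_trans t0 (ltW tx)) ltW.
  by move=> _; exact: prim_der.
have I0 (t : R) : 0 < t < L -> f t = 0.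
  move=> /andP[t0 tL].
  have h : is_derive t 1 (fun _ : R => 0) (f t).
    apply: (@near_eq_is_derive _ _ _ (prim f)) (prim_der cf t).
    near=> s; apply: P0; apply/andP; split; near: s.
      exact: lt_le_nbhsr.
    exact: lt_le_nbhsl.
  by apply: (der_uniq h); exact: derC.
have [c1 c2] : f 0 = 0 /\ f L = 0.
  split; apply/eqP/negP => /negP n0.
    have n1 : 0 < f 0 by rewrite lt0r n0 f0 ?lexx ?ltW.
    have [e /= e0 he] := cvgr_gt _ (cf 0) 0 n1.
    pose s := Num.min (e / 2) (L / 2).
    have s0 : 0 < s by rewrite lt_min; apply/andP; split; lra.
    have := he s; rewrite /= sub0r normrN gtr0_norm// => /(_ _).
    rewrite I0 ?ltxx => [h|]; first by
      have : s <= e / 2 by [rewrite ge_min lexx]; move=> h2; exfalso; suff: false by []; apply: h; lra.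
    by rewrite s0 /=; have : s <= L / 2 by [rewrite ge_min lexx orbT]; lra.
  have n1 : 0 < f L by rewrite lt0r n0 f0 ?lexx ?ltW.
  have [e /= e0 he] := cvgr_gt _ (cf L) 0 n1.
  pose s := Num.min (e / 2) (L / 2).
  have s0 : 0 < s by rewrite lt_min; apply/andP; split; lra.
  have s1 : s <= e / 2 by rewrite ge_min lexx.
  have s2 : s <= L / 2 by rewrite ge_min lexx orbT.
  have := he (L - s); rewrite /= opprB addrC subrK gtr0_norm// => /(_ _).
  rewrite I0 ?ltxx => [h|]; last by apply/andP; split; lra.
  by exfalso; suff: false by []; apply: h; lra.
move=> t /andP[]; rewrite le_eqVlt => /predU1P[<- //|t0].
rewrite le_eqVlt => /predU1P[-> //|tL]; by apply: I0; rewrite t0.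
Unshelve. all: by end_near. Qed.

(** The Cauchy-Schwarz inequality against 1, from the variance around the mean. *)
Lemma prim_sqr_le f (L : R) : 0 < L -> continuous f ->
  forall x : R, 0 <= x <= L -> prim f x ^+ 2 <= L * prim (fun t => f t ^+ 2) L.
Proof.
move=> L0 cf x /andP[x0 xL].
have cf2 : continuous (fun t => f t ^+ 2) by exact: contX.
have m : prim (fun t => f t ^+ 2) x <= prim (fun t => f t ^+ 2) L.
  apply: (@nondecr_der _ (fun t => f t ^+ 2)) => // t _; first exact: prim_der.
  exact: sqr_ge0.
have m0 : 0 <= prim (fun t => f t ^+ 2) x by apply: prim_ge0 => // t _; exact: sqr_ge0.
move: x0; rewrite le_eqVlt => /predU1P[x0|x0].
  rewrite -x0 prim0 expr0n/=; apply: mulr_ge0; first exact: ltW.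
  exact: le_trans m0 m.
apply: (@le_trans _ _ (x * prim (fun t => f t ^+ 2) x)); last by apply: ler_pM => //; exact: ltW.
pose a := prim f x / x.
have : 0 <= prim (fun t => (f t - a) ^+ 2) x by apply: prim_ge0 => [|t _]; [exact: ltW|exact: sqr_ge0].
have -> : prim (fun t => (f t - a) ^+ 2) x =
    prim (fun t => f t ^+ 2) x - 2 * a * prim f x + a ^+ 2 * x.
  apply: (@prim_eq _ (fun y => prim (fun t => f t ^+ 2) y - 2 * a * prim f y + a ^+ 2 * y)).
  - by apply: (@contX _ 2); apply: contB => //; exact: contC.
  - move=> y; have d1 := prim_der cf2 y; have d2 := derScale (2 * a) (prim_der cf y).
    by apply: (der_eq (derD (derB d1 d2) (derScale (a ^+ 2) (derid y)))); ring.
  - by rewrite !prim0; ring.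
have ax : a * x = prim f x by rewrite /a divfK// gt_eqF.
have -> : prim (fun t => f t ^+ 2) x - 2 * a * prim f x + a ^+ 2 * x =
    prim (fun t => f t ^+ 2) x - a ^+ 2 * x by rewrite -ax; ring.
rewrite -ax => h; have : 0 <= x * (prim (fun t => f t ^+ 2) x - a ^+ 2 * x).
  by apply: mulr_ge0 => //; exact: ltW.
have -> : (a * x) ^+ 2 = x * (a ^+ 2 * x) by ring.
by rewrite mulrBr subr_ge0.
Qed.

End Calculus.
Arguments derScale {R f x df} c _.


(** * Linear differential systems and the periodic Fredholm alternative *)

Section GeometricEstimates.
Context {R : realType}.
Implicit Types (K x y : R) (s : nat -> R).

Lemma le_geo_eq0 K x : (forall n, `|x| <= K * 2^-1 ^+ n) -> x = 0.
Proof.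
move=> h; apply/eqP; rewrite -normr_eq0; apply/negP => /negP x0.
have xp : 0 < `|x| by rewrite lt0r x0 normr_ge0.
have K0 : 0 <= K by have := h 0; rewrite expr0 mulr1; apply: le_trans.
pose n := Num.bound (K / `|x|).
have hn : K / `|x| < n%:R.
  by have := archi_boundP (divr_ge0 K0 (ltW xp)).
have h2 : (n%:R : R) <= 2 ^+ n by rewrite -natrX ler_nat ltnW// ltn_expl.
have := h n; rewrite exprVn ler_pdivlMr ?exprn_gt0// => h3.
rewrite ltr_pdivrMr// in hn.
have h4 : n%:R * `|x| <= 2 ^+ n * `|x| by rewrite ler_pM2r.
lra.
Qed.

(** The limit does not depend on the constant of the geometric bound: the Picard
    iterates satisfy such a bound on every compact interval, with other constants. *)
Lemma geo_lim K0 s : (forall n, `|s n.+1 - s n| <= K0 * 2^-1 ^+ n) ->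
  exists l, forall K, (forall n, `|s n.+1 - s n| <= K * 2^-1 ^+ n) ->
    forall n, `|l - s n| <= 2 * K * 2^-1 ^+ n.
Proof.
have ex K : (forall n, `|s n.+1 - s n| <= K * 2^-1 ^+ n) ->
    exists l, forall n, `|l - s n| <= 2 * K * 2^-1 ^+ n.
  move=> h; pose a n := s n - 2 * K * 2^-1 ^+ n; pose b n := s n + 2 * K * 2^-1 ^+ n.
  have aS n : a n <= a n.+1.
    by rewrite /a exprS; have := h n; rewrite ler_norml => /andP[h1 h2]; lra.
  have bS n : b n.+1 <= b n.
    by rewrite /b exprS; have := h n; rewrite ler_norml => /andP[h1 h2]; lra.
  have K0' : 0 <= K by have := h 0; rewrite expr0 mulr1; apply: le_trans.
  have anb n : a n <= b n.
    rewrite /a /b; have : 0 <= K * 2^-1 ^+ n by rewrite mulr_ge0// exprn_ge0.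
    lra.
  have amono n m : a n <= a (n + m)%N.
    by elim: m => [|m ih]; rewrite ?addn0// addnS (le_trans ih).
  have bmono n m : b (n + m)%N <= b n.
    by elim: m => [|m ih]; rewrite ?addn0// addnS (le_trans (bS _)).
  have ab n m : a n <= b m.
    apply: le_trans (amono n m) _; apply: le_trans (anb _) _.
    by rewrite addnC; exact: bmono.
  have ne : range a !=set0 by exists (a 0); exists 0.
  exists (sup (range a)) => n.
  have h1 : a n <= sup (range a).
    apply: ub_le_sup; last by exists n.
    by exists (b 0) => _ [m _ <-]; exact: ab.
  have h2 : sup (range a) <= b n.
    by apply: ge_sup => // _ [m _ <-]; exact: ab.
  by move: h1 h2; rewrite /a /b ler_norml => h1 h2; apply/andP; split; lra.
move=> h0; have [l hl] := ex _ h0; exists l => K h.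
have [l' hl'] := ex _ h; suff -> : l = l' by [].
apply/eqP; rewrite -subr_eq0; apply/eqP; apply: (@le_geo_eq0 (2 * K0 + 2 * K)) => n.
have -> : l - l' = (l - s n) - (l' - s n) by ring.
by rewrite (le_trans (ler_normB _ _))// mulrDl lerD.
Qed.

Let norm_shift x y : `|x - y| <= 1 -> `|y| <= `|x| + 1.
Proof.
move=> h; have h2 := ler_normB x (x - y).
have e : x - (x - y) = y by ring.
rewrite e in h2; lra.
Qed.

Lemma cont_unif (f : R -> R) :
  (forall r e : R, 0 < e ->
     exists2 g : R -> R, continuous g & forall y, `|y| <= r -> `|f y - g y| <= e) ->
  continuous f.
Proof.
move=> h x; apply/cvgrPdist_le => e e0.
have e3 : 0 < e / 3 by lra.
have [g cg hg] := h (`|x| + 1) _ e3.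
near=> y.
have hy : `|y| <= `|x| + 1.
  by apply: norm_shift; near: y; apply: cvgr_dist_le => //; exact: cvg_id.
have hgy : `|g x - g y| <= e / 3 by near: y; apply: cvgr_dist_le => //; exact: cg.
have -> : f x - f y = (f x - g x) + (g x - g y) - (f y - g y) by ring.
have h1 := hg x; have h2 := hg y hy.
have {}h1 : `|f x - g x| <= e / 3 by apply: h1; lra.
apply: le_trans (ler_normB _ _) _; have := ler_normD (f x - g x) (g x - g y); lra.
Unshelve. all: by end_near. Qed.

Lemma cont_bounded (f : R -> R) a b : continuous f ->
  exists K, 0 <= K /\ forall x, a <= x <= b -> `|f x| <= K.
Proof.
move=> cf; have [ab|ba] := leP a b; last first.
  by exists 0; split => // x /andP[h1 h2]; exfalso; have := le_trans h1 h2; rewrite leNgt ba.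
have cn : {within `[a, b], continuous (fun x => `|f x|)}.
  by apply: continuous_subspaceT => x; apply: cvg_norm; exact: cf.
have [c _ hc] := EVT_max ab cn.
by exists `|f c|; split => // x hx; apply: hc; rewrite in_itv.
Qed.

Lemma cont_bounded_fin (I : finType) (f : I -> R -> R) a b :
  (forall i, continuous (f i)) ->
  exists K, 0 <= K /\ forall i x, a <= x <= b -> `|f i x| <= K.
Proof.
move=> cf.
have /choice[K hK] : forall i, exists K, 0 <= K /\ forall x, a <= x <= b -> `|f i x| <= K.
  by move=> i; exact: cont_bounded.
exists (\sum_i K i); split; first by apply: sumr_ge0 => i _; case: (hK i).
move=> i x hx; apply: le_trans ((hK i).2 x hx) _.
by rewrite (bigD1 i)//= lerDl; apply: sumr_ge0 => j _; case: (hK j).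
Qed.

End GeometricEstimates.

Section LinearSystems.
Context {R : realType} {I : finType}.
Variables (M : I -> I -> R -> R) (C : R).
Hypothesis M_cont : forall i j, continuous (M i j).
Hypothesis C_gt0 : 0 < C.
Hypothesis M_le : forall i x, \sum_j `|M i j x| <= C.
Implicit Types (f g H Y : I -> R -> R) (p q K x y t : R).

(** With this operator, a linear initial value problem Y' = M Y + h becomes the
    fixed point equation Y = H + volterra Y on the whole line at once. *)
Definition volterra f i x : R := prim (fun t => \sum_j M i j t * f j t) x.

Let rhs_cont f i : (forall j, continuous (f j)) ->
  continuous (fun t => \sum_j M i j t * f j t).
Proof. by move=> cf; apply: cont_sum => j; apply: contM. Qed.

Lemma volterra_cont f i : (forall j, continuous (f j)) -> continuous (volterra f i).
Proof. by move=> cf; apply: prim_continuous; apply: cont_locint; exact: rhs_cont. Qed.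

Lemma volterraB f g i x : (forall j, continuous (f j)) ->
  (forall j, continuous (g j)) ->
  volterra (fun j t => f j t - g j t) i x = volterra f i x - volterra g i x.
Proof.
move=> cf cg; rewrite /volterra.
have h1 := prim_der (@rhs_cont f i cf); have h2 := prim_der (@rhs_cont g i cg).
apply: (@prim_eq _ _ (fun y => prim (fun t => \sum_j M i j t * f j t) y -
   prim (fun t => \sum_j M i j t * g j t) y)).
- by apply: rhs_cont => j; exact: contB.
- move=> y; apply: (der_eq (derB (h1 y) (h2 y))).
  by rewrite -sumrB; apply: eq_bigr => j _; rewrite mulrBr.
- by rewrite !prim0 subrr.
Qed.

Let weight (x : R) := expR (2 * C * `|x|).

Let weight_ge1 x : 1 <= weight x.
Proof.
apply: le_trans (expR_ge1Dx _); rewrite lerDl mulr_ge0 ?normr_ge0//.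
by rewrite mulr_ge0// ltW.
Qed.

Let weight_bound (g : R -> R) K x : 0 <= x -> continuous g ->
  (forall t, 0 <= t <= x -> `|g t| <= C * (K * expR (2 * C * t))) ->
  `|prim g x| <= K / 2 * expR (2 * C * x).
Proof.
have main (h : R -> R) y : 0 <= y -> continuous h ->
    (forall t, 0 <= t <= y -> h t <= C * (K * expR (2 * C * t))) -> 0 <= K ->
    prim h y <= K / 2 * expR (2 * C * y).
  move=> y0 ch hh K0.
  pose F z := K / 2 * expR (2 * C * z) - prim h z.
  have dF (z : R) : is_derive z 1 F (C * (K * expR (2 * C * z)) - h z).
    have d1 := @dercomp _ expR (fun z => 2 * C * z) z _ _ (is_derive_expR _)
      (derScale (2 * C) (derid z)).
    apply: (der_eq (derB (derScale (K / 2) d1) (prim_der ch z))).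
    by field.
  have := @nondecr_der _ F _ 0 y (fun z _ => dF z) _ y0; rewrite /F prim0.
  rewrite mulr0 expR0 mulr1 => /(_ _)/wrap[z /andP[z0 zy]|].
    by rewrite subr_ge0; apply: hh; rewrite !ltW.
  lra.
move=> x0 cg hg.
have K0 : 0 <= K.
  have := hg 0; rewrite lexx x0 mulr0 expR0 mulr1 => /(_ isT).
  by move=> /(le_trans (normr_ge0 _)); rewrite pmulr_rge0.
rewrite ler_norml; apply/andP; split; last first.
  by apply: main => // t ht; apply: le_trans (hg t ht); exact: ler_norm.
have -> : prim g x = - prim (fun t => - g t) x.
  apply: (@prim_eq _ _ (fun y => - prim (fun t => - g t) y)) => //.
    by move=> y; apply: (der_eq (derN (prim_der (contN cg) y))); rewrite opprK.
  by rewrite prim0 oppr0.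
rewrite lerN2; apply: main => //; first exact: contN.
by move=> t ht; apply: le_trans (hg t ht); rewrite -normrN; exact: ler_norm.
Qed.

(** One integration halves a bound expressed in the exponential weight: this
    single estimate drives both existence and uniqueness below. *)
Lemma volterra_half f p q K : p <= 0 -> 0 <= q -> (forall j, continuous (f j)) ->
  (forall j t, p <= t <= q -> `|f j t| <= K * weight t) ->
  forall i x, p <= x <= q -> `|volterra f i x| <= K / 2 * weight x.
Proof.
move=> p0 q0 cf hf i x /andP[px xq].
have hb t : p <= t <= q -> `|\sum_j M i j t * f j t| <= C * (K * weight t).
  move=> ht; apply: le_trans (ler_norm_sum _ _ _) _.
  have Kw : 0 <= K * weight t by apply: le_trans (hf i t ht).
  apply: (@le_trans _ _ (\sum_j `|M i j t| * (K * weight t))).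
    by apply: ler_sum => j _; rewrite normrM ler_wpM2l// hf.
  by rewrite -mulr_suml ler_wpM2r.
have [x0|x0] := leP 0 x.
  rewrite /weight (ger0_norm x0); apply: weight_bound => //.
    exact: rhs_cont.
  move=> t /andP[t0 tx]; have := hb t; rewrite /weight (ger0_norm t0); apply.
  by rewrite (le_trans p0 t0) (le_trans tx).
have -> : volterra f i x = - prim (fun t => \sum_j M i j (- t) * f j (- t)) (- x).
  apply/eqP; rewrite eq_sym eqr_oppLR; apply/eqP.
  rewrite -{2}[x]opprK; apply: (@prim_eq _ _ (fun y => - volterra f i (- y))).
  - apply: (@cont_comp _ _ (fun t => - t) (@rhs_cont f i cf)).
    by apply: contN => t; exact: cvg_id.
  - move=> y; have d1 := prim_der (@rhs_cont f i cf) (- y).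
    have d2 := @dercomp _ (volterra f i) (fun t => - t) y _ _ d1 (derN (derid y)).
    by apply: (der_eq (derN d2)); ring.
  - by rewrite oppr0 /volterra prim0 oppr0.
rewrite normrN /weight (ltr0_norm x0); apply: weight_bound; first lra.
  apply: (@cont_comp _ _ (fun t => - t) (@rhs_cont f i cf)).
  by apply: contN => t; exact: cvg_id.
move=> t /andP[t0 tx]; have := hb (- t); rewrite /weight normrN (ger0_norm t0).
by apply; apply/andP; split; lra.
Qed.

(** By [volterra_half], the bound on a fixed point can be halved indefinitely. *)
Lemma volterra_zero f p q : p <= 0 -> 0 <= q -> (forall j, continuous (f j)) ->
  (forall i x, p <= x <= q -> f i x = volterra f i x) ->
  forall i x, p <= x <= q -> f i x = 0.
Proof.
move=> p0 q0 cf hf i x hx.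
have [K [K0 hK]] := cont_bounded_fin p q cf.
have main n : forall j t, p <= t <= q -> `|f j t| <= K * 2^-1 ^+ n * weight t.
  elim: n => [|n ih] j t ht.
    rewrite expr0 mulr1; apply: le_trans (hK j t ht) _.
    by rewrite ler_peMr.
  rewrite hf//; have := volterra_half p0 q0 cf ih j ht.
  by rewrite exprS; congr (_ <= _); ring.
apply: (@le_geo_eq0 _ (K * weight x)) => n; rewrite mulrAC; exact: main.
Qed.

Section Picard.
Variable H : I -> R -> R.
Hypothesis H_cont : forall i, continuous (H i).

Let picard n : I -> R -> R :=
  iter n (fun f i x => H i x + volterra f i x) (fun _ _ => 0).

Let picard_cont n i : continuous (picard n i).
Proof.
elim: n i => [|n ih] i /=; first exact: contC.
by apply: contD => //; exact: volterra_cont.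
Qed.

Let picard_step p q K : p <= 0 -> 0 <= q ->
  (forall i x, p <= x <= q -> `|H i x| <= K) ->
  forall n i x, p <= x <= q ->
    `|picard n.+1 i x - picard n i x| <= K * weight x * 2^-1 ^+ n.
Proof.
move=> p0 q0 hH; elim=> [|n ih] i x hx.
  have -> : picard 1 i x - picard 0 i x = H i x.
    rewrite /picard/= subr0 -[RHS]addr0; congr (_ + _).
    apply: (@prim_eq _ _ (fun _ : R => 0 : R)) => //.
    - by apply: rhs_cont => j; exact: contC.
    - move=> y; apply: (der_eq (derC 0 y)); apply/esym/big1 => j _; exact: mulr0.
  rewrite expr0 mulr1; apply: le_trans (hH i x hx) _.
  have K0 : 0 <= K by apply: le_trans (hH i x hx).
  by rewrite ler_peMr.
have -> : picard n.+2 i x - picard n.+1 i x =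
    volterra (fun j t => picard n.+1 j t - picard n j t) i x.
  by rewrite (@volterraB (picard n.+1) (picard n) i x (@picard_cont n.+1) (@picard_cont n))/=; ring.
have h := @volterra_half (fun j t => picard n.+1 j t - picard n j t) p q
  (K * 2^-1 ^+ n) p0 q0 _ _ i x hx.
rewrite (le_trans (h _ _))//.
- by move=> j; exact: contB.
- by move=> j t ht; rewrite mulrAC; exact: ih.
- by rewrite exprS le_eqVlt; apply/orP; left; apply/eqP; field.
Qed.

(** The Picard iterates converge geometrically on compact intervals, again by
    [volterra_half]; the bound on the limit is that on the partial sums. *)
Lemma volterra_solution : exists Y, [/\ forall i, continuous (Y i),
  forall i x, Y i x = H i x + volterra Y i x &
  forall p q K, p <= 0 -> 0 <= q -> (forall i x, p <= x <= q -> `|H i x| <= K) ->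
    forall i x, p <= x <= q -> `|Y i x| <= 2 * K * weight x].
Proof.
have /choice[Y hY] : forall ix : I * R, exists l, forall K,
    (forall n, `|picard n.+1 ix.1 ix.2 - picard n ix.1 ix.2| <= K * 2^-1 ^+ n) ->
    forall n, `|l - picard n ix.1 ix.2| <= 2 * K * 2^-1 ^+ n.
  move=> [i x] /=.
  have [K [K0 hK]] := cont_bounded_fin (- `|x|) `|x| H_cont.
  apply: (@geo_lim _ (K * weight x)) => n.
  apply: (@picard_step (- `|x|) `|x|); rewrite ?oppr_le0 ?normr_ge0//.
  by rewrite -ler_norml.
have est p q K : p <= 0 -> 0 <= q -> (forall i x, p <= x <= q -> `|H i x| <= K) ->
    forall n i x, p <= x <= q -> `|Y (i, x) - picard n i x| <= 2 * (K * weight x) * 2^-1 ^+ n.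
  move=> p0 q0 hH n i x hx; apply: (hY (i, x) (K * weight x)) => m /=.
  exact: (picard_step p0 q0).
have cY i : continuous (fun x => Y (i, x)).
  apply: cont_unif => r e e0.
  have [r0|r0] := ltP r 0.
    exists (fun=> 0); first exact: contC.
    by move=> y hy; exfalso; have := le_lt_trans (le_trans (normr_ge0 y) hy) r0; rewrite ltxx.
  have [K [K0 hK]] := cont_bounded_fin (- r) r H_cont.
  pose A := 2 * (K * weight r).
  have A0 : 0 <= A by rewrite mulr_ge0// mulr_ge0// expR_ge0.
  have [n hn] : exists n, A * 2^-1 ^+ n <= e.
    apply: contrapT => hne.
    have : e = 0.
      apply: (@le_geo_eq0 _ A) => n; rewrite gtr0_norm//.
      by rewrite leNgt; apply/negP => h; apply: hne; exists n; rewrite ltW.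
    by move=> ee; rewrite ee ltxx in e0.
  exists (picard n i) => // y hy.
  have yr : - r <= y <= r by rewrite -ler_norml.
  apply: le_trans hn; apply: le_trans (est _ _ K _ r0 hK n i y yr) _; first lra.
  rewrite ler_wpM2r ?exprn_ge0// /A ler_wpM2l// ler_wpM2l// /weight ler_expR.
  by rewrite ler_wpM2l// ?[`|r|]ger0_norm// mulr_ge0// ltW.
exists (fun i x => Y (i, x)); split => //.
- move=> i x; apply/eqP; rewrite -subr_eq0; apply/eqP.
  pose r := `|x|; have r0 : 0 <= r by exact: normr_ge0.
  have rN : - r <= 0 by rewrite oppr_le0.
  have [K [K0 hK]] := cont_bounded_fin (- r) r H_cont.
  have xr : - r <= x <= r by rewrite -ler_norml.
  apply: (@le_geo_eq0 _ (2 * K * weight x)) => n.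
  have -> : Y (i, x) - (H i x + volterra (fun i x => Y (i, x)) i x) =
     (Y (i, x) - picard n.+1 i x) -
       volterra (fun j t => Y (j, t) - picard n j t) i x.
    by rewrite (@volterraB (fun i x => Y (i, x)) (picard n) i x cY (@picard_cont n))/=; ring.
  apply: le_trans (ler_normB _ _) _.
  have h1 := est _ _ K rN r0 hK n.+1 i x xr.
  have h2 : `|volterra (fun j t => Y (j, t) - picard n j t) i x| <=
      (2 * K * 2^-1 ^+ n) / 2 * weight x.
    apply: (volterra_half rN r0) => // [j|j t ht]; first exact: contB.
    by have := est _ _ K rN r0 hK n j t ht; congr (_ <= _); ring.
  apply: le_trans (lerD h1 h2) _.
  by rewrite exprS le_eqVlt; apply/orP; left; apply/eqP; field.
- move=> p q K p0 q0 hK i x hx.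
  by have := est _ _ K p0 q0 hK 0 i x hx; rewrite /= subr0 expr0 mulr1 mulrA.
Qed.
End Picard.

Lemma volterra_cst0 i x : volterra (fun _ _ => 0) i x = 0.
Proof.
apply: (@prim_eq _ _ (fun _ : R => 0 : R)) => //.
- by apply: rhs_cont => j; exact: contC.
- move=> y; apply: (der_eq (derC 0 y)); apply/esym/big1 => j _; exact: mulr0.
Qed.

Lemma volterra_lin f (J : finType) (g : J -> I -> R -> R) (c : J -> R) i x :
  (forall j, continuous (f j)) -> (forall a j, continuous (g a j)) ->
  volterra (fun j t => f j t + \sum_a c a * g a j t) i x =
  volterra f i x + \sum_a c a * volterra (g a) i x.
Proof.
move=> cf cg.
apply: (@prim_eq _ _ (fun y => volterra f i y + \sum_a c a * volterra (g a) i y)).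
- apply: rhs_cont => j; apply: contD => //; apply: cont_sum => a.
  by apply: contM => //; exact: contC.
- move=> y; have h1 := prim_der (@rhs_cont f i cf) y.
  have h2 a := derScale (c a) (prim_der (@rhs_cont (g a) i (cg a)) y).
  apply: (der_eq (derD h1 (der_sum h2))).
  under [X in _ + X = _]eq_bigr do rewrite mulr_sumr.
  rewrite exchange_big -big_split/=; apply: eq_bigr => j _.
  by rewrite mulrDr mulr_sumr; congr (_ + _); apply: eq_bigr => a _; ring.
- rewrite /volterra prim0 big1 ?addr0// => a _; by rewrite prim0 mulr0.
Qed.

(** The Fredholm alternative for the periodic boundary value problem. By
    superposition, periodicity is a square linear system in the initial values,
    whose matrix is the monodromy matrix minus the identity. *)
Lemma periodic_alternative (L : R) : 0 < L ->
  (exists v Z, [/\ forall i, continuous (Z i), exists i, v i != 0,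
     forall i x, Z i x = v i + volterra Z i x & forall i, Z i L = v i]) \/
  (exists2 K, 0 <= K & forall H h, (forall i, continuous (H i)) ->
     (forall i, H i 0 = 0) -> (forall i x, 0 <= x <= L -> `|H i x| <= h) ->
     exists v Y, [/\ forall i, continuous (Y i),
       forall i x, Y i x = v i + H i x + volterra Y i x,
       forall i, Y i L = v i &
       forall i x, 0 <= x <= L -> `|Y i x| <= K * h]).
Proof.
move=> L0.
have /choice[E hE] := fun j : I => volterra_solution (H := fun i _ => (i == j)%:R)
  (fun i => @contC _ _).
have cE a i : continuous (E a i) by case: (hE a).
have eE a i x : E a i x = (i == a)%:R + volterra (E a) i x by case: (hE a).
pose n := #|I|.
pose D : 'M[R]_n := \matrix_(a, b) (E (enum_val b) (enum_val a) L - (a == b)%:R).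
have comb (f : I -> R) i x : \sum_b f b * E b i x =
    f i + \sum_b f b * volterra (E b) i x.
  under eq_bigr do rewrite eE mulrDr.
  rewrite big_split/= (bigD1 i)//= eqxx mulr1 big1 ?addr0// => b bi.
  by rewrite eq_sym (negbTE bi) mulr0.
have sumD (f : I -> R) i : \sum_b f b * E b i L - f i =
    (D *m (\col_b f (enum_val b))) (enum_rank i) 0.
  rewrite mxE (reindex_onto (fun b : 'I_n => enum_val b) enum_rank)/=; last first.
    by move=> b _; rewrite enum_rankK.
  under eq_bigl do rewrite enum_valK eqxx.
  under [RHS]eq_bigr do rewrite !mxE enum_rankK.
  have {1}-> : f i = \sum_(b < n) (enum_rank i == b)%:R * f (enum_val b).
    rewrite (bigD1 (enum_rank i))//= eqxx mul1r enum_rankK big1 ?addr0// => b bi.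
    by rewrite eq_sym (negbTE bi) mul0r.
  by rewrite -sumrB; apply: eq_bigr => b _; ring.
have [Du|Du] := boolP (D \in unitmx); [right|left]; last first.
  have : kermx D^T != 0 by rewrite kermx_eq0 row_free_unit unitmx_tr.
  move=> /rowV0Pn[v /sub_kermxP vD v0].
  have Dv : D *m v^T = 0 by rewrite -[D]trmxK -trmx_mul vD trmx0.
  pose f i := v 0 (enum_rank i).
  have fv : \col_b f (enum_val b) = v^T.
    by apply/matrixP => a b; rewrite !mxE /f enum_valK (ord1 b).
  exists f, (fun i x => \sum_b f b * E b i x); split.
  - by move=> i; apply: cont_sum => b; apply: contM => //; exact: contC.
  - apply: contrapT => hne; move/eqP: v0; apply; apply/rowP => b; rewrite mxE.
    apply/eqP/negP => /negP vb; apply: hne; exists (enum_val b).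
    by rewrite /f enum_valK.
  - move=> i x; rewrite comb; congr (_ + _).
    have := @volterra_lin (fun _ _ => 0) I E f i x (fun j => @contC _ _) cE.
    rewrite volterra_cst0 add0r => <-; congr volterra.
    by apply/funext => j; apply/funext => t; rewrite add0r.
  - by move=> i; apply/eqP; rewrite -subr_eq0 sumD fv Dv mxE.
have [A [A0 hA]] : exists A, 0 <= A /\ forall b i x, 0 <= x <= L -> `|E b i x| <= A.
  have [A [A0 hA]] := @cont_bounded_fin R (I * I)%type (fun bi => E bi.1 bi.2) 0 L
    (fun bi => cE _ _).
  by exists A; split => // b i x; exact: (hA (b, i)).
pose w := 2 * weight L; have w0 : 0 <= w by rewrite mulr_ge0// expR_ge0.
pose S := \sum_b \sum_(c < n) `|invmx D (enum_rank b) c|.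
have S0 : 0 <= S by apply: sumr_ge0 => b _; apply: sumr_ge0.
exists (w + S * w * A); first by apply: addr_ge0 => //; apply: mulr_ge0 => //; exact: mulr_ge0.
move=> H h cH H0 hH.
have [P [cP eP bP]] := volterra_solution cH.
have hP i x : 0 <= x <= L -> `|P i x| <= w * h.
  move=> hx; have h0 : 0 <= h by apply: le_trans (hH i x hx).
  apply: le_trans (bP 0 L h (lexx _) (ltW L0) hH i x hx) _.
  rewrite /w mulrAC ler_wpM2r// ler_wpM2l// /weight ler_expR.
  case/andP: hx => x0 xL.
  by rewrite ler_wpM2l ?mulr_ge0 ?(ltW C_gt0)// (ger0_norm x0) (ger0_norm (ltW L0)).
pose vv : 'cV[R]_n := - (invmx D *m \col_c P (enum_val c) L).
pose v i := vv (enum_rank i) 0.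
have colv : \col_b v (enum_val b) = vv.
  by apply/matrixP => a b; rewrite mxE /v enum_valK (ord1 b).
exists v, (fun i x => P i x + \sum_b v b * E b i x); split.
- move=> i; apply: contD => //; apply: cont_sum => b; apply: contM => //.
  exact: contC.
- by move=> i x; rewrite volterra_lin// comb eP; ring.
- move=> i; apply/eqP; rewrite -subr_eq0 -addrA sumD colv /vv mulmxN mulKVmx//.
  by rewrite !mxE enum_rankK subrr.
- move=> i x hx; have h0 : 0 <= h by apply: le_trans (hH i x hx).
  rewrite mulrDl; apply: le_trans (ler_normD _ _) _; apply: lerD; first exact: hP.
  apply: le_trans (ler_norm_sum _ _ _) _.
  have LL : 0 <= L <= L by rewrite lexx ltW.
  rewrite /S !mulr_suml; apply: ler_sum => b _; rewrite normrM.
  have -> : (\sum_(c < n) `|invmx D (enum_rank b) c|) * w * A * h =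
    (\sum_(c < n) `|invmx D (enum_rank b) c|) * (w * h) * A by ring.
  apply: ler_pM => //; last exact: hA.
  rewrite /v /vv !mxE normrN; apply: le_trans (ler_norm_sum _ _ _) _.
  rewrite mulr_suml; apply: ler_sum => c _; rewrite !mxE normrM ler_wpM2l//.
  exact: hP.
Qed.

End LinearSystems.

Section SecondOrderSystems.
Context {R : realType} {J : finType}.
Variables (N : J -> J -> R -> R) (C0 : R).
Hypothesis N_cont : forall i j, continuous (N i j).
Hypothesis N_le : forall i j x, `|N i j x| <= C0.
Implicit Types (u v H : J -> R -> R) (p q x y : R) (al be : J -> R).

(** A system u'' = N u + h is the first order system for (u, u'), indexed by
    [bool * J] with [false] for u and [true] for u'. *)
Let M (i j : bool * J) x : R :=
  if i.1 then (if j.1 then 0 else N i.2 j.2 x)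
  else (if j.1 then (i.2 == j.2)%:R else 0).

Let C := (1 + `|C0|) * #|{: bool * J}|%:R + 1.

Let C_gt0 : 0 < C.
Proof. by rewrite ltr_wpDl// mulr_ge0// addr_ge0. Qed.

Let M_cont i j : continuous (M i j).
Proof.
rewrite /M; case: i.1; case: j.1; try exact: contC; exact: N_cont.
Qed.

Let M_le i x : \sum_j `|M i j x| <= C.
Proof.
apply: (@le_trans _ _ (\sum_(j : bool * J) (1 + `|C0|))); last first.
  by rewrite sumr_const -[X in X <= _]mulr_natr /C lerDl.
apply: ler_sum => j _; have c0 := normr_ge0 C0; have c1 := ler_norm C0.
rewrite /M; case: i.1; case: j.1; rewrite ?normr0 ?addr_ge0//.
  by have := N_le i.2 j.2 x; lra.
by rewrite normr_nat; case: eqP => _; rewrite ?mulr1n ?mulr0n; lra.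
Qed.

Let join u v (i : bool * J) : R -> R := if i.1 then v i.2 else u i.2.

Let volterra_join u v i : volterra M (join u v) i =
  if i.1 then prim (fun t => \sum_j N i.2 j t * u j t) else prim (v i.2).
Proof.
have sumE t : \sum_j M i j t * join u v j t =
    if i.1 then \sum_j N i.2 j t * u j t else v i.2 t.
  rewrite -(pair_bigA _ (fun a j => M i (a, j) t * join u v (a, j) t))/= big_bool.
  rewrite /M /join/=; case: i.1.
    by rewrite big1 ?add0r// => j _; rewrite mul0r.
  rewrite (bigD1 i.2)//= eqxx mul1r big1 ?addr0; last first.
    by move=> j ji; rewrite eq_sym (negbTE ji) mul0r.
  by rewrite big1 ?addr0// => j _; rewrite mul0r.
rewrite /volterra; apply/funext => x.
have -> : (fun t => \sum_j M i j t * join u v j t) =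
  (fun t => if i.1 then \sum_j N i.2 j t * u j t else v i.2 t).
  by apply/funext => t; exact: sumE.
by case: i.1.
Qed.

Let split_join (Y : bool * J -> R -> R) :
  Y = join (fun j => Y (false, j)) (fun j => Y (true, j)).
Proof. by apply/funext => -[[] j]. Qed.

Lemma second_order_zero u v p q : p <= 0 -> 0 <= q ->
  (forall i, continuous (u i)) -> (forall i, continuous (v i)) ->
  (forall i x, p <= x <= q -> u i x = prim (v i) x) ->
  (forall i x, p <= x <= q -> v i x = prim (fun t => \sum_j N i j t * u j t) x) ->
  forall i x, p <= x <= q -> u i x = 0 /\ v i x = 0.
Proof.
move=> p0 q0 cu cv hu hv i x hx.
have cj k : continuous (join u v k) by rewrite /join; case: k.1.
have h k t : p <= t <= q -> join u v k t = volterra M (join u v) k t.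
  by move=> ht; rewrite volterra_join /join; case: k.1; [exact: hv|exact: hu].
have z := volterra_zero M_cont C_gt0 M_le p0 q0 cj h.
by split; [exact: (z (false, i))|exact: (z (true, i))].
Qed.

Lemma second_order_ivp al be : exists u v, [/\ forall i, continuous (u i),
  forall i, continuous (v i), forall i x, u i x = al i + prim (v i) x &
  forall i x, v i x = be i + prim (fun t => \sum_j N i j t * u j t) x].
Proof.
pose H (i : bool * J) (x : R) := if i.1 then be i.2 else al i.2.
have cH i : continuous (H i) by rewrite /H; case: i.1; exact: contC.
have [Y [cY eY _]] := volterra_solution M_cont C_gt0 M_le cH.
exists (fun j => Y (false, j)), (fun j => Y (true, j)); split => // i x.
  by rewrite eY [in LHS](split_join Y) volterra_join.
by rewrite eY [in LHS](split_join Y) volterra_join.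
Qed.

(** The right-hand side enters through its primitive H, so that it may later be
    merely square integrable. *)
Lemma second_order_alternative (L : R) : 0 < L ->
  (exists u v al be, [/\ forall i, continuous (u i) /\ continuous (v i),
     exists i, (al i != 0) \/ (be i != 0),
     forall i x, u i x = al i + prim (v i) x,
     forall i x, v i x = be i + prim (fun t => \sum_j N i j t * u j t) x &
     forall i, u i L = al i /\ v i L = be i]) \/
  (exists2 K, 0 <= K & forall H h, (forall i, continuous (H i)) ->
     (forall i, H i 0 = 0) -> (forall i x, 0 <= x <= L -> `|H i x| <= h) -> 0 <= h ->
     exists u v al be, [/\ forall i, continuous (u i) /\ continuous (v i),
       forall i x, u i x = al i + prim (v i) x,
       forall i x, v i x = be i + H i x + prim (fun t => \sum_j N i j t * u j t) x,
       forall i, u i L = al i /\ v i L = be i &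
       forall i x, 0 <= x <= L -> `|u i x| <= K * h]).
Proof.
move=> L0; have [|] := periodic_alternative M_cont C_gt0 M_le L0.
  move=> [a [Z [cZ [i0 ai0] eZ pZ]]]; left.
  exists (fun j => Z (false, j)), (fun j => Z (true, j)),
    (fun j => a (false, j)), (fun j => a (true, j)); split => //.
  - by exists i0.2; case: i0 ai0 => -[] j h; [right|left].
  - by move=> i x; rewrite eZ [in LHS](split_join Z) volterra_join.
  - by move=> i x; rewrite eZ [in LHS](split_join Z) volterra_join.
move=> [K K0 hK]; right; exists K => // H h cH H0 hH h0.
have [] := hK (fun i => if i.1 then H i.2 else fun=> 0) h.
- by move=> i; case: i.1 => //; exact: contC.
- by move=> i; case: i.1.
- by move=> i x hx; case: i.1; [exact: hH|rewrite normr0].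
move=> a [Y [cY eY pY bY]].
exists (fun j => Y (false, j)), (fun j => Y (true, j)),
  (fun j => a (false, j)), (fun j => a (true, j)); split => //.
- by move=> i x; rewrite eY [in LHS](split_join Y) volterra_join/= addr0.
- by move=> i x; rewrite eY [in LHS](split_join Y) volterra_join.
- by move=> i x hx; exact: bY.
Qed.

End SecondOrderSystems.

(** * Jacobi elliptic functions *)

Section EllipticFunctions.
Context {R : realType}.
Implicit Types x y u : R.

(** The functions sn, cn, dn of modulus [k], characterized by their differential
    system; the complete integral [K] is the quarter period. *)
Record jacobi_triple (k K : R) (s c d : R -> R) : Prop := {
  jacobi_K_gt0 : 0 < K;
  jacobi_der_s : forall x : R, is_derive x 1 s (c x * d x);
  jacobi_der_c : forall x : R, is_derive x 1 c (- (s x * d x));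
  jacobi_der_d : forall x : R, is_derive x 1 d (- (k ^+ 2 * (s x * c x)));
  jacobi_sc : forall x, c x ^+ 2 = 1 - s x ^+ 2;
  jacobi_sd : forall x, d x ^+ 2 = 1 - k ^+ 2 * s x ^+ 2;
  jacobi_d_gt0 : forall x, 0 < d x;
  jacobi_sN : forall x, s (- x) = - s x;
  jacobi_cN : forall x, c (- x) = c x;
  jacobi_dN : forall x, d (- x) = d x;
  jacobi_sP : forall x, s (x + 2 * K) = - s x;
  jacobi_cP : forall x, c (x + 2 * K) = - c x;
  jacobi_dP : forall x, d (x + 2 * K) = d x;
  jacobi_s_gt0 : forall x, 0 < x < K -> 0 < s x;
  jacobi_c_gt0 : forall x, 0 < x < K -> 0 < c x;
  jacobi_s0 : s 0 = 0;
  jacobi_c0 : c 0 = 1;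
  jacobi_sK : s K = 1 }.

Variable k : R.
Hypothesis k2_lt1 : k ^+ 2 < 1.

Let q x : R := 1 - k ^+ 2 * sin x ^+ 2.

Let sin2_le1 x : sin x ^+ 2 <= 1.
Proof. by have := cos2Dsin2 x; have := sqr_ge0 (cos x); lra. Qed.

Let q_gt0 x : 0 < q x.
Proof.
rewrite /q subr_gt0; apply: le_lt_trans k2_lt1.
by rewrite -[leRHS]mulr1 ler_wpM2l// sqr_ge0.
Qed.

Let q_le1 x : q x <= 1.
Proof. by rewrite /q; have := mulr_ge0 (sqr_ge0 k) (sqr_ge0 (sin x)); lra. Qed.

Let g x : R := (Num.sqrt (q x))^-1.

Let q_der x : is_derive x 1 q (- (2 * k ^+ 2 * (sin x * cos x))).
Proof.
apply: (der_eq (derB (derC 1 x) (derScale (k ^+ 2) (derX 2 (is_derive_sin x))))).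
by rewrite expr1; ring.
Qed.

Let sq_gt0 x : 0 < Num.sqrt (q x).
Proof. by rewrite sqrtr_gt0. Qed.

Let sq_der x : is_derive x 1 (fun y => Num.sqrt (q y))
  (- (k ^+ 2 * (sin x * cos x)) / Num.sqrt (q x)).
Proof.
apply: (der_eq (dercomp (is_derive1_sqrt (q_gt0 x)) (q_der x))).
by field; rewrite gt_eqF.
Qed.

Let g_gt0 x : 0 < g x.
Proof. by rewrite invr_gt0. Qed.

Let g_ge1 x : 1 <= g x.
Proof.
rewrite /g -invr1 lef_pV2 ?posrE//.
by rewrite -[leRHS]sqrtr1 ler_wsqrtr.
Qed.

Let g_cont : continuous g.
Proof.
move=> x; apply: cvgV; first by rewrite gt_eqF.
exact: (der_cont (sq_der x)).
Qed.

Let F := prim g.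

Let FE x : ellipticF k x = F x.
Proof.
rewrite /ellipticF; have [x0|x0] := leP 0 x; first by rewrite /F prim_pos.
by rewrite /F /prim (Rint_rev _ x0) sub0r.
Qed.

Let F_der x : is_derive x 1 F (g x).
Proof. exact: prim_der. Qed.

Let F_cont : continuous F.
Proof. exact: (der_contT F_der). Qed.

Let F0 : F 0 = 0.
Proof. exact: prim0. Qed.

(* the integrand is at least 1, so F is unbounded both ways *)
Let F_expand x y : x <= y -> y - x <= F y - F x.
Proof.
have hd (z : R) : is_derive z 1 (fun t => F t - t) (g z - 1).
  exact: (derB (F_der z) (derid z)).
have h0 z : 0 <= g z - 1 by rewrite subr_ge0.
move=> xy; have := nondecrT hd h0 xy => /=; lra.
Qed.

Let F_lt x y : x < y -> F x < F y.
Proof. by move=> xy; have := F_expand (ltW xy); lra. Qed.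

Let F_inj : injective F.
Proof.
move=> x y e; have [/F_lt|/F_lt|//] := ltgtP x y; by rewrite e ltxx.
Qed.

Let F_ltE x y : (F x < F y) = (x < y).
Proof.
have [/F_lt//|h|->] := ltgtP x y; last by rewrite ltxx.
by apply/negbTE; rewrite -leNgt ltW// F_lt.
Qed.

Let F_surj u : exists x, F x = u.
Proof.
pose r := `|u|; have r0 : 0 <= r by exact: normr_ge0.
have h1 : u <= F r.
  by have := F_expand r0; have := ler_norm u; rewrite F0 -/r; lra.
have h2 : F (- r) <= u.
  have hr : - r <= 0 by lra.
  by have := F_expand hr; have := ler_norm (- u); rewrite normrN F0 -/r; lra.
have hrr : - r <= r by lra.
have [||x _ hx] := @IVT _ F (- r) r u hrr.
- by apply: continuous_subspaceT; exact: F_cont.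
- by rewrite ge_min le_max h1 h2 orbT.
- by exists x.
Qed.

Let am u := jacobi_am u k.

Let F_am u : F (am u) = u.
Proof.
have [x hx] := F_surj u.
have : [set phi | ellipticF k phi = u] (am u).
  by apply: xgetPex; exists x; rewrite /= FE.
by rewrite /= FE.
Qed.

Let am_F x : am (F x) = x.
Proof. by apply: F_inj; rewrite F_am. Qed.

Let am_der u : is_derive u 1 am (Num.sqrt (q (am u))).
Proof.
rewrite -{1}[u]F_am -[Num.sqrt _]invrK.
apply: (@is_derive_inverse R F am) => //.
- by near=> y; exact: am_F.
- by near=> y; exact: F_cont.
- by rewrite gt_eqF// g_gt0.
Unshelve. all: by end_near. Qed.

Let sinDpi x : sin (x + pi) = - sin x.
Proof. by rewrite [pi]splitr addrA sinDpihalf cosDpihalf. Qed.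

Let cosDpi x : cos (x + pi) = - cos x.
Proof. by rewrite [pi]splitr addrA cosDpihalf sinDpihalf. Qed.

Let FN x : F (- x) = - F x.
Proof.
have h (z : R) : is_derive z 1 (fun t => F (- t) + F t) 0.
  have d1 := @dercomp _ F (fun t => - t) z _ _ (F_der (- z)) (derN (derid z)).
  apply: (der_eq (derD d1 (F_der z))).
  by rewrite /g /q sinN sqrrN; ring.
have := is_derive_0_is_cst x 0 h.
by rewrite oppr0 F0 addr0 => /eqP; rewrite addr_eq0 => /eqP.
Qed.

Let FP x : F (x + pi) = F x + 2 * F (pi / 2).
Proof.
have h (z : R) : is_derive z 1 (fun t => F (t + pi) - F t) 0.
  have d1 := @dercomp _ F (fun t => t + pi) z _ _ (F_der (z + pi)) (derD (derid z) (derC pi z)).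
  apply: (der_eq (derB d1 (F_der z))).
  by rewrite /g /q sinDpi sqrrN; ring.
have e1 := is_derive_0_is_cst x (- (pi / 2)) h.
have e2 : - (pi / 2) + pi = pi / 2 :> R by field.
by rewrite e2 FN in e1; lra.
Qed.

(** sn, cn and dn are sin, cos and the square root of 1 - k^2 sin^2 evaluated at
    the amplitude, whose derivative is dn because it inverts [ellipticF]. *)
Lemma jacobi_triple_am : exists s d,
  jacobi_triple k (ellipticK k) s (fun u => jacobi_cn u k) d.
Proof.
exists (fun u => sin (am u)), (fun u => Num.sqrt (q (am u))).
have KE : ellipticK k = F (pi / 2) by rewrite /ellipticK FE.
have p0 := pi_gt0 R.
have K0 : 0 < F (pi / 2) by rewrite -F0 F_ltE; lra.
have amN u : am (- u) = - am u by apply: F_inj; rewrite FN !F_am.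
have amP u : am (u + 2 * F (pi / 2)) = am u + pi by apply: F_inj; rewrite FP !F_am.
have am0 : am 0 = 0 by rewrite -[X in am X]F0 am_F.
have amI u : 0 < u < F (pi / 2) -> 0 < am u < pi / 2.
  by move=> hu; rewrite -(F_ltE 0) -(F_ltE (am u)) F0 F_am.
rewrite KE /jacobi_cn -/am; split => //.
- by move=> u; exact: (dercomp (is_derive_sin _) (am_der u)).
- move=> u; apply: (der_eq (dercomp (is_derive_cos _) (am_der u))).
  by rewrite mulNr.
- move=> u; apply: (der_eq (dercomp (sq_der _) (am_der u))).
  by rewrite -/(am u); field; rewrite gt_eqF.
- by move=> u; have := cos2Dsin2 (am u); lra.
- by move=> u; rewrite sqr_sqrtr// ltW.
- by move=> u; rewrite amN sinN.
- by move=> u; rewrite -/(am _) amN cosN.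
- by move=> u; rewrite amN /q sinN sqrrN.
- by move=> u; rewrite amP sinDpi.
- by move=> u; rewrite -/(am _) amP cosDpi.
- by move=> u; rewrite amP /q sinDpi sqrrN.
- by move=> u hu; apply: sin_gt0_pihalf; exact: amI.
- move=> u hu; apply: cos_gt0_pihalf; have /andP[h1 h2] := amI _ hu.
  by rewrite h2 andbT -/(am u); lra.
- by rewrite am0 sin0.
- by rewrite -/(am 0) am0 cos0.
- by rewrite am_F sin_pihalf.
Qed.

End EllipticFunctions.

(** * Hill operators: Picone's identity and the Lame equation *)

Section Picone.
Context {R : realType}.
Implicit Types (f y v G : R -> R) (a c t x z : R).

(** The two kinds of end points at which the Picone boundary term f^2 y'/y
    vanishes: a common zero, simple for [y], or a critical point of [y]. *)
Definition picone_end f y y' t :=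
  (y t = 0 /\ f t = 0 /\ y' t != 0) \/ (y t != 0 /\ y' t = 0).

Let picone_end_limit f f' y y' t :
  (forall x, is_derive x 1 f (f' x)) -> (forall x, is_derive x 1 y (y' x)) ->
  continuous y' -> picone_end f y y' t ->
  exists r : R -> R, [/\ {for t, continuous r}, r t = 0 &
    forall z, y z != 0 -> f z ^+ 2 * y' z / y z = r z].
Proof.
move=> df dy cy' [[y0 [f0 y'0]]|[y0 y'0]].
  have [g [eg cg gt]] := (is_derive1_caratheodory f t (f' t)).1 (df t).
  have [h [eh ch ht]] := (is_derive1_caratheodory y t (y' t)).1 (dy t).
  exists (fun z => (z - t) * g z ^+ 2 * y' z / h z); split.
  - apply: cvgM; first apply: cvgM; first apply: cvgM.
    + by apply: cvgB; [exact: cvg_id|exact: cvg_cst].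
    + by rewrite expr2; under eq_fun do rewrite expr2; exact: cvgM.
    + exact: cy'.
    + by apply: cvgV => //; rewrite ht.
  - by rewrite subrr !mul0r.
  - move=> z; have := eg z; have := eh z; rewrite y0 f0 !subr0 => -> ->.
    rewrite mulf_eq0 negb_or => /andP[hz zt].
    by field; rewrite zt hz.
exists (fun z => f z ^+ 2 * y' z / y z); split => //.
- apply: cvgM; first apply: cvgM.
  + by apply: (contX (n := 2)); apply: der_contT df.
  + exact: cy'.
  + by apply: cvgV => //; exact: (der_cont (dy t)).
- by rewrite y'0 mulr0 mul0r.
Qed.

(** Picone's identity: f'^2 + v f^2 = (f' - f y'/y)^2 + (f^2 y'/y)' whenever
    y'' = v y, so the left side has nonnegative integral between end points as
    above, provided [y] has no zero in between. *)
Lemma picone f f' y y' v G a c : a < c ->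
  (forall x, is_derive x 1 f (f' x)) -> (forall x, is_derive x 1 y (y' x)) ->
  (forall x, is_derive x 1 y' (v x * y x)) ->
  (forall x, is_derive x 1 G (f' x ^+ 2 + v x * f x ^+ 2)) ->
  (forall x, a < x < c -> y x != 0) ->
  picone_end f y y' a -> picone_end f y y' c -> G a <= G c.
Proof.
move=> ac df dy dy' dG y0 ea ec.
have cy' : continuous y' by apply: der_contT dy'.
have cG : continuous G by apply: der_contT dG.
have [ra [cra ra0 era]] := picone_end_limit df dy cy' ea.
have [rc [crc rc0 erc]] := picone_end_limit df dy cy' ec.
pose B x := f x ^+ 2 * y' x / y x.
pose h x := G x - (if a < x < c then B x else 0).
have hE x : a < x < c -> h x = G x - B x by move=> hx; rewrite /h hx.
have dh x : a < x < c -> is_derive x 1 h ((f' x - f x * y' x / y x) ^+ 2).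
  move=> xac; have yx := y0 x xac.
  have d1 := derM (derM (derX 2 (df x)) (dy' x)) (derV yx (dy x)).
  have d2 := derB (dG x) d1.
  have d3 : is_derive x 1 (fun x => G x - B x) ((f' x - f x * y' x / y x) ^+ 2).
    by apply: (der_eq d2); rewrite /= expr1; field.
  apply: near_eq_is_derive d3; case/andP: xac => ax xc.
  near=> z; rewrite hE//; apply/andP; split; near: z.
    exact: lt_nbhsr.
  exact: lt_nbhsl.
have -> : G a = h a by rewrite /h ltxx subr0.
have -> : G c = h c by rewrite /h ltxx andbF subr0.
apply: (@ger0_derive1_ndecr R h a c) => //; try exact: ltW.
- by move=> x /[!in_itv]/= hx; apply: ex_derive; exact: dh.
- by move=> x /[!in_itv]/= hx; rewrite (der_val (dh x hx)) sqr_ge0.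
- apply/(continuous_within_itvP _ ac); split.
  + by move=> x /[!in_itv]/= hx; exact: (der_cont (dh x hx)).
  + have -> : h a = G a - ra a by rewrite /h ltxx ra0.
    have h1 : G x - ra x @[x --> a^'+] --> G a - ra a.
      by apply: cvgB; apply: cvg_at_right_filter; [exact: cG|exact: cra].
    apply: cvg_trans h1; apply: near_eq_cvg.
    near=> x; have hx : a < x < c by apply/andP; split; near: x; [exact: nbhs_right_gt|exact: nbhs_right_lt].
    by rewrite hE// /B era// y0.
  + have -> : h c = G c - rc c by rewrite /h ltxx andbF rc0.
    have h1 : G x - rc x @[x --> c^'-] --> G c - rc c.
      by apply: cvgB; apply: cvg_at_left_filter; [exact: cG|exact: crc].
    apply: cvg_trans h1; apply: near_eq_cvg.
    near=> x; have hx : a < x < c by apply/andP; split; near: x; [exact: nbhs_left_gt|exact: nbhs_left_lt].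
    by rewrite hE// /B erc// y0.
Unshelve. all: by end_near. Qed.

End Picone.

Section PeriodicPrimitives.
Context {R : realType}.
Variable L : R.
Implicit Types (f h : R -> R) (x y : R).

Lemma periodic_der f f' : (forall x : R, is_derive x 1 f (f' x)) ->
  Defs.periodic L f -> Defs.periodic L f'.
Proof.
move=> df pf x.
have d1 := @dercomp _ f (fun t => t + L) x _ _ (df (x + L)) (derD (derid x) (derC L x)).
have d2 : is_derive x 1 f (f' (x + L) * (1 + 0)) by apply: der_ext d1 => t; exact: pf.
by have := der_uniq d2 (df x); rewrite addr0 mulr1.
Qed.

Lemma prim_periodic h x : continuous h -> Defs.periodic L h ->
  prim h (x + L) = prim h x + prim h L.
Proof.
move=> ch ph.
have d (z : R) : is_derive z 1 (fun t => prim h (t + L) - prim h t) 0.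
  have d1 := @dercomp _ (prim h) (fun t => t + L) z _ _ (prim_der ch (z + L))
    (derD (derid z) (derC L z)).
  by apply: (der_eq (derB d1 (prim_der ch z))); rewrite ph; ring.
by have := is_derive_0_is_cst x 0 d; rewrite prim0 add0r; lra.
Qed.

Lemma prim_half h : continuous h -> Defs.periodic L h ->
  prim h L = prim (fun x => h x + h (- x)) (L / 2).
Proof.
move=> ch ph.
have chN : continuous (fun x => h (- x)).
  by apply: (cont_comp ch); apply: contN => x; exact: cvg_id.
have -> : prim (fun x => h x + h (- x)) (L / 2) = prim h (L / 2) - prim h (- (L / 2)).
  apply: (@prim_eq _ _ (fun x => prim h x - prim h (- x))); first exact: contD.
    move=> y.
    have d1 := @dercomp _ (prim h) (fun t => - t) y _ _ (prim_der ch (- y)) (derN (derid y)).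
    by apply: (der_eq (derB (prim_der ch y) d1)); ring.
  by rewrite oppr0 subrr.
have := prim_periodic (- (L / 2)) ch ph.
have -> : - (L / 2) + L = L / 2 by field.
lra.
Qed.

Lemma prim_FTC_per f f' : (forall x : R, is_derive x 1 f (f' x)) ->
  continuous f' -> Defs.periodic L f -> prim f' L = 0.
Proof. by move=> df cf pf; rewrite (prim_unique cf df) -(pf 0) add0r subrr. Qed.

End PeriodicPrimitives.

Section PeriodicHill.
Context {R : realType}.
Implicit Types (f W : R -> R) (x : R).

(** What is used of the Hill operator - b f'' + W f with period [L]: an odd
    solution [p] of the homogeneous equation, without zeros inside the half period, and an
    even eigenfunction [y] with positive eigenvalue and a single zero there. *)
Record hill_data (L b lam x2 : R) (W p p' y y' : R -> R) : Prop := {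
  hill_L : 0 < L;
  hill_b : 0 < b;
  hill_lam : 0 < lam;
  hill_W_cont : continuous W;
  hill_W_per : Defs.periodic L W;
  hill_WN : forall x, W (- x) = W x;
  hill_W_lt0 : forall x, W x < 0;
  hill_W_lb : exists C, forall x, C <= W x;
  hill_p_der : forall x : R, is_derive x 1 p (p' x);
  hill_p'_der : forall x : R, is_derive x 1 p' (W x / b * p x);
  hill_p_per : Defs.periodic L p;
  hill_pN : forall x, p (- x) = - p x;
  hill_p_neq0 : forall x, 0 < x < L / 2 -> p x != 0;
  hill_p0 : p 0 = 0;
  hill_pL : p (L / 2) = 0;
  hill_p'0 : p' 0 != 0;
  hill_p'L : p' (L / 2) != 0;
  hill_y_der : forall x : R, is_derive x 1 y (y' x);
  hill_y'_der : forall x : R, is_derive x 1 y' ((W x - lam) / b * y x);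
  hill_x2 : 0 < x2 < L / 2;
  hill_y_x2 : y x2 = 0;
  hill_y'_x2 : y' x2 != 0;
  hill_y_neq0 : forall x, 0 <= x <= L / 2 -> x != x2 -> y x != 0;
  hill_y'0 : y' 0 = 0;
  hill_y'L : y' (L / 2) = 0 }.

Variables (L b lam x2 : R) (W p p' y y' : R -> R).
Hypothesis hd : hill_data L b lam x2 W p p' y y'.

Definition hill_density f f' x := b * f' x ^+ 2 + W x * f x ^+ 2.

(** The form of the operator is nonnegative on the hyperplane f(x2)+f(-x2) = 0,
    and strictly so in the direction of even functions: by parity it is enough to
    integrate over the half period, and Picone's identity applies to the even
    part with [y] (on both sides of its zero) and to the odd part with [p]. *)
Lemma hill_form_bound f f' : (forall x : R, is_derive x 1 f (f' x)) ->
  continuous f' -> Defs.periodic L f -> f x2 + f (- x2) = 0 ->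
  lam * prim (fun x => (f x + f (- x)) ^+ 2) (L / 2) <=
  2 * prim (hill_density f f') L.
Proof.
case: hd => L0 b0 lam0 cW pW WN _ _ dp dp' pp pN p0 pz pL p'0 p'L dy dy' /andP[x20 x2L]
  yx2 y'x2 yn0 y'0 y'L.
move=> df cf' pf fx2.
have cf := der_contT df.
have pf' := periodic_der df pf.
have b0' : b != 0 by rewrite gt_eqF.
pose e x := f x + f (- x); pose e' x := f' x - f' (- x).
pose o x := f x - f (- x); pose o' x := f' x + f' (- x).
have dfN (x : R) : is_derive x 1 (fun t => f (- t)) (- f' (- x)).
  by apply: (der_eq (@dercomp _ f (fun t => - t) x _ _ (df (- x)) (derN (derid x)))); ring.
have de (x : R) : is_derive x 1 e (e' x) by exact: (derD (df x) (dfN x)).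
have dO (x : R) : is_derive x 1 o (o' x).
  by apply: (der_eq (derB (df x) (dfN x))); rewrite opprK.
have cN (h : R -> R) : continuous h -> continuous (fun x => h (- x)).
  by move=> ch; apply: (cont_comp ch); apply: contN => x; exact: cvg_id.
have ce := der_contT de; have co := der_contT dO.
have ce' : continuous e' by apply: contB => //; exact: cN.
have co' : continuous o' by apply: contD => //; exact: cN.
pose ge x := e' x ^+ 2 + (W x - lam) / b * e x ^+ 2.
pose go x := o' x ^+ 2 + W x / b * o x ^+ 2.
have cge : continuous ge.
  apply: contD; first exact: contX.
  apply: contM; last exact: contX.
  by apply: contM; [apply: contB => //; exact: contC|exact: contC].
have cgo : continuous go.
  apply: contD; first exact: contX.
  apply: contM; last exact: contX.
  by apply: contM => //; exact: contC.
have L20 : 0 < L / 2 by lra.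
have ge1 : prim ge 0 <= prim ge x2.
  apply: (picone x20 de dy dy' (prim_der cge)).
  - move=> x /andP[h1 h2]; apply: yn0; last by rewrite lt_eqF.
    by rewrite ltW//= ltW// (lt_trans h2).
  - right; split => //; apply: yn0; first by rewrite lexx ltW.
    by rewrite lt_eqF.
  - by left.
have ge2 : prim ge x2 <= prim ge (L / 2).
  apply: (picone x2L de dy dy' (prim_der cge)).
  - move=> x /andP[h1 h2]; apply: yn0; last by rewrite gt_eqF.
    by rewrite (ltW h2) andbT ltW// (lt_trans x20).
  - by left.
  - right; split => //; apply: yn0; first by rewrite lexx ltW.
    by rewrite gt_eqF.
have go1 : prim go 0 <= prim go (L / 2).
  apply: (picone L20 dO dp dp' (prim_der cgo)) => //.
    by left; rewrite /o oppr0 subrr.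
  left; split => //; split => //; rewrite /o -(pf (- (L / 2))).
  have -> : - (L / 2) + L = L / 2 by field.
  by rewrite subrr.
rewrite (prim0 ge) in ge1; rewrite (prim0 go) in go1.
pose hdens := hill_density f f'.
have chd : continuous hdens.
  apply: contD; first by apply: contM; [exact: contC|exact: contX].
  by apply: contM => //; exact: contX.
have phd : Defs.periodic L hdens.
  by move=> x; rewrite /hdens /hill_density pf' pW pf.
rewrite (prim_half chd phd).
have eq1 : (fun x => hdens x + hdens (- x)) =
    (fun x => b / 2 * (ge x + go x) + lam / 2 * e x ^+ 2).
  apply/funext => x; rewrite /hdens /hill_density WN /ge /go /e' /o' /e /o.
  by field.
have ce2 : continuous (fun x => e x ^+ 2) by exact: contX.
have cgg : continuous (fun x => ge x + go x) by exact: contD.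
rewrite eq1 (@primD _ (fun x => b / 2 * (ge x + go x))).
- rewrite (primZ _ _ (cont_locint cgg)) (primZ _ _ (cont_locint ce2)).
  rewrite (primD _ (cont_locint cge) (cont_locint cgo)).
  have : 0 <= b / 2 * (prim ge (L / 2) + prim go (L / 2)).
    by apply: mulr_ge0; lra.
  rewrite -/e; lra.
- by apply: locintZ; exact: cont_locint.
- by apply: locintZ; exact: cont_locint.
Qed.

End PeriodicHill.

Section LameEquation.
Context {R : realType}.
Implicit Types x : R.
Variables (k K L b : R) (s c d : R -> R).
Hypotheses (jt : jacobi_triple k K s c d) (L0 : 0 < L) (b0 : 0 < b).
Hypotheses (k0 : 0 < k) (k2 : k ^+ 2 < 1 / 2).

Let kap := 2 * K / L.

(** The Lame potential 12 k^2 sn^2, shifted so that sn cn dn is in the kernel. *)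
Definition lame_potential x :=
  b * kap ^+ 2 * (12 * k ^+ 2 * s (kap * x) ^+ 2 - 4 - 4 * k ^+ 2).

Definition lame_kernel x := s (kap * x) * c (kap * x) * d (kap * x).

(** The even Lame function dn (1 - alpha sn^2) has eigenvalue k^2 + 2 alpha when
    alpha^2 - (2 + 4 k^2) alpha + 5 k^2 = 0; the larger root is taken, which makes
    the function change sign once on the half period. *)
Let disc := Num.sqrt (1 - k ^+ 2 + 4 * k ^+ 4).
Let alpha := 1 + 2 * k ^+ 2 + disc.

Lemma lame_hill_data : exists p' y y' x2 lam,
  hill_data L b lam x2 lame_potential lame_kernel p' y y'.
Proof.
case: jt => K0 ds dc dd sc sd dpos sN cN dN sP cP dP spos cpos s0 c0 sK.
have L0' : L != 0 by rewrite gt_eqF.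
have K0' : K != 0 by rewrite gt_eqF.
have kap0 : 0 < kap by rewrite /kap; apply: divr_gt0 => //; lra.
have kapL x : kap * (x + L) = kap * x + 2 * K by rewrite /kap; field.
have kapL2 : kap * (L / 2) = K by rewrite /kap; field.
have dk x : is_derive x 1 (fun t => kap * t) (kap * 1) := derScale kap (derid x).
have dS x : is_derive x 1 (fun t => s (kap * t)) _ := dercomp (ds (kap * x)) (dk x).
have dC x : is_derive x 1 (fun t => c (kap * t)) _ := dercomp (dc (kap * x)) (dk x).
have dD x : is_derive x 1 (fun t => d (kap * t)) _ := dercomp (dd (kap * x)) (dk x).
have d4 : 0 < 1 - k ^+ 2 + 4 * k ^+ 4.
  by have := exprn_gt0 4 k0; have := k2; lra.
have disc2 : disc ^+ 2 = 1 - k ^+ 2 + 4 * k ^+ 4 by rewrite sqr_sqrtr// ltW.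
have disc0 : 0 < disc by rewrite sqrtr_gt0.
have k20 : 0 < k ^+ 2 by rewrite exprn_gt0.
have alpha1 : 1 < alpha by rewrite /alpha; lra.
have alphaE : alpha ^+ 2 = (2 + 4 * k ^+ 2) * alpha - 5 * k ^+ 2.
  by rewrite /alpha sqrrD disc2; ring.
pose lam0 := 2 * disc - 2 + k ^+ 2.
have lam0p : 0 < lam0.
  have : (1 - k ^+ 2 / 2) ^+ 2 < disc ^+ 2.
    rewrite disc2; have -> : (1 - k ^+ 2 / 2) ^+ 2 = 1 - k ^+ 2 + k ^+ 4 / 4 by field.
    by have := exprn_gt0 4 k0; lra.
  rewrite ltr_pXn2r ?nnegrE ?ltW//; last by have := k2; lra.
  by rewrite /lam0; lra.
pose lam := b * kap ^+ 2 * lam0.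
have lamp : 0 < lam by rewrite mulr_gt0// mulr_gt0// exprn_gt0.
pose S x := s (kap * x); pose C x := c (kap * x); pose D x := d (kap * x).
pose p' x := kap * (C x ^+ 2 * D x ^+ 2 - S x ^+ 2 * D x ^+ 2 -
  k ^+ 2 * S x ^+ 2 * C x ^+ 2).
pose y x := D x * (1 - alpha * S x ^+ 2).
pose y' x := - kap * (S x * C x) * (k ^+ 2 + 2 * alpha - 3 * alpha * k ^+ 2 * S x ^+ 2).
have dp x : is_derive x 1 lame_kernel (p' x).
  apply: (der_eq (derM (derM (dS x) (dC x)) (dD x))).
  by rewrite /p' /S /C /D; ring.
have S2 x : S x ^+ 2 = 1 - C x ^+ 2 by rewrite /S /C sc; ring.
have D2 x : D x ^+ 2 = 1 - k ^+ 2 + k ^+ 2 * C x ^+ 2 by rewrite /D /C sd sc; ring.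
have dp' x : is_derive x 1 p' (lame_potential x / b * lame_kernel x).
  have dS2 := derX 2 (dS x); have dC2 := derX 2 (dC x); have dD2 := derX 2 (dD x).
  have d1 := derM dC2 dD2; have d2 := derM dS2 dD2.
  have d3 := derM (derScale (k ^+ 2) dS2) dC2.
  apply: (der_eq (derScale kap (derB (derB d1 d2) d3))).
  rewrite /= !expr1 /lame_potential /lame_kernel -/(S x) -/(C x) -/(D x) D2 S2.
  have -> : C x ^+ 2 = 1 - S x ^+ 2 by rewrite S2; ring.
  by field; rewrite gt_eqF.
have dy x : is_derive x 1 y (y' x).
  apply: (der_eq (derM (dD x) (derB (derC 1 x) (derScale alpha (derX 2 (dS x)))))).
  rewrite /= !expr1 /y' -/(S x) -/(C x) -/(D x).
  have e : D x * (0 - alpha * (2%:R * S x * (C x * D x * (kap * 1)))) =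
    - (2 * alpha * kap * S x * C x) * D x ^+ 2 by ring.
  by rewrite e [D x ^+ 2]sd -/(S x); ring.
pose h := k ^+ 2 + 2 * alpha.
have hE : h = 4 + 4 * k ^+ 2 + lam0 by rewrite /h /lam0 /alpha; ring.
have key : 12 * k ^+ 2 + alpha * h = 2 * h + 9 * alpha * k ^+ 2.
  by rewrite /h; move: alphaE; lra.
have dy' x : is_derive x 1 y' ((lame_potential x - lam) / b * y x).
  have d1 := derB (derC (k ^+ 2 + 2 * alpha) x)
    (derScale (3 * alpha * k ^+ 2) (derX 2 (dS x))).
  apply: (der_eq (derM (derScale (- kap) (derM (dS x) (dC x))) d1)).
  rewrite /= !expr1 /lame_potential /y -/(S x) -/(C x) -/(D x) -/h.
  have -> : (b * kap ^+ 2 * (12 * k ^+ 2 * S x ^+ 2 - 4 - 4 * k ^+ 2) - lam) / b *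
     (D x * (1 - alpha * S x ^+ 2)) =
     kap ^+ 2 * D x * (- h + S x ^+ 2 * (12 * k ^+ 2 + alpha * h) -
       12 * alpha * k ^+ 2 * S x ^+ 4).
    by rewrite hE /lam; field; rewrite gt_eqF.
  rewrite key.
  have -> : - kap * (S x * C x) * (0 - 3 * alpha * k ^+ 2 *
      (2%:R * S x * (C x * D x * (kap * 1)))) +
    (h - 3 * alpha * k ^+ 2 * S x ^+ 2) * (- kap * (S x * (- (S x * D x) *
      (kap * 1)) + C x * (C x * D x * (kap * 1)))) =
    kap ^+ 2 * D x * (6 * alpha * k ^+ 2 * S x ^+ 2 * C x ^+ 2 -
      (h - 3 * alpha * k ^+ 2 * S x ^+ 2) * (C x ^+ 2 - S x ^+ 2)) by ring.
  have -> : C x ^+ 2 = 1 - S x ^+ 2 by rewrite S2; ring.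
  by ring.
have S_le1 x : S x ^+ 2 <= 1 by rewrite S2; have := sqr_ge0 (C x); lra.
have SN x : S (- x) = - S x by rewrite /S mulrN sN.
have CN x : C (- x) = C x by rewrite /C mulrN cN.
have DN x : D (- x) = D x by rewrite /D mulrN dN.
have SP x : S (x + L) = - S x by rewrite /S kapL sP.
have CP x : C (x + L) = - C x by rewrite /C kapL cP.
have DP x : D (x + L) = D x by rewrite /D kapL dP.
have cK : c K = 0 by apply/eqP; rewrite -sqrf_eq0 sc sK expr1n subrr.
have SL : S (L / 2) = 1 by rewrite /S kapL2.
have CL : C (L / 2) = 0 by rewrite /C kapL2.
have S0 : S 0 = 0 by rewrite /S mulr0.
have C0 : C 0 = 1 by rewrite /C mulr0.
have inK x : 0 < x < L / 2 -> 0 < kap * x < K.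
  by move=> /andP[h1 h2]; rewrite mulr_gt0//= -kapL2 ltr_pM2l.
have Spos x : 0 < x < L / 2 -> 0 < S x by move=> hx; apply: spos; exact: inK.
have Cpos x : 0 < x < L / 2 -> 0 < C x by move=> hx; apply: cpos; exact: inK.
have Smono x z : 0 <= x -> x < z -> z <= L / 2 -> S x < S z.
  move=> x0 xz zL; have dS' := fun t (_ : t \in `]x, z[) => dS t.
  have cS : {within `[x, z], continuous S}.
    by apply: continuous_subspaceT; exact: (der_contT dS).
  have [t /[!in_itv]/= /andP[xt tz] e] := MVT xz dS' cS.
  rewrite -subr_gt0 e mulr_gt0 ?subr_gt0// mulr1 mulr_gt0// mulr_gt0// ?dpos//.
  by apply: Cpos; rewrite (le_lt_trans x0)//= (lt_le_trans tz).
have L2p : 0 <= L / 2 by rewrite divr_ge0// ltW.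
have Sge0 x : 0 <= x <= L / 2 -> 0 <= S x.
  move=> /andP[]; rewrite le_eqVlt => /predU1P[<-|x0 xL]; first by rewrite S0.
  by rewrite ltW// -S0 Smono.
have [x2 /[!in_itv]/= /andP[x20 x2L] hx2] :
    exists2 x2, x2 \in `[0, L / 2] & 1 - alpha * S x2 ^+ 2 = 0.
  apply: (@IVT _ (fun x => 1 - alpha * S x ^+ 2)) => //.
    apply: continuous_subspaceT; apply: contB; first exact: contC.
    apply: contM; first exact: contC.
    by apply: (contX (n := 2)); exact: (der_contT dS).
  rewrite S0 SL expr1n ge_min le_max; apply/andP; split; apply/orP.
    by right; lra.
  by left; rewrite expr0n/= mulr0 subr0 ler01.
have x20' : 0 < x2.
  rewrite lt_neqAle x20 andbT; apply/negP => /eqP e; move: hx2.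
  by rewrite -e S0; lra.
have x2L' : x2 < L / 2.
  rewrite lt_neqAle x2L andbT; apply/negP => /eqP e; move: hx2.
  by rewrite e SL; lra.
have x2in : 0 < x2 < L / 2 by rewrite x20'.
exists p', y, y', x2, lam; split => //.
- rewrite /lame_potential.
  apply: contM; first exact: contC.
  apply: contB; last exact: contC.
  apply: contB; last exact: contC.
  apply: contM; first exact: contC.
  by apply: (contX (n := 2)); exact: (der_contT dS).
- by move=> x; rewrite /lame_potential -/(S x) -/(S (x + L)) SP sqrrN.
- by move=> x; rewrite /lame_potential -/(S x) -/(S (- x)) SN sqrrN.
- move=> x; rewrite /lame_potential -/(S x) -mulrA pmulr_rlt0// pmulr_rlt0 ?exprn_gt0//.
  have : k ^+ 2 * S x ^+ 2 <= k ^+ 2 * 1 by rewrite ler_pM2l.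
  by have := k2; lra.
- exists (b * kap ^+ 2 * (0 - 4 - 4 * k ^+ 2)) => x; rewrite /lame_potential -/(S x).
  have h1 : 0 <= k ^+ 2 * S x ^+ 2 by rewrite mulr_ge0 ?sqr_ge0.
  by apply: ler_wpM2l; [exact: ltW (mulr_gt0 b0 (exprn_gt0 2 kap0))|lra].
- by move=> x; rewrite /lame_kernel -/(S (x + L)) -/(C (x + L)) -/(D (x + L)) SP CP DP mulrNN.
- move=> x; rewrite /lame_kernel -/(S (- x)) -/(C (- x)) -/(D (- x)) SN CN DN.
  by rewrite !mulNr.
- move=> x hx; rewrite gt_eqF// /lame_kernel mulr_gt0 ?dpos// mulr_gt0//.
    exact: Spos.
  exact: Cpos.
- by rewrite /lame_kernel -/(S 0) S0 !mul0r.
- by rewrite /lame_kernel -/(C (L / 2)) CL mulr0 mul0r.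
- rewrite /p' S0 C0 D2 C0 expr1n expr0n/= mulr1 subrK !mulr0 !mul0r !subr0 !mulr1.
  by rewrite gt_eqF.
- have -> : p' (L / 2) = - (kap * D (L / 2) ^+ 2) by rewrite /p' SL CL; ring.
  by rewrite oppr_eq0 mulf_neq0// ?expf_neq0// gt_eqF ?dpos.
- by rewrite /y hx2 mulr0.
- have aS : alpha * S x2 ^+ 2 = 1 by move: hx2; lra.
  have -> : y' x2 = - kap * (S x2 * C x2) * (2 * alpha - 2 * k ^+ 2).
    rewrite /y'; have -> : 3 * alpha * k ^+ 2 * S x2 ^+ 2 = 3 * k ^+ 2 * (alpha * S x2 ^+ 2).
      by ring.
    by rewrite aS; ring.
  rewrite !mulf_neq0 ?oppr_eq0 ?gt_eqF ?Spos ?Cpos//.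
  by rewrite subr_gt0; have := k2; lra.
- move=> x /andP[hx1 hx2'] xx2; rewrite /y mulf_eq0 negb_or gt_eqF ?dpos//=.
  apply: contra xx2 => /eqP e0.
  have al0 : alpha != 0 by rewrite gt_eqF// (lt_trans _ alpha1).
  have e : S x = S x2.
    apply/eqP; rewrite -(@eqrXn2 _ 2)// ?Sge0 ?hx1 ?x20//.
    by apply/eqP; apply: (mulfI al0); lra.
  apply/eqP; move: e.
  have [h1|h1|//] := ltgtP x x2 => e.
    by have := Smono _ _ hx1 h1 x2L; rewrite e ltxx.
  by have := Smono _ _ x20 h1 hx2'; rewrite e ltxx.
- by rewrite /y' S0 mul0r mulr0 mul0r.
- by rewrite /y' CL !mulr0 mul0r.
Qed.

End LameEquation.

(** * The operator on pairs of real periodic C^2 functions *)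

Section PeriodicC2.
Context {R : realType}.
Implicit Types x : R.

(** Periodic C^2 functions, bundled with their derivatives in order to serve as
    values of the operator without any differentiability side condition. *)
Record perC2 (L : R) := PerC2 {
  c2f :> R -> R; c2d : R -> R; c2dd : R -> R;
  c2_der : forall x : R, is_derive x 1 c2f (c2d x);
  c2_der2 : forall x : R, is_derive x 1 c2d (c2dd x);
  c2_cont : continuous c2dd;
  c2_per : Defs.periodic L c2f }.

Variable L : R.
Implicit Types u v : perC2 L.

Lemma c2f_cont u : continuous u. Proof. exact: der_contT (c2_der u). Qed.
Lemma c2d_cont u : continuous (c2d u). Proof. exact: der_contT (c2_der2 u). Qed.
Lemma c2d_per u : Defs.periodic L (c2d u).
Proof. exact: periodic_der (c2_der u) (c2_per u). Qed.
Lemma c2dd_per u : Defs.periodic L (c2dd u).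
Proof. exact: periodic_der (c2_der2 u) (c2d_per u). Qed.

Definition c2_lin (a : R) u (c : R) v : perC2 L := @PerC2 L
  (fun x => a * u x + c * v x) (fun x => a * c2d u x + c * c2d v x)
  (fun x => a * c2dd u x + c * c2dd v x)
  (fun x => derD (derScale a (c2_der u x)) (derScale c (c2_der v x)))
  (fun x => derD (derScale a (c2_der2 u x)) (derScale c (c2_der2 v x)))
  (contD (contM (@contC _ a) (@c2_cont _ u)) (contM (@contC _ c) (@c2_cont _ v)))
  (fun x => f_equal2 (fun s t => a * s + c * t) (c2_per u x) (c2_per v x)).

Definition c2_cst (a : R) : perC2 L := @PerC2 L (fun=> a) (fun=> 0) (fun=> 0)
  (fun x => @derC _ a x) (fun x => @derC _ 0 x) (@contC _ 0) (fun _ => erefl).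

Definition c2_sum (I : finType) (a : I -> R) (f : I -> perC2 L) : perC2 L :=
  @PerC2 L (fun x => \sum_i a i * f i x) (fun x => \sum_i a i * c2d (f i) x)
  (fun x => \sum_i a i * c2dd (f i) x)
  (fun x => der_sum (fun i => derScale (a i) (c2_der (f i) x)))
  (fun x => der_sum (fun i => derScale (a i) (c2_der2 (f i) x)))
  (cont_sum (fun i => contM (@contC _ (a i)) (@c2_cont _ (f i))))
  (fun x => eq_bigr _ (fun i _ => f_equal ( *%R (a i)) (c2_per (f i) x))).

Lemma periodic_eq0 (f : R -> R) : 0 < L -> Defs.periodic L f ->
  (forall x, 0 <= x <= L -> f x = 0) -> forall x, f x = 0.
Proof.
move=> L0 pf h x; pose m := Num.floor (x / L).
have pn (j : nat) y : f (y + L *+ j) = f y.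
  by elim: j y => [|j ih] y; rewrite ?addr0// mulrSr addrA pf ih.
have pz (j : int) y : f (y + L *~ j) = f y.
  case: j => j; first exact: pn.
  by rewrite NegzE mulrNz -[in RHS](subrK (L *~ j.+1) y) pn.
have -> : x = (x - L *~ m) + L *~ m by ring.
rewrite pz; apply: h; have := floor_itv (x / L); rewrite -/m => /andP[h1 h2].
have h3 : L * m%:~R <= x by rewrite mulrC -ler_pdivlMr.
have h4 : x < L * (m + 1)%:~R by rewrite mulrC -ltr_pdivrMr.
rewrite intrD mulrDr mulr1 in h4; rewrite -mulrzr; apply/andP; split; lra.
Qed.

End PeriodicC2.

Section PeriodicSolutions.
Context {R : realType} {J : finType}.
Variables (L : R) (N : J -> J -> R -> R) (C0 : R).
Hypothesis N_cont : forall i j, continuous (N i j).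
Hypothesis N_le : forall i j x, `|N i j x| <= C0.
Hypothesis N_per : forall i j, Defs.periodic L (N i j).

(** Matching values at 0 and [L] make the solution periodic on the whole line:
    its translate by [L] solves the same initial value problem. *)
Lemma periodic_solution (G u v : J -> R -> R) (al be : J -> R) :
  (forall i, continuous (G i)) -> (forall i, Defs.periodic L (G i)) ->
  (forall i, continuous (u i) /\ continuous (v i)) ->
  (forall i x, u i x = al i + prim (v i) x) ->
  (forall i x, v i x = be i + prim (G i) x + prim (fun t => \sum_j N i j t * u j t) x) ->
  (forall i, u i L = al i /\ v i L = be i) ->
  exists U : J -> perC2 L, forall i x, [/\ U i x = u i x, c2d (U i) x = v i x &
    c2dd (U i) x = G i x + \sum_j N i j x * u j x].
Proof.
move=> cG pG cuv eu ev bc.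
have cS i : continuous (fun t => \sum_j N i j t * u j t).
  by apply: cont_sum => j; apply: contM => //; case: (cuv j).
have du i (x : R) : is_derive x 1 (u i) (v i x).
  have d := derD (derC (al i) x) (prim_der (cuv i).2 x).
  rewrite add0r in d; apply: der_ext d => t; by rewrite eu.
have dv i (x : R) : is_derive x 1 (v i) (G i x + \sum_j N i j x * u j x).
  have d := derD (derD (derC (be i) x) (prim_der (cG i) x)) (prim_der (@cS i) x).
  rewrite add0r in d; apply: der_ext d => t; by rewrite ev.
pose d i x := u i (x + L) - u i x; pose e i x := v i (x + L) - v i x.
have sh (f f' : R -> R) (x : R) : (forall t : R, is_derive t 1 f (f' t)) ->
    is_derive x 1 (fun t => f (t + L)) (f' (x + L)).
  move=> df; have := @dercomp _ f (fun t => t + L) x _ _ (df (x + L)) (derD (derid x) (derC L x)).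
  by rewrite addr0 mulr1.
have dd i (x : R) : is_derive x 1 (d i) (e i x) by exact: (derB (sh _ _ x (du i)) (du i x)).
have de i (x : R) : is_derive x 1 (e i) (\sum_j N i j x * d j x).
  apply: (der_eq (derB (sh _ _ x (dv i)) (dv i x))).
  rewrite pG opprD addrACA subrr add0r -sumrB.
  by apply: eq_bigr => j _; rewrite N_per /d mulrBr.
have d0 i : d i 0 = 0 by rewrite /d add0r (bc i).1 eu prim0 addr0 subrr.
have e0 i : e i 0 = 0 by rewrite /e add0r (bc i).2 ev !prim0 !addr0 subrr.
have cd i := der_contT (dd i); have ce i := der_contT (de i).
have pu i : Defs.periodic L (u i).
  move=> x; have rx : 0 <= `|x| by exact: normr_ge0.
  have rx' : - `|x| <= 0 by rewrite oppr_le0.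
  have hx : - `|x| <= x <= `|x| by rewrite -ler_norml.
  have h1 i0 t : - `|x| <= t <= `|x| -> d i0 t = prim (e i0) t.
    by move=> _; rewrite (prim_unique (@ce i0) (dd i0)) d0 subr0.
  have h2 i0 t : - `|x| <= t <= `|x| ->
      e i0 t = prim (fun s => \sum_j N i0 j s * d j s) t.
    move=> _; rewrite (prim_unique _ (de i0)) ?e0 ?subr0//.
    by apply: cont_sum => j; apply: contM => //; exact: cd.
  have [h _] := second_order_zero N_cont N_le rx' rx cd ce h1 h2 i hx.
  by apply/eqP; rewrite -subr_eq0; apply/eqP.
have cG2 i : continuous (fun x => G i x + \sum_j N i j x * u j x) by exact: contD.
by exists (fun i => @PerC2 R L (u i) (v i) _ (du i) (dv i) (@cG2 i) (pu i)).
Qed.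

End PeriodicSolutions.

Section RealOperator.
Context {R : realType}.
Implicit Types x y : R.
Variables (L b w B lam x2 : R) (phi W p p' y y' : R -> R).
Hypothesis hd : hill_data L b lam x2 W p p' y y'.
Hypothesis w_lt1 : w ^+ 2 < 1.
Hypothesis B_eq : B ^+ 2 = 2 - w * B.
Hypothesis phiW : forall x, (W x - 1) * (1 - w * B) = B ^+ 2 * phi x.
Let L0 : 0 < L := hill_L hd.
Let b0 : 0 < b := hill_b hd.
Notation pair := (perC2 L * perC2 L)%type.
Implicit Types u v : pair.

Definition calT1 u x :=
  u.1 x - b * c2dd u.1 x + b * w * c2dd u.2 x + (B * phi x - w) * u.2 x.
Definition calT2 u x :=
  b * w * c2dd u.1 x + (B * phi x - w) * u.1 x + u.2 x - b * c2dd u.2 x + phi x * u.2 x.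

Definition eigenpair (z : R) u := forall x, calT1 u x = z * u.1 x /\ calT2 u x = z * u.2 x.

Definition ip u v := prim (fun x => u.1 x * v.1 x + u.2 x * v.2 x) L.
Definition form u v := prim (fun x => calT1 u x * v.1 x + calT2 u x * v.2 x) L.

Let B0 : B != 0.
Proof.
by apply/negP => /eqP e; have := B_eq; rewrite e expr0n/= mulr0 subr0; lra.
Qed.

Let B2_gt0 : 0 < B ^+ 2. Proof. by rewrite exprn_even_gt0//= B0. Qed.

Lemma one_sub_wB_gt0 : 0 < 1 - w * B.
Proof.
rewrite ltNge; apply/negP => h.
(* otherwise B^2 <= 1, against B^2 + w B = 2 *)
have B1 : B ^+ 2 <= 1 by have := B_eq; lra.
have : (w * B) ^+ 2 < 1.
  rewrite exprMn; apply: (@le_lt_trans _ _ (w ^+ 2)) => //.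
  by rewrite -[leRHS]mulr1 ler_wpM2l// sqr_ge0.
by have := B_eq; nra.
Qed.

Let phi_cont : continuous phi.
Proof.
have -> : phi = (fun x => (1 - w * B) / B ^+ 2 * (W x - 1)).
  apply/funext => x; apply: (mulfI (x := B ^+ 2)); first by rewrite expf_neq0.
  by rewrite -phiW; field.
apply: contM; first exact: contC.
by apply: contB; [exact: hill_W_cont hd|exact: contC].
Qed.

Let phi_per : Defs.periodic L phi.
Proof.
move=> x; apply: (mulfI (x := B ^+ 2)); first by rewrite expf_neq0.
by rewrite -!phiW (hill_W_per hd).
Qed.

Let T1_cont u : continuous (calT1 u).
Proof.
apply: contD; first apply: contD; first apply: contB.
- exact: c2f_cont.
- by apply: contM; [exact: contC|exact: c2_cont].
- by apply: contM; [exact: contC|exact: c2_cont].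
- apply: contM; last exact: c2f_cont.
  by apply: contB; [apply: contM => //; exact: contC|exact: contC].
Qed.

Let T2_cont u : continuous (calT2 u).
Proof.
apply: contD; first apply: contB; first apply: contD; first apply: contD.
- by apply: contM; [exact: contC|exact: c2_cont].
- apply: contM; last exact: c2f_cont.
  by apply: contB; [apply: contM => //; exact: contC|exact: contC].
- exact: c2f_cont.
- by apply: contM; [exact: contC|exact: c2_cont].
- by apply: contM; [exact: phi_cont|exact: c2f_cont].
Qed.

Let ip_cont u v : continuous (fun x => u.1 x * v.1 x + u.2 x * v.2 x).
Proof. by apply: contD; apply: contM; exact: c2f_cont. Qed.

Let form_cont u v : continuous (fun x => calT1 u x * v.1 x + calT2 u x * v.2 x).
Proof. by apply: contD; apply: contM => //; exact: c2f_cont. Qed.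

Lemma ip_eq0 u : ip u u <= 0 -> forall x, u.1 x = 0 /\ u.2 x = 0.
Proof.
move=> h; have nn x : 0 <= u.1 x * u.1 x + u.2 x * u.2 x.
  by rewrite -!expr2 addr_ge0// sqr_ge0.
have z := prim_eq0 L0 (@ip_cont u u) (fun t _ => nn t) h.
have z2 x : 0 <= x <= L -> u.1 x = 0 /\ u.2 x = 0.
  move=> hx; have /eqP := z x hx; rewrite -!expr2 paddr_eq0 ?sqr_ge0//.
  by rewrite !sqrf_eq0 => /andP[/eqP -> /eqP ->].
move=> x; split.
  by apply: (periodic_eq0 L0 (c2_per u.1)) => t /z2[].
by apply: (periodic_eq0 L0 (c2_per u.2)) => t /z2[].
Qed.

Lemma ip_ge0 u : 0 <= ip u u.
Proof.
by apply: prim_ge0 => [|t _]; [exact: ltW|rewrite -!expr2 addr_ge0// sqr_ge0].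
Qed.

Lemma ipC u v : ip u v = ip v u.
Proof. by congr (prim _ L); apply/funext => x; ring. Qed.

(** Symmetry: the difference of the two integrands is an exact derivative. *)
Lemma formC u v : form u v = form v u.
Proof.
pose F x := - b * (c2d u.1 x * v.1 x - c2d v.1 x * u.1 x)
  - b * (c2d u.2 x * v.2 x - c2d v.2 x * u.2 x)
  + b * w * (c2d u.2 x * v.1 x + c2d u.1 x * v.2 x
             - c2d v.2 x * u.1 x - c2d v.1 x * u.2 x).
pose f x := (calT1 u x * v.1 x + calT2 u x * v.2 x) -
            (calT1 v x * u.1 x + calT2 v x * u.2 x).
have cf : continuous f by apply: contB; exact: form_cont.
have dF x : is_derive x 1 F (f x).
  have m (a c : perC2 L) := derM (c2_der2 a x) (c2_der c x).
  apply: (der_eq (derD (derB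
    (derScale (- b) (derB (m u.1 v.1) (m v.1 u.1)))
    (derScale b (derB (m u.2 v.2) (m v.2 u.2))))
    (derScale (b * w) (derB (derB (derD (m u.2 v.1) (m u.1 v.2)) (m v.2 u.1)) (m v.1 u.2))))).
  by rewrite /f /calT1 /calT2; ring.
have pF : Defs.periodic L F by move=> x; rewrite /F !c2d_per !c2_per.
have h := prim_FTC_per dF cf pF.
have fD : form u v = prim (fun x => f x + (calT1 v x * u.1 x + calT2 v x * u.2 x)) L.
  by congr (prim _ L); apply/funext => x; rewrite /f subrK.
by rewrite fD (primD _ (cont_locint cf) (cont_locint (@form_cont v u))) h add0r.
Qed.

Lemma form_eigen z u v : eigenpair z u -> form u v = z * ip u v.
Proof.
move=> hu; rewrite -(primZ _ _ (cont_locint (@ip_cont u v))); congr (prim _ L).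
by apply/funext => x; have [-> ->] := hu x; ring.
Qed.

Lemma eigen_orthogonal z1 z2 u v : z1 != z2 -> eigenpair z1 u -> eigenpair z2 v ->
  ip u v = 0.
Proof.
move=> z12 hu hv; have := formC u v.
rewrite (form_eigen _ hu) (form_eigen _ hv) (ipC v) => /eqP.
by rewrite -subr_eq0 -mulrBl mulf_eq0 subr_eq0 (negbTE z12) => /eqP.
Qed.

Definition pair_lin (a : R) u (c : R) v : pair := (c2_lin a u.1 c v.1, c2_lin a u.2 c v.2).

Lemma ip_linl a u c v t : ip (pair_lin a u c v) t = a * ip u t + c * ip v t.
Proof.
have l1 := cont_locint (@ip_cont u t); have l2 := cont_locint (@ip_cont v t).
rewrite /ip -(primZ a _ l1) -(primZ c _ l2) -(primD _ (locintZ _ l1) (locintZ _ l2)).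
by congr (prim _ L); apply/funext => x /=; ring.
Qed.

Lemma form_linl a u c v t : form (pair_lin a u c v) t = a * form u t + c * form v t.
Proof.
have l1 := cont_locint (@form_cont u t); have l2 := cont_locint (@form_cont v t).
rewrite /form -(primZ a _ l1) -(primZ c _ l2) -(primD _ (locintZ _ l1) (locintZ _ l2)).
by congr (prim _ L); apply/funext => x; rewrite /calT1 /calT2 /=; ring.
Qed.

Lemma ip_linr a u c v t : ip t (pair_lin a u c v) = a * ip t u + c * ip t v.
Proof. by rewrite ipC ip_linl !(ipC t). Qed.

Lemma form_linr a u c v t : form t (pair_lin a u c v) = a * form t u + c * form t v.
Proof. by rewrite formC form_linl !(formC t). Qed.

(** Coordinates in the basis (1, B), (B - w, w B - 1), which diagonalizes
    simultaneously the leading matrix ((1, -w), (-w, 1)) and the matrix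
    ((0, B), (B, 1)) multiplying the wave. *)
Definition nrm := 1 - 2 * w * B + B ^+ 2.
Definition coord1 u : perC2 L := c2_lin ((1 - w * B) / nrm) u.1 ((B - w) / nrm) u.2.
Definition coord2 u : perC2 L := c2_lin (B / nrm) u.1 (- nrm^-1) u.2.

Let V2 x := 1 + (1 - w * B) ^+ 2 / ((1 - w ^+ 2) * B ^+ 2) * (1 - W x).

Let nrm_gt0 : 0 < nrm.
Proof. by rewrite /nrm; have := one_sub_wB_gt0; have := B_eq; lra. Qed.

Let w2_gt0 : 0 < 1 - w ^+ 2. Proof. by have := w_lt1; lra. Qed.

Let V2_ge1 x : 1 <= V2 x.
Proof.
rewrite lerDl; apply: mulr_ge0; last by have := hill_W_lt0 hd x; lra.
by apply: divr_ge0; [exact: sqr_ge0|apply: mulr_ge0; exact: ltW].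
Qed.

Lemma coordK1 u x : u.1 x = coord1 u x + (B - w) * coord2 u x.
Proof. by have := nrm_gt0; rewrite /= /nrm => h; field; rewrite gt_eqF. Qed.

Lemma coordK2 u x : u.2 x = B * coord1 u x + (w * B - 1) * coord2 u x.
Proof. by have := nrm_gt0; rewrite /= /nrm => h; field; rewrite gt_eqF. Qed.

Let phiE x : phi x = (1 - w * B) / B ^+ 2 * (W x - 1).
Proof.
apply: (mulfI (x := B ^+ 2)); first by rewrite expf_neq0.
by rewrite -phiW; field.
Qed.

(** In these coordinates the wave acts diagonally, with factors B^2 / (1 - w B) and
    - (1 - w B) / (1 - w^2) relative to the leading matrix; by [phiW] the first
    operator is the Hill operator with potential W. *)
Lemma calT_coord1 u x : calT1 u x + B * calT2 u x =
  nrm * (- b * c2dd (coord1 u) x + W x * coord1 u x).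
Proof.
have h := nrm_gt0; have n0 : nrm != 0 by rewrite gt_eqF.
have h1 : 1 - w * B != 0 by rewrite gt_eqF// one_sub_wB_gt0.
have e : W x = 1 + B ^+ 2 / (1 - w * B) * phi x by rewrite phiE; field; rewrite h1 B0.
rewrite /calT1 /calT2 e /=.
have -> : nrm * (- b * ((1 - w * B) / nrm * c2dd u.1 x + (B - w) / nrm * c2dd u.2 x) +
  (1 + B ^+ 2 / (1 - w * B) * phi x) *
  ((1 - w * B) / nrm * u.1 x + (B - w) / nrm * u.2 x)) =
  - b * ((1 - w * B) * c2dd u.1 x + (B - w) * c2dd u.2 x) +
  ((1 - w * B) * u.1 x + (B - w) * u.2 x) +
  phi x * (B ^+ 2 * u.1 x + B ^+ 2 * (B - w) / (1 - w * B) * u.2 x).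
  by field; rewrite n0 h1.
have -> : B ^+ 2 * (B - w) / (1 - w * B) = 2 * B.
  apply: (mulIf h1); rewrite divfK//.
  have -> : B ^+ 2 * (B - w) = (B ^+ 2) * B - w * B ^+ 2 by ring.
  have e3 : B ^+ 2 * B = (2 - w * B) * B by rewrite -B_eq.
  by rewrite e3; ring.
by ring.
Qed.

Lemma calT_coord2 u x : (B - w) * calT1 u x + (w * B - 1) * calT2 u x =
  nrm * (1 - w ^+ 2) * (- b * c2dd (coord2 u) x + V2 x * coord2 u x).
Proof.
have h := nrm_gt0; have n0 : nrm != 0 by rewrite gt_eqF.
have h1 : 1 - w * B != 0 by rewrite gt_eqF// one_sub_wB_gt0.
have w2 : 1 - w ^+ 2 != 0 by rewrite gt_eqF.
have e : V2 x = 1 - (1 - w * B) / (1 - w ^+ 2) * phi x.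
  by rewrite /V2 phiE; field; rewrite w2 B0.
rewrite /calT1 /calT2 e /=.
have -> : nrm * (1 - w ^+ 2) * (- b * (B / nrm * c2dd u.1 x + - nrm^-1 * c2dd u.2 x) +
  (1 - (1 - w * B) / (1 - w ^+ 2) * phi x) * (B / nrm * u.1 x + - nrm^-1 * u.2 x)) =
  - b * (1 - w ^+ 2) * (B * c2dd u.1 x - c2dd u.2 x) +
   (1 - w ^+ 2 - (1 - w * B) * phi x) * (B * u.1 x - u.2 x).
  by field; rewrite n0 w2.
have -> : (B - w) * (u.1 x - b * c2dd u.1 x + b * w * c2dd u.2 x + (B * phi x - w) * u.2 x) +
 (w * B - 1) * (b * w * c2dd u.1 x + (B * phi x - w) * u.1 x + u.2 x - b * c2dd u.2 x + phi x * u.2 x)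
 = - b * (1 - w ^+ 2) * (B * c2dd u.1 x - c2dd u.2 x) +
   (1 - w ^+ 2) * (B * u.1 x - u.2 x) + phi x *
   ((w * B - 1) * B * u.1 x + (B ^+ 2 - 1) * u.2 x) by ring.
by rewrite B_eq; ring.
Qed.

Let scalar_form (V : R -> R) (f : perC2 L) : R :=
  prim (fun x => (- b * c2dd f x + V x * f x) * f x) L.

Let scalar_formE (V : R -> R) (f : perC2 L) : continuous V -> Defs.periodic L V ->
  scalar_form V f = prim (hill_density b V f (c2d f)) L.
Proof.
move=> cV pV; pose F x := - b * (c2d f x * f x).
pose g x := (- b * c2dd f x + V x * f x) * f x - hill_density b V f (c2d f) x.
have dF x : is_derive x 1 F (g x).
  apply: (der_eq (derScale (- b) (derM (c2_der2 f x) (c2_der f x)))).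
  by rewrite /g /hill_density; ring.
have cf := @c2f_cont _ _ f; have cdf := @c2d_cont _ _ f; have cddf := @c2_cont _ _ f.
have chd : continuous (hill_density b V f (c2d f)).
  apply: contD; apply: contM => //; try exact: contC; exact: contX.
have cg : continuous g.
  apply: contB => //; apply: contM => //; apply: contD; apply: contM => //; exact: contC.
have pF : Defs.periodic L F by move=> x; rewrite /F c2d_per c2_per.
have h := prim_FTC_per dF cg pF.
have -> : scalar_form V f = prim (fun x => g x + hill_density b V f (c2d f) x) L.
  by congr (prim _ L); apply/funext => x; rewrite /g subrK.
by rewrite (primD _ (cont_locint cg) (cont_locint chd)) h add0r.
Qed.

Let V2_cont : continuous V2.
Proof.
apply: contD; first exact: contC.
apply: contM; first exact: contC.
by apply: contB; [exact: contC|exact: hill_W_cont hd].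
Qed.

Let V2_per : Defs.periodic L V2.
Proof. by move=> x; rewrite /V2 (hill_W_per hd). Qed.

Let scal_cont (V : R -> R) (f : perC2 L) : continuous V ->
  continuous (fun x => (- b * c2dd f x + V x * f x) * f x).
Proof.
move=> cV; apply: contM; last exact: c2f_cont.
apply: contD; apply: contM => //; [exact: contC|exact: c2_cont|exact: c2f_cont].
Qed.

(** The basis is orthogonal for the leading matrix, so there are no cross terms. *)
Lemma form_split u : form u u =
  nrm * prim (hill_density b W (coord1 u) (c2d (coord1 u))) L +
  nrm * (1 - w ^+ 2) * prim (hill_density b V2 (coord2 u) (c2d (coord2 u))) L.
Proof.
rewrite -(scalar_formE _ (hill_W_cont hd) (hill_W_per hd)) -(scalar_formE _ V2_cont V2_per).
have l1 := cont_locint (@scal_cont W (coord1 u) (hill_W_cont hd)).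
have l2 := cont_locint (@scal_cont V2 (coord2 u) V2_cont).
rewrite /scalar_form -(primZ nrm _ l1) -(primZ (nrm * (1 - w ^+ 2)) _ l2).
rewrite -(primD _ (locintZ _ l1) (locintZ _ l2)); congr (prim _ L); apply/funext => x.
rewrite mulrA -calT_coord1 mulrA -calT_coord2 {1}(coordK1 u x) {1}(coordK2 u x).
by ring.
Qed.

Let form2_ge (f : perC2 L) : prim (fun x => f x ^+ 2) L <= prim (hill_density b V2 f (c2d f)) L.
Proof.
have cf := @c2f_cont _ _ f; have cdf := @c2d_cont _ _ f.
apply: prim_le; [exact: ltW|exact: contX| |].
  apply: contD; apply: contM => //; try exact: contC; exact: contX.
move=> t _; rewrite /hill_density.
have h1 : 0 <= b * c2d f t ^+ 2 by rewrite mulr_ge0 ?sqr_ge0// ltW.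
have h2 : 0 <= (V2 t - 1) * f t ^+ 2 by rewrite mulr_ge0 ?sqr_ge0// subr_ge0.
by rewrite mulrBl mul1r in h2; lra.
Qed.

(** A single linear condition makes the form nonnegative: this is the bound on
    the number of negative eigenvalues. *)
Definition trace u := coord1 u x2 + coord1 u (- x2).

Lemma trace_lin a u c v : trace (pair_lin a u c v) = a * trace u + c * trace v.
Proof. by rewrite /trace /=; ring. Qed.

Lemma form_ge0 u : trace u = 0 -> 0 <= form u u.
Proof.
move=> h; rewrite form_split addr_ge0//; last first.
  apply: mulr_ge0; first exact: ltW (mulr_gt0 nrm_gt0 w2_gt0).
  apply: le_trans (form2_ge _); apply: prim_ge0 => [|t _]; [exact: ltW|exact: sqr_ge0].
apply: mulr_ge0; first exact: ltW.
have := hill_form_bound hd (c2_der (coord1 u)) (@c2d_cont _ _ _) (c2_per (coord1 u)) h.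
have : 0 <= lam * prim (fun x => (coord1 u x + coord1 u (- x)) ^+ 2) (L / 2).
  apply: mulr_ge0; first exact: ltW (hill_lam hd).
  by apply: prim_ge0 => [|t _]; [rewrite divr_ge0// ltW|exact: sqr_ge0].
by move=> h1 h2; have := le_trans h1 h2; rewrite pmulr_rge0.
Qed.

Lemma negative_trace z u : z < 0 -> eigenpair z u -> trace u = 0 ->
  forall x, u.1 x = 0 /\ u.2 x = 0.
Proof.
move=> z0 hu tu; apply: ip_eq0; have := form_ge0 tu.
by rewrite (form_eigen _ hu) nmulr_rge0.
Qed.

(** Two negative eigenvalues would make the form negative on a plane, which meets
    the hyperplane where the trace vanishes. *)
Lemma negative_unique z1 z2 u v : z1 < 0 -> z2 < 0 -> eigenpair z1 u ->
  eigenpair z2 v -> (exists x, u.1 x != 0 \/ u.2 x != 0) ->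
  (exists x, v.1 x != 0 \/ v.2 x != 0) -> z1 = z2.
Proof.
move=> z10 z20 hu hv [xu nu] [xv nv]; apply/eqP/negP => /negP z12.
have tu : trace u != 0.
  apply/negP => /eqP tu; have [e1 e2] := negative_trace z10 hu tu xu.
  by case: nu; rewrite ?e1 ?e2 eqxx.
have ov := eigen_orthogonal z12 hu hv.
have := @form_ge0 (pair_lin (trace v) u (- trace u) v).
rewrite trace_lin mulNr mulrC subrr => /(_ erefl).
rewrite form_linl !form_linr (form_eigen u hu) (form_eigen v hu) (form_eigen u hv).
rewrite (form_eigen v hv) (ipC v u) ov !mulr0 !addr0 !add0r.
have iu := ip_ge0 u; have iv : 0 < ip v v.
  rewrite ltNge; apply/negP => /ip_eq0 /(_ xv)[e1 e2].
  by case: nv; rewrite ?e1 ?e2 eqxx.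
have h1 : 0 <= trace v ^+ 2 * (- z1 * ip u u).
  by rewrite mulr_ge0 ?sqr_ge0// mulr_ge0// oppr_ge0 ltW.
have h2 : 0 < trace u ^+ 2 * (- z2 * ip v v).
  by rewrite mulr_gt0 ?exprn_even_gt0//= mulr_gt0// oppr_gt0.
by move=> h3; lra.
Qed.

Let W_int_lt0 : prim W L < 0.
Proof.
have cW := hill_W_cont hd.
rewrite ltNge; apply/negP => h.
have cNW := contN cW.
have h2 : prim (fun t => - W t) L <= 0.
  have -> : prim (fun t => - W t) L = - prim W L.
    apply: (@prim_eq _ _ (fun y => - prim W y)) => //.
      by move=> t; exact: (derN (prim_der cW t)).
    by rewrite prim0 oppr0.
  by rewrite oppr_le0.
have := prim_eq0 L0 cNW (fun t _ => _) h2 (t := 0).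
move=> /(_ _)/wrap[t|]; first by rewrite oppr_ge0 ltW// (hill_W_lt0 hd).
rewrite lexx ltW// => /(_ isT) /eqP; rewrite oppr_eq0 => /eqP e.
by have := hill_W_lt0 hd 0; rewrite e ltxx.
Qed.

(** The kernel. The second coordinate vanishes by positivity. The first one, f,
    is first compared with the constant c for which f - c meets the condition of
    [hill_form_bound]: the form of f - c is c^2 times the integral of W, which is
    negative, so c = 0 and f is odd. An odd solution is a multiple of [p]. *)
Lemma kernel_spanned u : eigenpair 0 u ->
  exists g, forall x, u.1 x = g * p x /\ u.2 x = B * (g * p x).
Proof.
move=> hu; have [f1 e1] : exists f1, coord1 u = f1 by exists (coord1 u).
have [f2 e2] : exists f2, coord2 u = f2 by exists (coord2 u).
have n0 : nrm != 0 by rewrite gt_eqF.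
have w0 : 1 - w ^+ 2 != 0 by rewrite gt_eqF.
have L1 x : - b * c2dd f1 x + W x * f1 x = 0.
  apply: (mulfI n0); rewrite -e1 -calT_coord1; have [-> ->] := hu x; ring.
have L2 x : - b * c2dd f2 x + V2 x * f2 x = 0.
  apply: (mulfI (mulf_neq0 n0 w0)); rewrite -e2 -calT_coord2; have [-> ->] := hu x; ring.
have f2z x : f2 x = 0.
  apply: (periodic_eq0 L0 (c2_per f2)) => t ht; apply/eqP; rewrite -sqrf_eq0; apply/eqP.
  apply: (prim_eq0 (f := fun t => f2 t ^+ 2) L0) ht.
  - by apply: (@contX _ _ 2); exact: c2f_cont.
  - by move=> s _; exact: sqr_ge0.
  - apply: le_trans (form2_ge f2) _; rewrite -(scalar_formE _ V2_cont V2_per).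
    rewrite /scalar_form; have -> : (fun x => (- b * c2dd f2 x + V2 x * f2 x) * f2 x) =
      (fun _ : R => 0 : R) by apply/funext => s; rewrite L2 mul0r.
    by rewrite prim_cst0.
pose c := (f1 x2 + f1 (- x2)) / 2.
pose f := c2_lin 1 f1 (-1) (c2_cst L c).
have ftr : f x2 + f (- x2) = 0 by rewrite /f /= /c; field.
have cW := hill_W_cont hd.
have bd := hill_form_bound hd (c2_der f) (@c2d_cont _ _ f) (c2_per f) ftr.
have lam0 := hill_lam hd.
have i0 : 0 <= prim (fun x => (f x + f (- x)) ^+ 2) (L / 2).
  by apply: prim_ge0 => [|t _]; [rewrite divr_ge0// ltW|exact: sqr_ge0].
have formf : prim (hill_density b W f (c2d f)) L = c ^+ 2 * prim W L.
  rewrite -(scalar_formE _ cW (hill_W_per hd)) /scalar_form.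
  have -> : (fun x => (- b * c2dd f x + W x * f x) * f x) =
      (fun x => - (c * b) * c2dd f1 x + c ^+ 2 * W x).
    apply/funext => x; rewrite /f /=.
    have -> : (- b * (1 * c2dd f1 x + -1 * 0) + W x * (1 * f1 x + -1 * c)) *
      (1 * f1 x + -1 * c) = (- b * c2dd f1 x + W x * f1 x) * (f1 x - 2 * c) +
      - (c * b) * c2dd f1 x + c ^+ 2 * W x by ring.
    by rewrite L1 mul0r add0r.
  have l1 := cont_locint (@c2_cont _ _ f1); have l2 := cont_locint cW.
  rewrite (primD _ (locintZ _ l1) (locintZ _ l2)) (primZ _ _ l1) (primZ _ _ l2).
  by rewrite (prim_FTC_per (c2_der2 f1) (@c2_cont _ _ f1) (@c2d_per _ _ f1)) mulr0 add0r.
have Wneg := W_int_lt0.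
rewrite formf in bd.
have c20 := sqr_ge0 c.
have cz : c = 0.
  apply/eqP; rewrite -sqrf_eq0; apply/negP => /negP c2.
  have c2p : 0 < c ^+ 2 by rewrite lt0r c2.
  have h1 : c ^+ 2 * prim W L < 0 by rewrite pmulr_rlt0.
  have h2 : 0 <= lam * prim (fun x => (f x + f (- x)) ^+ 2) (L / 2) by rewrite mulr_ge0// ltW.
  by move: bd; lra.
rewrite cz expr0n/= mul0r mulr0 pmulr_rle0// in bd.
have cf1 := @c2f_cont _ _ f1.
have cfe : continuous (fun x => (f x + f (- x)) ^+ 2).
  apply: (@contX _ _ 2); apply: contD; first exact: c2f_cont.
  by apply: (@cont_comp _ _ (fun t => - t) (@c2f_cont _ _ f)); apply: contN => t; exact: cvg_id.
have L20 : 0 < L / 2 by rewrite divr_gt0.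
have f10 : f1 0 = 0.
  have := prim_eq0 L20 cfe (fun t _ => sqr_ge0 _) bd (t := 0).
  rewrite lexx ltW// => /(_ isT) /eqP; rewrite sqrf_eq0 oppr0 /f /= cz => /eqP.
  lra.
pose g := c2d f1 0 / p' 0.
pose z x := f1 x - g * p x; pose z' x := c2d f1 x - g * p' x.
have dp := hill_p_der hd; have dp' := hill_p'_der hd.
have dz x : is_derive x 1 z (z' x) := derB (c2_der f1 x) (derScale g (dp x)).
have dz' x : is_derive x 1 z' (W x / b * z x).
  apply: (der_eq (derB (c2_der2 f1 x) (derScale g (dp' x)))).
  have -> : c2dd f1 x = W x / b * f1 x.
    have e : W x * f1 x = b * c2dd f1 x by have := L1 x; lra.
    by rewrite mulrAC e mulrAC divff ?mul1r// gt_eqF.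
  by rewrite /z; ring.
have z0 : z 0 = 0 by rewrite /z f10 (hill_p0 hd) mulr0 subrr.
have z'0 : z' 0 = 0 by rewrite /z' /g divfK ?subrr// (hill_p'0 hd).
have cz' := der_contT dz'; have czz := der_contT dz.
have cq : continuous (fun x => W x / b) by apply: contM => //; exact: contC.
have [Cw hCw] := hill_W_lb hd.
have q_le x : `|W x / b| <= `|Cw| / b.
  rewrite normrM (gtr0_norm (x := b^-1)) ?invr_gt0//.
  apply: ler_wpM2r; first by rewrite invr_ge0 ltW.
  have := hill_W_lt0 hd x; have := hCw x => h1 h2.
  by rewrite (ltr0_norm h2) ler0_norm; lra.
have zz x : z x = 0.
  have rx : 0 <= `|x| by exact: normr_ge0.
  have rx' : - `|x| <= 0 by rewrite oppr_le0.
  have hx : - `|x| <= x <= `|x| by rewrite -ler_norml.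
  have h1 (_ : unit) t : - `|x| <= t <= `|x| -> z t = prim z' t.
    by move=> _; rewrite (prim_unique cz' dz) z0 subr0.
  have h2 (_ : unit) t : - `|x| <= t <= `|x| ->
      z' t = prim (fun s => \sum_(j : unit) W s / b * z s) t.
    move=> _; have -> : (fun s => \sum_(j : unit) W s / b * z s) = (fun s => W s / b * z s).
      by apply/funext => s; rewrite big_const card_unit /= addr0.
    by rewrite (prim_unique (contM cq czz) dz') z'0 subr0.
  by have [] := @second_order_zero R unit (fun _ _ x => W x / b) (`|Cw| / b) (fun _ _ => cq)
    (fun _ _ => q_le) (fun _ => z) (fun _ => z') _ _ rx' rx (fun _ => czz) (fun _ => cz')
    h1 h2 tt x hx.
exists g => x; have e : f1 x = g * p x by have := zz x; rewrite /z; lra.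
by rewrite (coordK1 u x) (coordK2 u x) e1 e2 f2z e; split; ring.
Qed.

Definition pair_sum (I : finType) (a : I -> R) (f : I -> pair) : pair :=
  (c2_sum a (fun i => (f i).1), c2_sum a (fun i => (f i).2)).

Lemma ip_suml (I : finType) (a : I -> R) (f : I -> pair) v :
  ip (pair_sum a f) v = \sum_i a i * ip (f i) v.
Proof.
have l i := locintZ (a i) (cont_locint (@ip_cont (f i) v)).
rewrite /ip; under [RHS]eq_bigr do rewrite -(primZ _ _ (cont_locint (@ip_cont _ _))).
rewrite -(prim_sum _ l); congr (prim _ L); apply/funext => x /=.
by rewrite !mulr_suml -big_split/=; apply: eq_bigr => i _; ring.
Qed.

Lemma form_suml (I : finType) (a : I -> R) (f : I -> pair) v :
  form (pair_sum a f) v = \sum_i a i * form (f i) v.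
Proof.
have l i := locintZ (a i) (cont_locint (@form_cont (f i) v)).
rewrite /form; under [RHS]eq_bigr do rewrite -(primZ _ _ (cont_locint (@form_cont _ _))).
rewrite -(prim_sum _ l); congr (prim _ L); apply/funext => x.
have -> : calT1 (pair_sum a f) x = \sum_i a i * calT1 (f i) x.
  rewrite /calT1 /= !mulr_sumr -sumrB -!big_split/=.
  by apply: eq_bigr => i _; ring.
have -> : calT2 (pair_sum a f) x = \sum_i a i * calT2 (f i) x.
  rewrite /calT2 /= !mulr_sumr -!big_split/= -sumrB -big_split/=.
  by apply: eq_bigr => i _; ring.
by rewrite !mulr_suml -big_split/=; apply: eq_bigr => i _; ring.
Qed.

Let coord1_sqr u x : coord1 u x ^+ 2 <=
  2 * (((1 - w * B) / nrm) ^+ 2 + ((B - w) / nrm) ^+ 2) * (u.1 x * u.1 x + u.2 x * u.2 x).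
Proof.
have cs (r t s q : R) : (r * s + t * q) ^+ 2 <= 2 * (r ^+ 2 + t ^+ 2) * (s * s + q * q).
  have h1 := sqr_ge0 (r * s - t * q); have h2 := sqr_ge0 (r * q).
  have h3 := sqr_ge0 (t * s); nra.
exact: cs.
Qed.

Lemma form_semibounded : exists C, 0 <= C /\ forall u, - C * ip u u <= form u u.
Proof.
have [Cw hCw] := hill_W_lb hd.
pose k := 2 * (((1 - w * B) / nrm) ^+ 2 + ((B - w) / nrm) ^+ 2).
have k0 : 0 <= k by rewrite mulr_ge0// addr_ge0// sqr_ge0.
have n0 := nrm_gt0.
exists (nrm * (`|Cw| * k)); split; first by apply: mulr_ge0; [exact: ltW|exact: mulr_ge0].
move=> u; rewrite form_split.
have h2 : 0 <= nrm * (1 - w ^+ 2) * prim (hill_density b V2 (coord2 u) (c2d (coord2 u))) L.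
  apply: mulr_ge0; first exact: ltW (mulr_gt0 n0 w2_gt0).
  by apply: le_trans (form2_ge _); apply: prim_ge0 => [|t _]; [exact: ltW|exact: sqr_ge0].
have cc1 := @c2f_cont _ _ (coord1 u); have cd1 := @c2d_cont _ _ (coord1 u).
have h1 : - (`|Cw| * k) * ip u u <= prim (hill_density b W (coord1 u) (c2d (coord1 u))) L.
  rewrite -(primZ _ _ (cont_locint (@ip_cont u u))); apply: prim_le; first exact: ltW.
  - by apply: contM; [exact: contC|exact: ip_cont].
  - apply: contD; apply: contM; (try exact: contC); (try exact: (@contX _ _ 2)).
    exact: hill_W_cont hd.
  move=> t _; have c1 := coord1_sqr u t; rewrite -/k in c1.
  rewrite /hill_density; have q0 : 0 <= b * c2d (coord1 u) t ^+ 2.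
    by rewrite mulr_ge0 ?sqr_ge0// ltW.
  have q1 : `|Cw| * coord1 u t ^+ 2 <= `|Cw| * (k * (u.1 t * u.1 t + u.2 t * u.2 t)).
    exact: ler_wpM2l.
  have q2 : 0 <= (W t + `|Cw|) * coord1 u t ^+ 2.
    apply: mulr_ge0; last exact: sqr_ge0.
    by have := hCw t; have := ler_norm (- Cw); rewrite normrN; lra.
  rewrite mulrDl in q2; rewrite mulNr -mulrA; lra.
have := ler_wpM2l (ltW n0) h1; rewrite mulrA mulrN; lra.
Qed.

(** Poincare's inequality on a grid of [m] points: f'^2 - q f^2 + 2 q (f^2 (x - x_j))'
    is nonnegative within a distance 1/(2 sqrt q) of x_j, and the exact derivative
    integrates to 0 between two zeros. *)
Lemma poincare_grid (f : perC2 L) (m : nat) (q : R) : (0 < m)%N -> 0 <= q ->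
  4 * q * (L / m%:R) ^+ 2 <= 1 -> (forall j, (j < m)%N -> f (j%:R * (L / m%:R)) = 0) ->
  q * prim (fun x => f x ^+ 2) L <= prim (fun x => c2d f x ^+ 2) L.
Proof.
move=> m0 q0 hq fz; set h := L / m%:R.
have mR : 0 < m%:R :> R by rewrite ltr0n.
have h0 : 0 < h by rewrite divr_gt0.
have mh : m%:R * h = L by rewrite /h mulrC divfK// gt_eqF.
have fz' j : (j <= m)%N -> f (j%:R * h) = 0.
  rewrite leq_eqVlt => /predU1P[->|]; last exact: fz.
  by have := fz 0 m0; rewrite mul0r mh -(c2_per f 0) add0r.
have cf := @c2f_cont _ _ f; have cdf := @c2d_cont _ _ f.
pose g x := c2d f x ^+ 2 - q * f x ^+ 2.
have cg : continuous g.
  by apply: contB; [exact: contX|apply: contM; [exact: contC|exact: contX]].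
have step j : (j < m)%N -> prim g (j%:R * h) <= prim g (j.+1%:R * h).
  move=> jm; set xj := j%:R * h.
  have xj1 : j.+1%:R * h = xj + h by rewrite -natr1 mulrDl mul1r.
  pose K x := prim g x - f x ^+ 2 * (- 2 * q * (x - xj)).
  have dK x : is_derive x 1 K ((c2d f x + 2 * q * (x - xj) * f x) ^+ 2 +
      (q - 4 * q ^+ 2 * (x - xj) ^+ 2) * f x ^+ 2).
    have d1 := derM (derX 2 (c2_der f x)) (derScale (- 2 * q) (derB (derid x) (derC xj x))).
    by apply: (der_eq (derB (prim_der cg x) d1)); rewrite /g /= expr1; ring.
  have e0 : prim g xj = K xj by rewrite /K subrr mulr0 mulr0 subr0.
  have e1 : prim g (j.+1%:R * h) = K (j.+1%:R * h).
    by rewrite /K (fz' _ jm) expr0n/= mul0r subr0.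
  rewrite e0 e1 xj1.
  apply: (nondecr_der (fun x _ => dK x)); last by rewrite lerDl ltW.
  move=> x /andP[x0 x1]; rewrite addr_ge0 ?sqr_ge0// mulr_ge0 ?sqr_ge0// subr_ge0.
  have d2 : (x - xj) ^+ 2 <= h ^+ 2 by rewrite lerXn2r ?nnegrE; lra.
  have -> : 4 * q ^+ 2 * (x - xj) ^+ 2 = q * (4 * q * (x - xj) ^+ 2) by ring.
  rewrite -[leRHS]mulr1; apply: ler_wpM2l => //.
  by apply: le_trans hq; apply: ler_wpM2l => //; rewrite mulr_ge0.
have all j : (j <= m)%N -> 0 <= prim g (j%:R * h).
  elim: j => [|j ih] jm; first by rewrite mul0r prim0.
  by apply: le_trans (step j jm); apply: ih; exact: ltnW.
have := all m (leqnn m); rewrite mh.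
have -> : prim g L = prim (fun x => c2d f x ^+ 2) L - q * prim (fun x => f x ^+ 2) L.
  have l1 : locint (fun x => c2d f x ^+ 2) by apply: cont_locint; exact: contX.
  have l2 : locint (fun x => f x ^+ 2) by apply: cont_locint; exact: contX.
  rewrite -mulNr -(primZ (- q) _ l2) -(primD _ l1 (locintZ _ l2)).
  by congr (prim _ L); apply/funext => x; rewrite /g mulNr.
by rewrite subr_ge0.
Qed.

(** On functions vanishing on a fine enough grid, the second derivatives dominate
    the potential and the level z. *)
Lemma form_ge_grid (z : R) : exists2 m, (0 < m)%N & forall u,
  (forall j, (j < m)%N -> u.1 (j%:R * (L / m%:R)) = 0 /\ u.2 (j%:R * (L / m%:R)) = 0) ->
  form u u <= z * ip u u -> ip u u <= 0.
Proof.
have [C [C0 hC]] := form_semibounded.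
have [Cw hCw] := hill_W_lb hd.
have n0 := nrm_gt0; have w0 := w2_gt0.
pose k : R := 2 * (1 + (B - w) ^+ 2 + B ^+ 2 + (w * B - 1) ^+ 2).
have k0 : 0 <= k by rewrite mulr_ge0// !addr_ge0// sqr_ge0.
pose c : R := nrm * (1 - w ^+ 2) * b.
have c0 : 0 < c by rewrite !mulr_gt0.
(* c q is to dominate the potential and the level z *)
pose q : R := (nrm * `|Cw| + `|z| * k + 1) / c.
have q0 : 0 <= q.
  apply: divr_ge0; last exact: ltW.
  apply: addr_ge0 => //; apply: addr_ge0; apply: mulr_ge0 => //; exact: ltW.
have [m m0 hm] : exists2 m, (0 < m)%N & 4 * q * (L / m%:R) ^+ 2 <= 1.
  pose A := 4 * q * L ^+ 2; have A0 : 0 <= A by rewrite mulr_ge0 ?sqr_ge0// mulr_ge0.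
  exists (Num.bound A).+1 => //; have := archi_boundP A0; set n := Num.bound A => hA.
  have nR : 0 < n.+1%:R :> R by rewrite ltr0n.
  have -> : 4 * q * (L / n.+1%:R) ^+ 2 = A / n.+1%:R ^+ 2.
    by rewrite expr_div_n /A mulrA.
  rewrite ler_pdivrMr ?exprn_gt0// mul1r.
  apply: le_trans (ltW hA) _; rewrite expr2.
  apply: (@le_trans _ _ n.+1%:R); first by rewrite ler_nat.
  by rewrite ler_peMl// ler1n.
exists m => // u hu hform.
pose f1 := coord1 u; pose f2 := coord2 u.
have z1 j : (j < m)%N -> f1 (j%:R * (L / m%:R)) = 0.
  by move=> /hu[e1 e2]; rewrite /f1 /= e1 e2 !mulr0 addr0.
have z2 j : (j < m)%N -> f2 (j%:R * (L / m%:R)) = 0.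
  by move=> /hu[e1 e2]; rewrite /f2 /= e1 e2 !mulr0 addr0.
have p1 := poincare_grid m0 q0 hm z1; have p2 := poincare_grid m0 q0 hm z2.
have sq (f : perC2 L) : continuous (fun x => f x ^+ 2) by apply: (@contX _ _ 2); exact: c2f_cont.
have sqd (f : perC2 L) : continuous (fun x => c2d f x ^+ 2) by apply: (@contX _ _ 2); exact: c2d_cont.
have l (f : perC2 L) := cont_locint (sq f); have ld (f : perC2 L) := cont_locint (sqd f).
set S1 := prim (fun x => f1 x ^+ 2) L in p1; set S2 := prim (fun x => f2 x ^+ 2) L in p2.
set D1 := prim (fun x => c2d f1 x ^+ 2) L in p1; set D2 := prim (fun x => c2d f2 x ^+ 2) L in p2.
have S10 : 0 <= S1 by apply: prim_ge0 => [|t _]; [exact: ltW|exact: sqr_ge0].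
have S20 : 0 <= S2 by apply: prim_ge0 => [|t _]; [exact: ltW|exact: sqr_ge0].
have cdens (V : R -> R) (f : perC2 L) : continuous V -> continuous (hill_density b V f (c2d f)).
  by move=> cV; apply: contD; apply: contM => //; exact: contC.
have g1 : b * D1 - `|Cw| * S1 <= prim (hill_density b W f1 (c2d f1)) L.
  have -> : b * D1 - `|Cw| * S1 = prim (fun x => b * c2d f1 x ^+ 2 + (- `|Cw|) * f1 x ^+ 2) L.
    by rewrite (primD _ (locintZ _ (ld f1)) (locintZ _ (l f1))) !primZ// mulNr.
  apply: prim_le; first exact: ltW.
  - by apply: contD; apply: contM => //; exact: contC.
  - by apply: cdens; exact: hill_W_cont hd.
  move=> t _; rewrite /hill_density lerD2l; apply: ler_wpM2r; first exact: sqr_ge0.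
  by have := hCw t; have := ler_norm (- Cw); rewrite normrN; lra.
have g2 : b * D2 <= prim (hill_density b V2 f2 (c2d f2)) L.
  rewrite -(primZ _ _ (ld f2)); apply: prim_le; first exact: ltW.
  - by apply: contM => //; exact: contC.
  - exact: cdens.
  move=> t _; rewrite /hill_density lerDl mulr_ge0 ?sqr_ge0//.
  by have := V2_ge1 t; lra.
have ipS : ip u u <= k * (S1 + S2).
  rewrite mulrDr -!primZ// -primD; [|exact: locintZ|exact: locintZ].
  apply: prim_le; first exact: ltW.
  - exact: ip_cont.
  - by apply: contD; apply: contM => //; exact: contC.
  move=> t _; rewrite (coordK1 u t) (coordK2 u t) -/f1 -/f2 /k.
  set s := f1 t; set r := f2 t; set d := B - w; set e := w * B - 1.
  have h1 := sqr_ge0 (s - d * r); have h2 := sqr_ge0 (B * s - e * r).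
  have h3 := sqr_ge0 (d * s); have h4 := sqr_ge0 r; have h5 := sqr_ge0 (e * s).
  have h6 := sqr_ge0 (B * r).
  have -> : 2 * (1 + d ^+ 2 + B ^+ 2 + e ^+ 2) * s ^+ 2 +
    2 * (1 + d ^+ 2 + B ^+ 2 + e ^+ 2) * r ^+ 2 =
    ((s + d * r) * (s + d * r) + (B * s + e * r) * (B * s + e * r)) +
    (s - d * r) ^+ 2 + (B * s - e * r) ^+ 2 + 2 * (d * s) ^+ 2 + 2 * r ^+ 2 +
    2 * (e * s) ^+ 2 + 2 * (B * r) ^+ 2 by ring.
  lra.
have ip0 := ip_ge0 u.
have f_ge : nrm * (b * D1 - `|Cw| * S1) + nrm * (1 - w ^+ 2) * (b * D2) <= form u u.
  rewrite form_split; apply: lerD; apply: ler_wpM2l => //; first exact: ltW.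
  exact: ltW (mulr_gt0 n0 w0).
have up : z * ip u u <= `|z| * (k * (S1 + S2)).
  apply: (@le_trans _ _ (`|z| * ip u u)); first by apply: ler_wpM2r => //; exact: ler_norm.
  exact: ler_wpM2l.
have cq : c * q = nrm * `|Cw| + `|z| * k + 1 by rewrite /q mulrC divfK// gt_eqF.
have d1 : c * q * S1 <= nrm * b * D1.
  apply: (@le_trans _ _ (c * D1)); first by rewrite -mulrA; apply: ler_wpM2l => //; exact: ltW.
  have D10 : 0 <= D1 by apply: le_trans p1; exact: mulr_ge0.
  apply: ler_wpM2r => //; rewrite /c -mulrA [_ * b]mulrC mulrA.
  rewrite -[leRHS]mulr1; apply: ler_wpM2l; first exact: ltW (mulr_gt0 n0 b0).
  by have := sqr_ge0 w; lra.
have d2 : c * q * S2 <= nrm * (1 - w ^+ 2) * (b * D2).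
  by rewrite [leRHS]mulrA -/c -[leLHS]mulrA; apply: ler_wpM2l => //; exact: ltW.
have e1 : 0 <= nrm * `|Cw| * S2 by rewrite mulr_ge0// mulr_ge0//; exact: ltW.
rewrite cq in d1 d2.
have e2 : nrm * (b * D1 - `|Cw| * S1) = nrm * b * D1 - nrm * `|Cw| * S1 by ring.
have e3 s : (nrm * `|Cw| + `|z| * k + 1) * s = nrm * `|Cw| * s + `|z| * k * s + s by ring.
have e4 : `|z| * (k * (S1 + S2)) = `|z| * k * S1 + `|z| * k * S2 by ring.
rewrite e2 in f_ge; rewrite e4 in up; rewrite e3 in d1; rewrite e3 in d2.
have S0 : S1 + S2 <= 0 by lra.
apply: le_trans ipS _; have -> : S1 + S2 = 0 by lra.
by rewrite mulr0.
Qed.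

(** Only finitely many eigenvalues lie below a given level: too many independent
    eigenfunctions would have a nontrivial combination vanishing on the grid. *)
Lemma eigen_finite (z : R) : exists n, forall (t : 'I_n -> R) (f : 'I_n -> pair),
  injective t -> (forall i, t i <= z) -> (forall i, eigenpair (t i) (f i)) ->
  (forall i, exists x, (f i).1 x != 0 \/ (f i).2 x != 0) -> False.
Proof.
have [m m0 hm] := form_ge_grid z; exists (m + m).+1 => t f ti tz hf fn0.
pose E1 := \matrix_(i < (m + m).+1, j < m) (f i).1 (j%:R * (L / m%:R)).
pose E2 := \matrix_(i < (m + m).+1, j < m) (f i).2 (j%:R * (L / m%:R)).
have : kermx (row_mx E1 E2) != 0.
  rewrite kermx_eq0 /row_free neq_ltn; apply/orP; left.
  by apply: leq_ltn_trans (rank_leq_col _) _; exact: ltnSn.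
move=> /rowV0Pn[c /sub_kermxP]; rewrite mul_mx_row -[0]row_mx0 => /eq_row_mx[c1 c2] cn0.
pose a i := c 0 i; pose u := pair_sum a f.
have ipE i (v : 'I_(m + m).+1 -> R) : ip (f i) (pair_sum v f) = v i * ip (f i) (f i).
  rewrite ipC ip_suml (bigD1 i)//= big1 ?addr0// => j ji.
  by rewrite (eigen_orthogonal _ (hf j) (hf i)) ?mulr0//; apply: contra ji => /eqP/ti ->.
have fE : form u u = \sum_i a i ^+ 2 * (t i * ip (f i) (f i)).
  rewrite form_suml; apply: eq_bigr => i _.
  by rewrite (form_eigen _ (hf i)) ipE; ring.
have iE : ip u u = \sum_i a i ^+ 2 * ip (f i) (f i).
  by rewrite ip_suml; apply: eq_bigr => i _; rewrite ipE; ring.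
have i0 : ip u u <= 0.
  apply: hm.
    move=> j jm; split; rewrite /u /=.
      have := congr1 (fun A : 'rV_m => A 0 (Ordinal jm)) c1; rewrite !mxE => h.
      by apply: (eq_trans _ h); apply: eq_bigr => i _; rewrite mxE.
    have := congr1 (fun A : 'rV_m => A 0 (Ordinal jm)) c2; rewrite !mxE => h.
    by apply: (eq_trans _ h); apply: eq_bigr => i _; rewrite mxE.
  rewrite fE iE mulr_sumr; apply: ler_sum => i _; rewrite mulrCA.
  by apply: ler_wpM2r => //; rewrite mulr_ge0 ?sqr_ge0// ip_ge0.
case/negP: cn0; apply/eqP/rowP => i; rewrite mxE -/(a i).
have ti0 j : 0 <= a j ^+ 2 * ip (f j) (f j) by rewrite mulr_ge0 ?sqr_ge0// ip_ge0.
have : a i ^+ 2 * ip (f i) (f i) <= 0.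
  apply: le_trans i0; rewrite iE (bigD1 i)//= lerDl; exact: sumr_ge0.
have ip1 : 0 < ip (f i) (f i).
  rewrite ltNge; apply/negP => /ip_eq0 h; have [x] := fn0 i.
  by have [-> ->] := h x; rewrite eqxx => -[].
rewrite pmulr_lle0// => h; apply/eqP; rewrite -sqrf_eq0 eq_le h; exact: sqr_ge0.
Qed.

(** Solving the operator for the second derivatives. *)
Let D := b * (1 - w ^+ 2).

Lemma calT_solve (f u1 u2 d1 d2 g1 g2 : R) :
  (u1 - b * d1 + b * w * d2 + (B * f - w) * u2 = g1 /\
   b * w * d1 + (B * f - w) * u1 + u2 - b * d2 + f * u2 = g2) <->
  (d1 = u1 / b + f * (w * B * u1 + (B + w) * u2) / D - (g1 + w * g2) / D /\
   d2 = u2 / b + f * (B * u1 + (w * B + 1) * u2) / D - (w * g1 + g2) / D).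
Proof.
have b0' : b != 0 by rewrite gt_eqF.
have w0 : 1 - w ^+ 2 != 0 by rewrite gt_eqF.
by split=> -[h1 h2]; [rewrite -h1 -h2|rewrite h1 h2]; rewrite /D; split; field; rewrite ?b0' ?w0.
Qed.

(** The resulting real system of four second order equations for an eigenvalue
    zr + i zi; in an index, the first bit selects the component of the pair and the
    second one its real or imaginary part. *)
Definition wave_mx (c c' : bool) : R :=
  if c then (if c' then w * B + 1 else B) else (if c' then B + w else w * B).

Definition coef (zr zi : R) (i j : bool * bool) x : R :=
  (if i.2 == j.2 then (i.1 == j.1)%:R / b + phi x * wave_mx i.1 j.1 / D else 0) -
  (if i.1 == j.1 then 1 else w) *
  (if i.2 == j.2 then zr else if j.2 then - zi else zi) / D.

Definition source (g : bool * bool -> R -> R) (i : bool * bool) x : R :=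
  - ((if i.1 then w else 1) * g (false, i.2) x + (if i.1 then 1 else w) * g (true, i.2) x) / D.

(** Multiplication by zr + i zi on real and imaginary parts. *)
Definition zmul (zr zi : R) (U : bool * bool -> R) (c r : bool) : R :=
  if r then zr * U (c, true) + zi * U (c, false) else zr * U (c, false) - zi * U (c, true).

Lemma coef_sum zr zi (U : bool * bool -> R) g x i :
  source g i x + \sum_j coef zr zi i j x * U j =
  U i / b + phi x * (wave_mx i.1 false * U (false, i.2) + wave_mx i.1 true * U (true, i.2)) / D -
  ((if i.1 then w else 1) * (zmul zr zi U false i.2 + g (false, i.2) x) +
   (if i.1 then 1 else w) * (zmul zr zi U true i.2 + g (true, i.2) x)) / D.
Proof.
have b0' : b != 0 by rewrite gt_eqF.
have D0 : D != 0 by rewrite mulf_neq0// gt_eqF.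
rewrite (eq_bigr (fun j => coef zr zi i (j.1, j.2) x * U (j.1, j.2))); last by move=> -[].
rewrite -(pair_bigA _ (fun a c => coef zr zi i (a, c) x * U (a, c)))/= !big_bool/=.
by case: i => -[] []; rewrite /coef /source /zmul /wave_mx /=; field; rewrite b0' D0.
Qed.

Lemma coef_calT zr zi (U d : bool * bool -> R) g x :
  (forall i, d i = source g i x + \sum_j coef zr zi i j x * U j) <->
  (forall r, U (false, r) - b * d (false, r) + b * w * d (true, r) +
       (B * phi x - w) * U (true, r) = zmul zr zi U false r + g (false, r) x /\
     b * w * d (false, r) + (B * phi x - w) * U (false, r) + U (true, r) -
       b * d (true, r) + phi x * U (true, r) = zmul zr zi U true r + g (true, r) x).
Proof.
split=> h; first by move=> r; apply/calT_solve; split; rewrite h coef_sum /wave_mx /= ?mul1r.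
by move=> [[] r]; have /calT_solve[h1 h2] := h r; rewrite coef_sum /wave_mx /= ?mul1r.
Qed.

Lemma coef_cont zr zi i j : continuous (coef zr zi i j).
Proof.
apply: contB; last exact: contC.
case: (i.2 == j.2); last exact: contC.
apply: contD; first exact: contC.
apply: contM; last exact: contC.
by apply: contM => //; exact: contC.
Qed.

Lemma coef_per zr zi i j : Defs.periodic L (coef zr zi i j).
Proof. by move=> x; rewrite /coef phi_per. Qed.

Lemma coef_bounded zr zi : exists C, forall i j x, `|coef zr zi i j x| <= C.
Proof.
have [Cw hCw] := hill_W_lb hd.
pose Cp := (1 - w * B) / B ^+ 2 * (`|Cw| + 1).
have q0 : 0 <= (1 - w * B) / B ^+ 2 by rewrite divr_ge0 ?sqr_ge0// ltW// one_sub_wB_gt0.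
have hp x : `|phi x| <= Cp.
  rewrite phiE normrM ger0_norm//; apply: ler_wpM2l => //.
  have h1 := hCw x; have h2 := hill_W_lt0 hd x; have h3 := ler_norm (- Cw).
  by rewrite normrN in h3; rewrite ler0_norm; lra.
pose c (i j : bool * bool) := `|(i.1 == j.1)%:R / b| + Cp * `|wave_mx i.1 j.1 / D| +
  `|(if i.1 == j.1 then 1 else w) *
    (if i.2 == j.2 then zr else if j.2 then - zi else zi) / D|.
have Cp0 : 0 <= Cp by apply: le_trans (hp 0).
have c0 i j : 0 <= c i j by rewrite !addr_ge0// mulr_ge0.
exists (\sum_i \sum_j c i j) => i j x.
rewrite (bigD1 i)//= (bigD1 j)//= -[leRHS]addrA; apply: (@le_trans _ _ (c i j)); last first.
  rewrite lerDl addr_ge0//; first exact: sumr_ge0.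
  by apply: sumr_ge0 => k _; exact: sumr_ge0.
rewrite /coef /c; apply: le_trans (ler_normB _ _) _; rewrite lerD2r.
case: (i.2 == j.2); last by rewrite normr0 addr_ge0// mulr_ge0.
apply: le_trans (ler_normD _ _) _; rewrite lerD2l -mulrA normrM.
exact: ler_wpM2r.
Qed.

(** For the first case, periodicity over one period is upgraded to the whole line by
    [periodic_solution]. *)
Lemma resolvent_alternative (zr zi : R) :
  (exists U : bool * bool -> perC2 L, (exists i x, U i x != 0) /\
     forall i x, c2dd (U i) x = \sum_j coef zr zi i j x * U j x) \/
  (exists2 K, 0 <= K & forall H h, (forall i, continuous (H i)) ->
     (forall i, H i 0 = 0) -> (forall i x, 0 <= x <= L -> `|H i x| <= h) -> 0 <= h ->
     exists (u v : bool * bool -> R -> R) (al be : bool * bool -> R), [/\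
       forall i, continuous (u i) /\ continuous (v i),
       forall i x, u i x = al i + prim (v i) x,
       forall i x, v i x = be i + H i x + prim (fun t => \sum_j coef zr zi i j t * u j t) x,
       forall i, u i L = al i /\ v i L = be i &
       forall i x, 0 <= x <= L -> `|u i x| <= K * h]).
Proof.
have [C hC] := coef_bounded zr zi.
have [|] := second_order_alternative (@coef_cont zr zi) hC L0; last by right.
move=> [u [v [al [be [cuv [i0 nz] eu ev bc]]]]]; left.
have ev0 i x : v i x = be i + prim (fun=> 0) x +
    prim (fun t => \sum_j coef zr zi i j t * u j t) x by rewrite ev prim_cst0 addr0.
have [U hU] := @periodic_solution R _ L _ C (@coef_cont zr zi) hC (@coef_per zr zi)
  (fun _ _ => 0) u v al be (fun _ => @contC R 0) (fun _ _ => erefl) cuv eu ev0 bc.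
exists U; split; last first.
  move=> i x; have [_ _ ->] := hU i x; rewrite add0r; apply: eq_bigr => j _.
  by have [-> _ _] := hU j x.
apply: contrapT => hne.
have Uz i x : U i x = 0 by apply: contrapT => h; apply: hne; exists i, x; apply/eqP.
have Uz' i x : c2d (U i) x = 0.
  by apply: (der_uniq (c2_der (U i) x)); apply: der_ext (derC 0 x) => t; rewrite Uz.
case: nz; rewrite -?(bc i0).1 -?(bc i0).2.
  by have [<- _ _] := hU i0 L; rewrite Uz eqxx.
by have [_ <- _] := hU i0 L; rewrite Uz' eqxx.
Qed.

(** The same alternative with an L^2 bound: continuous data are integrated once, at
    the cost of a factor L by the Cauchy-Schwarz inequality, and a periodic
    continuous right-hand side makes the solution classical. *)
Lemma real_resolvent (z : R) :
  (exists u, (exists x, u.1 x != 0 \/ u.2 x != 0) /\ eigenpair z u) \/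
  (exists2 M, 0 <= M & forall u, exists v,
     (forall x, calT1 v x = z * v.1 x + u.1 x /\ calT2 v x = z * v.2 x + u.2 x) /\
     ip v v <= M * ip u u).
Proof.
have [[U [[i0 [x0 nz]] hU]]|[K K0 hK]] := resolvent_alternative z 0.
  left; exists (U (false, i0.2), U (true, i0.2)); split.
    by exists x0; case: i0 nz => -[] r /=; [right|left].
  move=> x; have /coef_calT h : forall i, c2dd (U i) x =
      source (fun _ _ => 0) i x + \sum_j coef z 0 i j x * U j x.
    by move=> i; rewrite hU /source !mulr0 addr0 oppr0 mul0r add0r.
  have [h1 h2] := h i0.2; rewrite /calT1 /calT2 /= h1 h2 !addr0 /zmul.
  by case: i0.2; rewrite !mul0r ?addr0 ?subr0.
pose c := 2 * (1 + w ^+ 2) / D ^+ 2.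
have D0 : 0 < D by rewrite mulr_gt0.
have c0 : 0 <= c by rewrite divr_ge0 ?sqr_ge0// mulr_ge0// addr_ge0// sqr_ge0.
right; exists (2 * K ^+ 2 * (L * c) * L).
  have lL := ltW L0.
  exact: (mulr_ge0 (mulr_ge0 (mulr_ge0 (ler0n R 2) (sqr_ge0 K)) (mulr_ge0 lL c0)) lL).
move=> u; pose g (i : bool * bool) x := if i.2 then 0 else if i.1 then u.2 x else u.1 x.
have cg i : continuous (g i).
  by rewrite /g; case: i.2; case: i.1; (try exact: contC); exact: c2f_cont.
have cs i : continuous (source g i).
  apply: contM; last exact: contC.
  by apply: contN; apply: contD; apply: contM => //; exact: contC.
have ps i : Defs.periodic L (source g i).
  by move=> x; rewrite /source /g /=; case: i.2; rewrite ?(c2_per u.1) ?(c2_per u.2).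
have cs2 i : continuous (fun x => source g i x ^+ 2) by exact: contX.
have ip0 := ip_ge0 u.
have A0 : 0 <= L * (c * ip u u) by exact: (mulr_ge0 (ltW L0) (mulr_ge0 c0 ip0)).
have hH i x : 0 <= x <= L -> `|prim (source g i) x| <= Num.sqrt (L * (c * ip u u)).
  move=> hx; rewrite -sqrtr_sqr ler_wsqrtr//.
  apply: le_trans (prim_sqr_le L0 (@cs i) hx) _; apply: ler_wpM2l; first exact: ltW.
  rewrite -(primZ c _ (cont_locint (@ip_cont u u))); apply: prim_le => //.
  - exact: ltW.
  - by apply: contM; [exact: contC|exact: ip_cont].
  move=> t _; rewrite /source /g /=; case: i.2.
    rewrite !mulr0 addr0 oppr0 mul0r expr0n/= mulr_ge0//.
    by rewrite -!expr2 addr_ge0// sqr_ge0.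
  have cauchy (c1 c2 d1 d2 : R) :
      (c1 * d1 + c2 * d2) ^+ 2 <= 2 * (c1 ^+ 2 + c2 ^+ 2) * (d1 * d1 + d2 * d2).
    have h1 := sqr_ge0 (c1 * d2 - c2 * d1).
    have h2 : 0 <= (c1 ^+ 2 + c2 ^+ 2) * (d1 ^+ 2 + d2 ^+ 2).
      by rewrite mulr_ge0// addr_ge0// sqr_ge0.
    by nra.
  rewrite expr_div_n sqrrN /c [leRHS]mulrAC; apply: ler_wpM2r.
    by rewrite invr_ge0 sqr_ge0.
  by apply: le_trans (cauchy _ _ _ _) _; case: i.1; rewrite ?expr1n// [w ^+ 2 + 1]addrC.
have [|||u' [v' [al [be [cuv eu ev bc bd]]]]] := hK (fun i => prim (source g i)) _ _ _ hH.
- by move=> i; apply: prim_continuous; apply: cont_locint; exact: cs.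
- by move=> i; exact: prim0.
- by rewrite sqrtr_ge0.
have [C hC] := coef_bounded z 0.
have [U hU] := periodic_solution (@coef_cont z 0) hC (@coef_per z 0) cs ps cuv eu ev bc.
have UE i x : U i x = u' i x by case: (hU i x).
exists (U (false, false), U (true, false)); split.
  move=> x; have /coef_calT h : forall i, c2dd (U i) x =
      source g i x + \sum_j coef z 0 i j x * U j x.
    by move=> i; have [_ _ ->] := hU i x; congr (_ + _); apply: eq_bigr => j _; rewrite UE.
  have [h1 h2] := h false; rewrite /calT1 /calT2 /= h1 h2 /zmul /g /=.
  by rewrite !mul0r !subr0.
have bU i x : 0 <= x <= L -> U i x ^+ 2 <= K ^+ 2 * (L * (c * ip u u)).
  move=> hx; rewrite -(sqr_sqrtr A0) -exprMn UE -real_normK ?num_real//.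
  by rewrite lerXn2r ?nnegrE//; [rewrite mulr_ge0// sqrtr_ge0|exact: bd].
set A := K ^+ 2 * (L * (c * ip u u)) in bU.
have -> : 2 * K ^+ 2 * (L * c) * L * ip u u = (2 * A) * L by rewrite /A; ring.
have -> : (2 * A) * L = prim (fun=> 2 * A) L.
  by apply/esym; apply: (@prim_eq _ _ (fun x => 2 * A * x));
    [exact: contC|move=> t; apply: (der_eq (derScale (2 * A) (derid t))); rewrite mulr1|rewrite mulr0].
apply: prim_le; [exact: ltW|exact: ip_cont|exact: contC|].
by move=> t ht; rewrite -!expr2 mulr_natl mulr2n; apply: lerD; exact: bU.
Qed.

(** A negative eigenvalue exists: the infimum of the Rayleigh quotient is negative,
    as the constant (1, B) shows. If it were not an eigenvalue, the bounded inverse v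
    of u would give form (u - t v) >= 0 for t small, hence a larger lower bound. *)
Lemma negative_exists : exists z u, [/\ z < 0, exists x, u.1 x != 0 \/ u.2 x != 0 &
  eigenpair z u].
Proof.
pose E : set R := [set r | exists u, 0 < ip u u /\ r = form u u / ip u u].
have [C [C0 hC]] := form_semibounded.
pose u1 : pair := (c2_cst L 1, c2_cst L B).
have n0 := nrm_gt0; have n0' : nrm != 0 by rewrite gt_eqF.
have ip1 : 0 < ip u1 u1.
  rewrite ltNge; apply/negP => /ip_eq0 /(_ 0)[/eqP]; by rewrite /= oner_eq0.
have form1 : form u1 u1 < 0.
  have c1 x : (1 - w * B) / nrm * 1 + (B - w) / nrm * B = 1.
    by have := nrm_gt0; rewrite /nrm => h; field; rewrite gt_eqF.
  have c2 x : B / nrm * 1 + - nrm^-1 * B = 0 by ring.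
  have -> : form u1 u1 = nrm * prim W L.
    rewrite form_split; have -> : hill_density b W (coord1 u1) (c2d (coord1 u1)) = W.
      by apply/funext => x; rewrite /hill_density /= (c1 x); ring.
    have -> : hill_density b V2 (coord2 u1) (c2d (coord2 u1)) = (fun=> 0).
      by apply/funext => x; rewrite /hill_density /= (c2 x); ring.
    by rewrite prim_cst0 mulr0 addr0.
  by rewrite pmulr_rlt0// W_int_lt0.
have Eu1 : E (form u1 u1 / ip u1 u1) by exists u1.
have Elb : lbound E (- C).
  by move=> _ [u [u0 ->]]; rewrite ler_pdivlMr// hC.
have hinf : has_inf E by split; [exists (form u1 u1 / ip u1 u1)|exists (- C)].
pose z := inf E.
have zle u : z * ip u u <= form u u.
  have [h|h] := ltP 0 (ip u u).
    by rewrite -ler_pdivlMr//; apply: ge_inf; [exists (- C)|exists u].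
  have i0 : ip u u = 0 by apply/eqP; rewrite eq_le h ip_ge0.
  have uz := ip_eq0 h; rewrite i0 mulr0 /form.
  have -> : (fun x => calT1 u x * u.1 x + calT2 u x * u.2 x) = (fun _ : R => 0 : R).
    by apply/funext => x; have [-> ->] := uz x; rewrite !mulr0 addr0.
  by rewrite prim_cst0.
have z0 : z < 0.
  apply: le_lt_trans (ge_inf _ Eu1) _; first by exists (- C).
  by rewrite pmulr_llt0 ?invr_gt0.
have [[u [nu eu]]|[M M0 hM]] := real_resolvent z; first by exists z, u.
pose M' := (1 + M) / 2; have M'0 : 0 < M' by rewrite divr_gt0//; lra.
have lb : lbound E (z + M'^-1).
  move=> _ [u [u0 ->]]; rewrite ler_pdivlMr// mulrDl.
  have [v [ev bv]] := hM u.
  have nv t : form v t - z * ip v t = ip u t.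
    rewrite -(primZ z _ (cont_locint (@ip_cont v t))).
    have -> : form v t = prim (fun x => z * (v.1 x * t.1 x + v.2 x * t.2 x) +
        (u.1 x * t.1 x + u.2 x * t.2 x)) L.
      by congr (prim _ L); apply/funext => x; have [-> ->] := ev x; ring.
    rewrite (primD _ (locintZ _ (cont_locint (@ip_cont v t))) (cont_locint (@ip_cont u t))).
    by rewrite addrAC subrr add0r.
  pose s := M'^-1; have := zle (pair_lin 1 u (- s) v).
  rewrite form_linl !form_linr ip_linl !ip_linr (formC u v) (ipC u v).
  have e1 := nv u; have e2 := nv v.
  have uv : ip u v <= M' * ip u u.
    have := ip_ge0 (pair_lin 1 u (-1) v); rewrite ip_linl !ip_linr (ipC v u).
    by rewrite /M'; lra.
  have s0 : 0 < s by rewrite invr_gt0.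
  have sM : s * M' = 1 by rewrite mulVf// gt_eqF.
  have h2 : s ^+ 2 * ip u v <= s * ip u u.
    have := ler_wpM2l (sqr_ge0 s) uv.
    by have -> : s ^+ 2 * (M' * ip u u) = s * (s * M') * ip u u by [ring]; rewrite sM mulr1.
  have e1' : form v u = z * ip v u + ip u u by lra.
  have e2' : form v v = z * ip v v + ip u v by lra.
  rewrite e1' e2' => h.
  have : z * ip u u + 2 * s * ip u u - s ^+ 2 * ip u v <= form u u.
    move: h; rewrite !mul1r.
    have -> : z * (ip u u + - s * ip v u + - s * (ip v u + - s * ip v v)) =
      z * ip u u - 2 * s * z * ip v u + s ^+ 2 * z * ip v v by ring.
    have -> : form u u + - s * (z * ip v u + ip u u) +
      - s * (z * ip v u + ip u u + - s * (z * ip v v + ip u v)) =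
      form u u - 2 * s * z * ip v u - 2 * s * ip u u + s ^+ 2 * z * ip v v + s ^+ 2 * ip u v by ring.
    lra.
  by rewrite -/s; lra.
have := lb_le_inf (proj1 hinf) lb; rewrite -/z gerDl.
by rewrite leNgt invr_gt0 M'0.
Qed.

End RealOperator.

(** * Integration by parts and trigonometric test functions *)

Section IntegrationByParts.
Context {R : realType}.
Local Notation mu := (@lebesgue_measure R).
Implicit Types (f g : R -> R) (x y X : R).

Lemma locintM f g : locint f -> continuous g -> locint (fun x => f x * g x).
Proof.
move=> hf cg a b.
have mg : measurable_fun (`[a, b] : set R) g.
  by apply: measurable_funTS; exact: measurable_realfun.continuous_measurable_fun.
have bg : [bounded g x | x in (`[a, b] : set R)].
  have [K [K0 hK]] := cont_bounded a b cg.
  exists K; split; first exact: num_real.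
  by move=> M KM x /=; rewrite in_itv/= => /hK h; apply: le_trans h (ltW KM).
have := integrableMl _ (hf a b) mg bg; move/(_ (measurable_itv _)).
by congr (integrable _ _ _); apply/funext => x /=; rewrite EFinM.
Qed.

Lemma locint_norm f : locint f -> locint (fun x => `|f x|).
Proof. by move=> hf a b; exact: integrable_norm (hf a b). Qed.

Lemma prim_diff f x y : locint f -> 0 <= x -> x <= y ->
  prim f y - prim f x = \int[mu]_(t in `[x, y]) f t.
Proof.
move=> hf x0 xy; rewrite !prim_pos//; last exact: le_trans xy.
by rewrite (Rint_chasles hf x0 xy) addrAC subrr add0r.
Qed.

(** A bound of the increments by (y - x) (A y - A x) is of second order: summed over
    a subdivision of mesh h, it is at most h times the total increment of A. *)
Lemma increments_const (Phi A : R -> R) (C X : R) : 0 <= X ->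
  (forall x y, 0 <= x -> x <= y -> y <= X ->
     `|Phi y - Phi x| <= C * (y - x) * (A y - A x)) -> Phi X = Phi 0.
Proof.
move=> X0 h; apply/eqP; rewrite -subr_eq0; apply/eqP/(@le_geo_eq0 _ (C * X * (A X - A 0))) => n.
pose m := (2 ^ n)%N; pose s : R := X / m%:R.
have m0 : (0 : R) < m%:R by rewrite ltr0n expn_gt0.
have s0 : 0 <= s by rewrite divr_ge0// ltW.
have sm : s * m%:R = X by rewrite divfK// gt_eqF.
have ind (i : nat) : (i <= m)%N ->
    `|Phi (s * i%:R) - Phi 0| <= C * s * (A (s * i%:R) - A 0).
  elim: i => [|i ih] hi; first by rewrite mulr0 !subrr normr0 mulr0.
  have -> : Phi (s * i.+1%:R) - Phi 0 = (Phi (s * i.+1%:R) - Phi (s * i%:R)) +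
      (Phi (s * i%:R) - Phi 0) by rewrite addrA subrK.
  apply: le_trans (ler_normD _ _) _.
  have st : s * i.+1%:R - s * i%:R = s by rewrite -mulrBr -natrB// subSnn mulr1.
  have h1 : 0 <= s * i%:R by rewrite mulr_ge0.
  have h2 : s * i%:R <= s * i.+1%:R by rewrite -subr_ge0 st.
  have h3 : s * i.+1%:R <= X by rewrite -sm ler_wpM2l// ler_nat.
  have := h _ _ h1 h2 h3; rewrite st => h4; have h5 := ih (ltnW hi); lra.
have := ind m (leqnn m); rewrite sm => hm; apply: le_trans hm _.
rewrite /s /m natrX exprVn le_eqVlt; apply/orP; left; apply/eqP; ring.
Qed.

(** Valid for [v] merely integrable: the defect of the formula has increments of
    second order, controlled by the integral of |v|, so it is constant. *)
Lemma prim_by_parts (v th th' : R -> R) X : 0 <= X -> locint v ->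
  (forall x : R, is_derive x 1 th (th' x)) -> continuous th' ->
  prim (fun x => v x * th x) X = prim v X * th X - prim (fun x => prim v x * th' x) X.
Proof.
move=> X0 lv dth cth'.
have cth := der_contT dth; have cV := prim_continuous lv.
have lvt := locintM lv cth; have cVt := contM cV cth'; have lVt := cont_locint cVt.
pose A := prim (fun x => `|v x|); have la := locint_norm lv.
have [C [C0 hC]] := cont_bounded 0 X cth'.
pose Phi x := prim (fun x => v x * th x) x - (prim v x * th x - prim (fun x => prim v x * th' x) x).
suff : Phi X = Phi 0 by rewrite /Phi !prim0 mul0r !subr0 => /eqP; rewrite subr_eq0 => /eqP.
apply: (@increments_const _ A (2 * C)) => // x y x0 xy yX.
have y0 := le_trans x0 xy.
have incA : A y - A x = \int[mu]_(t in `[x, y]) `|v t| by exact: prim_diff.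
have incV t : x <= t <= y -> `|prim v t - prim v x| <= A y - A x.
  move=> /andP[xt ty]; rewrite (prim_diff lv x0 xt).
  apply: le_trans (le_normr_Rintegral _ (lv x t)) _ => //.
  rewrite incA (Rint_chasles la xt ty) lerDl; exact: Rintegral_ge0.
have inct t : x <= t <= y -> `|th t - th y| <= C * (y - x).
  move=> /andP[xt ty]; have t0 := le_trans x0 xt.
  have h1 : C * t - th t <= C * y - th y.
    apply: (@nondecr_der _ (fun s => C * s - th s) (fun s => C - th' s)) => // s.
      by move=> _; apply: (der_eq (derB (derScale C (derid s)) (dth s))); rewrite mulr1.
    move=> /andP[/ltW s1 /ltW s2]; have /hC : 0 <= s <= X.
      by rewrite (le_trans t0 s1) (le_trans s2 yX).
    by rewrite ler_norml => /andP[_ h]; rewrite subr_ge0.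
  have h2 : C * t + th t <= C * y + th y.
    apply: (@nondecr_der _ (fun s => C * s + th s) (fun s => C + th' s)) => // s.
      by move=> _; apply: (der_eq (derD (derScale C (derid s)) (dth s))); rewrite mulr1.
    move=> /andP[/ltW s1 /ltW s2]; have /hC : 0 <= s <= X.
      by rewrite (le_trans t0 s1) (le_trans s2 yX).
    by rewrite ler_norml => /andP[h _]; lra.
  have h3 : C * (t - x) >= 0 by rewrite mulr_ge0// subr_ge0.
  by rewrite ler_norml; apply/andP; split; lra.
pose q1 t := v t * (th t - th y); pose q2 t := (prim v t - prim v x) * th' t.
have c1 : continuous (fun t => th t - th y) by apply: contB => //; exact: contC.
have l1 : locint q1 by exact: locintM.
have cq2 : continuous q2 by apply: contM => //; apply: contB => //; exact: contC.
have l2 := cont_locint cq2.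
have e1 : prim (fun t => v t * th t) y - prim (fun t => v t * th t) x =
    \int[mu]_(t in `[x, y]) q1 t + th y * (prim v y - prim v x).
  rewrite (prim_diff lvt x0 xy) (prim_diff lv x0 xy).
  rewrite -RintegralZl//.
  rewrite -RintegralD//; last exact: (locintZ (th y) lv x y).
  by apply: eq_Rintegral => t _; rewrite /q1; ring.
have e2 : prim (fun t => prim v t * th' t) y - prim (fun t => prim v t * th' t) x =
    \int[mu]_(t in `[x, y]) q2 t + prim v x * (th y - th x).
  rewrite (prim_diff lVt x0 xy).
  have -> : th y - th x = \int[mu]_(t in `[x, y]) th' t.
    by rewrite -(prim_diff (cont_locint cth') x0 xy) !(prim_unique cth' dth); ring.
  rewrite -RintegralZl//; last exact: (cont_locint cth' x y).
  rewrite -RintegralD//; last exact: (locintZ (prim v x) (cont_locint cth') x y).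
  by apply: eq_Rintegral => t _; rewrite /q2; ring.
have -> : Phi y - Phi x = \int[mu]_(t in `[x, y]) q1 t + \int[mu]_(t in `[x, y]) q2 t.
  by rewrite /Phi; lra.
apply: le_trans (ler_normD _ _) _.
have b1 : `|\int[mu]_(t in `[x, y]) q1 t| <= C * (y - x) * (A y - A x).
  apply: le_trans (le_normr_Rintegral _ (l1 x y)) _ => //.
  rewrite incA -RintegralZl//.
  apply: le_Rintegral => //; [exact: (locint_norm l1 x y)|exact: (locintZ (C * (y - x)) la x y)|].
  move=> t /=; rewrite in_itv/= => ht; rewrite /q1 normrM mulrC.
  by apply: ler_wpM2r => //; exact: inct.
have b2 : `|\int[mu]_(t in `[x, y]) q2 t| <= C * (y - x) * (A y - A x).
  apply: le_trans (le_normr_Rintegral _ (l2 x y)) _ => //.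
  have -> : C * (y - x) * (A y - A x) = \int[mu]_(t in `[x, y]) (C * (A y - A x)).
    have dc (t : R) : is_derive t 1 (fun t => C * (A y - A x) * t) (C * (A y - A x)).
      by apply: (der_eq (derScale _ (derid t))); rewrite mulr1.
    rewrite -(prim_diff (cont_locint (@contC _ (C * (A y - A x)))) x0 xy).
    rewrite !(prim_unique (F := fun t => C * (A y - A x) * t) (@contC _ (C * (A y - A x))) dc).
    by ring.
  apply: le_Rintegral => //; [exact: (locint_norm l2 x y)|exact: (cont_locint (@contC _ (C * (A y - A x))) x y)|].
  move=> t /=; rewrite in_itv/= => ht; rewrite /q2 normrM mulrC.
  have /hC h : 0 <= t <= X.
    by case/andP: ht => h1 h2; rewrite (le_trans x0 h1) (le_trans h2 yX).
  by apply: ler_pM => //; exact: incV.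
have -> : 2 * C * (y - x) * (A y - A x) = C * (y - x) * (A y - A x) + C * (y - x) * (A y - A x).
  by ring.
exact: lerD.
Qed.

End IntegrationByParts.

Section TrigonometricTests.
Context {R : realType}.
Local Notation mu := (@lebesgue_measure R).
Implicit Types (f g : R -> R) (x y : R) (P Q : {poly R}).
Variable L : R.
Hypothesis L0 : 0 < L.
Let kap := pi *+ 2 / L.

Lemma der_derivable f x (df : R) : is_derive x 1 f df -> derivable f x 1.
Proof. by move=> h; exact: ex_derive. Qed.

(** Polynomials in the cosine and sine of frequency 2 pi / L, centred at [x0]; the
    normal form is stable under differentiation because cos^2 + sin^2 = 1. *)
Definition trig (x0 : R) P Q x := P.[cos (kap * (x - x0))] + sin (kap * (x - x0)) * Q.[cos (kap * (x - x0))].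

Lemma der_trig x0 P Q x : is_derive x 1 (trig x0 P Q)
  (trig x0 (kap *: ('X * Q - (1 - 'X^2) * Q^`())) (- kap *: P^`()) x).
Proof.
have d0 : is_derive x 1 (fun t => kap * (t - x0)) kap.
  by apply: (der_eq (derScale kap (derB (derid x) (derC x0 x)))); rewrite subr0 mulr1.
have dc := @dercomp _ (@cos R) (fun t => kap * (t - x0)) x _ _ (is_derive_cos _) d0.
have ds := @dercomp _ (@sin R) (fun t => kap * (t - x0)) x _ _ (is_derive_sin _) d0.
have dP := @dercomp _ (horner P) (fun t => cos (kap * (t - x0))) x _ _ (is_derive_poly P _) dc.
have dQ := @dercomp _ (horner Q) (fun t => cos (kap * (t - x0))) x _ _ (is_derive_poly Q _) dc.
have hP (r c : R) : (r *: ('X * Q - (1 - 'X^2) * Q^`())).[c] = r * (c * Q.[c] - (1 - c ^+ 2) * Q^`().[c]).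
  by rewrite !hornerE.
apply: (der_eq (derD dP (derM ds dQ))); rewrite /trig hP hornerZ.
have := cos2Dsin2 (kap * (x - x0)).
move: (cos (kap * (x - x0))) (sin (kap * (x - x0))) => c s h; have -> : 1 - c ^+ 2 = s ^+ 2 by rewrite -h; ring.
by ring.
Qed.

Lemma trig_cont x0 P Q : continuous (trig x0 P Q).
Proof. exact: der_contT (der_trig x0 P Q). Qed.

Lemma trig_per x0 P Q : Defs.periodic L (trig x0 P Q).
Proof.
move=> x; rewrite /trig.
have -> : kap * (x + L - x0) = kap * (x - x0) + pi *+ 2.
  by rewrite /kap; field; rewrite gt_eqF.
by rewrite cosD2pi sinD2pi.
Qed.

Lemma trig_deriven x0 P Q n : exists P' Q', ((trig x0 P Q)^`(n))%classic = trig x0 P' Q'.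
Proof.
elim: n => [|n [P' [Q' ih]]]; first by exists P, Q; rewrite derive1n0.
rewrite derive1nS ih; eexists; eexists; apply/funext => x.
exact: (der_val (der_trig x0 P' Q' x)).
Qed.

Lemma smooth_per_trig x0 P Q : smooth_per L (trig x0 P Q).
Proof.
split=> [|n x]; first exact: trig_per.
have [P' [Q' ->]] := trig_deriven x0 P Q n; exact: der_derivable (der_trig x0 P' Q' x).
Qed.

Lemma smooth_per_der theta : smooth_per L theta ->
  (forall x : R, is_derive x 1 theta ((theta^`())%classic x)) /\ continuous ((theta^`())%classic).
Proof.
move=> [_ h]; split=> x.
  by rewrite derive1E; apply: derivableP; exact: (h 0%N x).
have := h 1%N x; rewrite derive1n1 => /derivable1_diffP; exact: differentiable_continuous.
Qed.

(** Subtracting the mean makes the primitive periodic; this is how arbitrary test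
    functions arise as derivatives of test functions, up to constants. *)
Lemma smooth_per_prim theta (a := prim theta L / L) (Theta := fun x => prim theta x - a * x) :
  smooth_per L theta -> smooth_per L Theta /\ (Theta^`())%classic = (fun x => theta x - a).
Proof.
move=> st; have [dt _] := smooth_per_der st; have ct := der_contT dt.
have dT x : is_derive x 1 Theta (theta x - a).
  by apply: (der_eq (derB (prim_der ct x) (derScale a (derid x)))); rewrite mulr1.
have de : (Theta^`())%classic = (fun x => theta x - a).
  by apply/funext => x; exact: der_val (dT x).
have de2 : ((fun x => theta x - a)^`())%classic = (theta^`())%classic.
  apply/funext => x; apply: der_val; apply: (der_eq (derB (dt x) (derC a x))).
  by rewrite subr0.
split; last exact: de.
split=> [x|].
  rewrite /Theta (prim_periodic x ct st.1) /a; have : L != 0 by rewrite gt_eqF.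
  by move=> Ln0; field.
case=> [|[|n]] x.
- by rewrite derive1n0; exact: der_derivable (dT x).
- rewrite derive1n1 de; exact: der_derivable (derB (dt x) (derC a x)).
- rewrite 2!derive1Sn de de2 -derive1Sn; exact: st.2.
Qed.

Lemma smooth_per_cst (c : R) : smooth_per L (fun=> c) /\ ((fun _ : R => c)^`())%classic = (fun=> 0).
Proof.
have de : ((fun _ : R => c)^`())%classic = (fun=> 0) :> (R -> R).
  by apply/funext => x; exact: (der_val (derC c x)).
have dn n : exists c' : R, ((fun _ : R => c)^`(n))%classic = (fun=> c').
  elim: n => [|n [c' ih]]; first by exists c; rewrite derive1n0.
  by exists 0; rewrite derive1nS ih; apply/funext => x; exact: (der_val (derC c' x)).
split=> //; split=> // n x; have [c' ->] := dn n; exact: der_derivable (derC c' x).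
Qed.

Lemma prim_incr_ge f (c x y : R) : continuous f -> x <= y ->
  (forall t, x <= t <= y -> c <= f t) -> c * (y - x) <= prim f y - prim f x.
Proof.
move=> cf xy hf; have : prim f x - c * x <= prim f y - c * y; last by lra.
apply: (@nondecr_der _ (fun t => prim f t - c * t) (fun t => f t - c)) => // t.
  by move=> _; apply: (der_eq (derB (prim_der cf t) (derScale c (derid t)))); rewrite mulr1.
by move=> /andP[/ltW h1 /ltW h2]; rewrite subr_ge0 hf// h1.
Qed.

(** The function 1 + cos - a peaks at [x0]: its powers grow geometrically near [x0]
    and, within a period, stay bounded at distance [del] or more. *)
Lemma trig_peak x0 del : 0 < del -> del <= L / 4 -> exists P q, [/\ 1 < q,
  forall x, `|x - x0| <= del -> 1 <= trig x0 P 0 x,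
  forall x, `|x - x0| <= del / 2 -> q <= trig x0 P 0 x &
  forall x, del <= `|x - x0| <= L - del -> `|trig x0 P 0 x| <= 1].
Proof.
move=> del0 del1; have pi0 := @pi_gt0 R.
have k0 : 0 < kap by rewrite divr_gt0// mulrn_wgt0.
have kL : kap * L = pi *+ 2 by rewrite divfK// gt_eqF.
have kd : kap * del <= pi / 2.
  have : kap * del <= kap * (L / 4) by rewrite ler_wpM2l// ltW.
  by rewrite mulrA kL -mulr_natr; lra.
have kd0 : 0 < kap * del by rewrite mulr_gt0.
have kd2 : kap * (del / 2) = kap * del / 2 by rewrite mulrA.
have cosle (s t : R) : 0 <= s -> s <= t -> t <= pi -> cos t <= cos s.
  move=> s0; rewrite le_eqVlt => /predU1P[->//|st] tp; apply: ltW.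
  by rewrite ltr_cos ?in_itv/= ?s0 ?tp ?(le_trans s0 (ltW st)) ?(le_trans (ltW st) tp).
pose a := cos (kap * del).
have a0 : 0 <= a by apply: cos_ge0_pihalf; apply/andP; split; lra.
have tE x : trig x0 ((1 - a)%:P + 'X) 0 x = 1 + cos (kap * (x - x0)) - a.
  by rewrite /trig !hornerE; ring.
have tnorm x : cos (kap * (x - x0)) = cos (kap * `|x - x0|).
  by rewrite -[LHS]cos_norm normrM (gtr0_norm k0).
exists ((1 - a)%:P + 'X), (1 + cos (kap * (del / 2)) - a); split=> [|x hx|x hx|x /andP[hx up]].
- have : a < cos (kap * (del / 2)); last by lra.
  by rewrite /a kd2 ltr_cos ?in_itv/=; [lra|apply/andP; split; lra|apply/andP; split; lra].
- have : a <= cos (kap * (x - x0)); last by rewrite tE; lra.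
  rewrite tnorm; apply: cosle; [|by rewrite ler_wpM2l// ltW|by lra].
  by rewrite mulr_ge0// ltW.
- have : cos (kap * (del / 2)) <= cos (kap * (x - x0)); last by rewrite tE; lra.
  rewrite tnorm; apply: cosle; [|by rewrite ler_wpM2l// ltW|by rewrite kd2; lra].
  by rewrite mulr_ge0// ltW.
have g1 := cos_geN1 (kap * (x - x0)); have g2 : a <= 1 := cos_le1 _.
have : cos (kap * (x - x0)) <= a; last by rewrite ler_norml tE => h; apply/andP; split; lra.
have h1 : kap * del <= kap * `|x - x0| by rewrite ler_wpM2l// ltW.
have h2 : kap * `|x - x0| <= pi *+ 2 - kap * del by rewrite -kL -mulrBr ler_wpM2l// ltW.
rewrite tnorm; move: (kap * `|x - x0|) h1 h2 => r h1 h2.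
have [h|h] := leP r pi; first by apply: cosle => //; exact: ltW.
(* beyond pi, reflect *)
have -> : cos r = cos (pi *+ 2 - r).
  by rewrite -[in RHS]cosN opprB -[LHS]cosD2pi -[in RHS]cosD2pi subrK cosD2pi.
by rewrite mulr2n in h2 *; apply: cosle; [exact: ltW|lra|lra].
Qed.

(** A continuous function orthogonal to all trigonometric polynomials vanishes: near a
    point where it is positive, its integral against the powers of a peak diverges. *)
Lemma trig_orthogonal_npos f : continuous f ->
  (forall x0 P Q, prim (fun x => f x * trig x0 P Q x) L = 0) ->
  forall x1, 0 <= x1 <= L -> f x1 <= 0.
Proof.
move=> cf hf x1 /andP[x10 x1L]; rewrite leNgt; apply/negP => f1.
have [M [M0 hM]] := cont_bounded 0 L cf.
have f2 : 0 < f x1 / 2 by rewrite divr_gt0.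
have [e /= e0 he] : exists2 e : R, 0 < e & forall x, `|x - x1| < e -> f x1 / 2 < f x.
  have h2 : f x1 / 2 < f x1 by lra.
  have [e /= e0 he] := cvgr_gt _ (cf x1) _ h2.
  by exists e => // x hx; apply: he; rewrite /= distrC.
pose del : R := Num.min (e / 4) (L / 4).
have del0 : 0 < del by rewrite lt_min !divr_gt0.
have del1 : del <= e / 4 by rewrite ge_min lexx.
have del2 : del <= L / 4 by rewrite ge_min lexx orbT.
have [x0 [x0a x0b x0c]] : exists x0 : R, [/\ del <= x0, x0 <= L - del & `|x0 - x1| = del].
  have [h|h] := leP x1 (L / 2).
    exists (x1 + del); split; [lra|lra|].
    by rewrite addrAC subrr add0r gtr0_norm.
  exists (x1 - del); split; [lra|lra|].
  by rewrite addrAC subrr add0r normrN gtr0_norm.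
have fpos x : `|x - x0| <= del -> f x1 / 2 <= f x.
  move=> hx; apply/ltW/he; have -> : x - x1 = (x - x0) + (x0 - x1) by ring.
  by apply: le_lt_trans (ler_normD _ _) _; rewrite x0c; lra.
have [P [q [q1 near nearer far]]] := trig_peak x0 del0 del2.
have q0 : 0 <= q by apply/ltW/(lt_trans _ q1).
pose t := trig x0 P 0; pose J n x := f x * t x ^+ n.
have tn n : (fun x => t x ^+ n) = trig x0 (P ^+ n) 0.
  by apply/funext => x; rewrite /t /trig horner_exp !horner0 !mulr0 !addr0.
have JE n : J n = (fun x => f x * trig x0 (P ^+ n) 0 x) by rewrite -tn.
have cJ n : continuous (J n) by rewrite JE; apply: contM => //; exact: trig_cont.
have J0 n : prim (J n) L = 0 by rewrite JE.
have xin x : 0 <= x <= L -> `|x - x0| <= L - del.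
  by move=> /andP[xa xb]; rewrite ler_norml; apply/andP; split; lra.
have Jlow n x : 0 <= x <= L -> - M <= J n x.
  move=> hx; have [h|h] := leP `|x - x0| del.
    apply: (@le_trans _ _ 0); first by rewrite oppr_le0.
    apply: mulr_ge0; first exact: le_trans (ltW f2) (fpos x h).
    exact: exprn_ge0 (le_trans ler01 (near x h)).
  suff : `|J n x| <= M by rewrite ler_norml => /andP[].
  rewrite /J normrM normrX -[M]mulr1; apply: ler_pM => //; first exact: hM.
  by rewrite exprn_ile1//; apply: far; rewrite xin// andbT ltW.
have p1E : 0 <= x0 - del / 2 by lra.
have p2E : x0 + del / 2 <= L by lra.
have p12 : x0 - del / 2 <= x0 + del / 2 by lra.
pose p1 := x0 - del / 2; pose p2 := x0 + del / 2.
have pos n : f x1 / 2 * q ^+ n * del <= M * L.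
  have i1 : - M * (p1 - 0) <= prim (J n) p1 - prim (J n) 0.
    apply: prim_incr_ge => // s /andP[s1 s2]; apply: Jlow.
    by rewrite s1 (le_trans s2 (le_trans p12 p2E)).
  have i3 : - M * (L - p2) <= prim (J n) L - prim (J n) p2.
    apply: prim_incr_ge => // s /andP[s1 s2]; apply: Jlow.
    by rewrite s2 (le_trans (le_trans p1E p12) s1).
  have i2 : f x1 / 2 * q ^+ n * (p2 - p1) <= prim (J n) p2 - prim (J n) p1.
    apply: prim_incr_ge => // s hs.
    have {}hs : `|s - x0| <= del / 2 by rewrite ler_distl.
    have hs' : `|s - x0| <= del by apply: le_trans hs _; lra.
    apply: ler_pM; [exact: ltW|exact: exprn_ge0|exact: fpos|].
    rewrite lerXn2r ?nnegrE//; last exact: nearer.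
    exact: le_trans ler01 (near s hs').
  move: i1 i2 i3; rewrite prim0 J0 /p1 /p2.
  have -> : x0 + del / 2 - (x0 - del / 2) = del by lra.
  have : 0 <= M * del by rewrite mulr_ge0// ltW.
  by clear; lra.
have bern n : 1 + (q - 1) * n%:R <= q ^+ n.
  have r0 : 0 <= q - 1 by rewrite subr_ge0 ltW.
  elim: n => [|n ih]; first by rewrite mulr0 addr0 expr0.
  apply: (@le_trans _ _ (q * (1 + (q - 1) * n%:R))); last by rewrite exprS ler_wpM2l.
  have : 0 <= (q - 1) * ((q - 1) * n%:R) by rewrite !mulr_ge0.
  by rewrite -natr1; move: (n%:R : R) => m; clear; lra.
pose c := f x1 / 2 * del * (q - 1).
have c0 : 0 < c by rewrite !mulr_gt0// subr_gt0.
pose n := Num.bound (M * L / c).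
have ML0 : 0 <= M * L / c by apply: divr_ge0; [apply: mulr_ge0 => //|]; exact: ltW.
have := archi_boundP ML0; rewrite -/n ltr_pdivrMr// => hn.
have := pos n; rewrite leNgt => /negP; apply.
apply: lt_le_trans hn _; rewrite /c.
have -> : f x1 / 2 * q ^+ n * del = f x1 / 2 * del * q ^+ n by ring.
have -> : n%:R * (f x1 / 2 * del * (q - 1)) = f x1 / 2 * del * ((q - 1) * n%:R) by ring.
apply: ler_wpM2l; first by apply: mulr_ge0; exact: ltW.
by apply: le_trans (bern n); rewrite lerDr.
Qed.

End TrigonometricTests.

(** * The du Bois-Reymond lemma *)

Section DuBoisReymond.
Context {R : realType}.
Local Notation mu := (@lebesgue_measure R).
Implicit Types (f g v k : R -> R) (x y : R).
Variable L : R.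
Hypothesis L0 : 0 < L.
Local Notation I := [set` `[0, L]].

Lemma ae_sub (P Q : R -> Prop) : {ae mu, forall x, P x} -> (forall x, P x -> Q x) ->
  {ae mu, forall x, Q x}.
Proof. by move=> h hPQ; apply: (@filterS _ _ (ae_filter_ringOfSetsType mu) P). Qed.

Lemma ae_and (P Q : R -> Prop) : {ae mu, forall x, P x} -> {ae mu, forall x, Q x} ->
  {ae mu, forall x, P x /\ Q x}.
Proof. exact: (@filterI _ _ (ae_filter_ringOfSetsType mu)). Qed.

Lemma cut_locint f : mu.-integrable I (EFin \o f) -> locint (f \_ I).
Proof.
move=> hf a b; have : mu.-integrable setT (EFin \o (f \_ I)).
  by rewrite -restrict_EFin; apply/integrable_restrict => //; rewrite setTI.
exact: integrableS.
Qed.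

Lemma cut_in f x : 0 <= x <= L -> (f \_ I) x = f x.
Proof. by move=> hx; rewrite patchE mem_set//= in_itv. Qed.

Lemma prim_eq_in f g x : 0 <= x -> (forall t, 0 <= t <= x -> f t = g t) -> prim f x = prim g x.
Proof.
move=> x0 h; rewrite !prim_pos//; apply: eq_Rintegral => t; rewrite inE /= in_itv/=.
exact: h.
Qed.

Lemma prim_cut f : prim (f \_ I) L = \int[mu]_(x in I) f x.
Proof.
rewrite prim_pos ?ltW//; apply: eq_Rintegral => t; rewrite inE /= in_itv/=.
exact: cut_in.
Qed.

Lemma prim_ae f g x : locint f -> locint g -> 0 <= x <= L -> f = g %[ae mu in I] ->
  prim f x = prim g x.
Proof.
move=> lf lg /andP[x0 xL] h; rewrite !prim_pos// /Rintegral; congr fine.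
apply: ae_eq_integral => //.
- by case/integrableP: (lf 0 x).
- by case/integrableP: (lg 0 x).
- apply: (ae_sub h) => t {}h /=; rewrite in_itv/= => /andP[t0 tx].
  by congr EFin; apply: h; rewrite /= in_itv/= t0 (le_trans tx xL).
Qed.

(** Lebesgue differentiation of the vanishing primitive. *)
Lemma prim_zero_ae k : locint k -> (forall x, 0 <= x <= L -> prim k x = 0) ->
  k = (fun=> 0) %[ae mu in I].
Proof.
move=> lk h; pose c : R -> R := k \_ I.
have ic : mu.-integrable setT (EFin \o c).
  by rewrite -restrict_EFin; apply/integrable_restrict => //; rewrite setTI.
have loc : locally_integrable [set: R] c by apply: integrable_locally => //; exact: openT.
have ii y : mu.-integrable [set` Interval (BLeft 0) (BRight y)] (EFin \o c).
  by apply: integrableS ic.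
have F0 x : 0 <= x -> \int[mu]_(t in `[0, x]) c t = 0.
  move=> x0; have lc : locint c by apply: cut_locint; exact: lk.
  have [xL|Lx] := leP x L.
    rewrite -prim_pos// (@prim_eq_in c k)// ?h ?x0// => t /andP[t0 tx].
    by rewrite /c cut_in// t0 (le_trans tx).
  rewrite (Rint_chasles lc (ltW L0) (ltW Lx)) -prim_pos ?ltW//.
  have -> : prim c L = 0.
    rewrite (@prim_eq_in c k)// ?h ?lexx ?ltW// => t ht; exact: cut_in.
  rewrite add0r -(Rintegral_itv_obnd_cbnd); last first.
    by apply: integrableS ic.
  rewrite (@eq_Rintegral _ _ _ _ _ (fun=> 0)) ?Rintegral_cst ?mul0r// => t.
  rewrite inE /= in_itv/= => /andP[Lt _]; rewrite /c patchE memNset//=.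
  by rewrite in_itv/= => /andP[_]; rewrite leNgt Lt.
have h1 := FTC1 ii loc.
have hne (q : R) : {ae mu, forall x : R, x != q}.
  exists [set q]; split => //; first by rewrite lebesgue_measure_set1.
  by move=> x /= /negP; rewrite negbK => /eqP.
have h2 := ae_and (hne 0) (hne L).
apply: (ae_sub (ae_and h1 h2)) => x [{}h1 [n0 nL]] /=; rewrite in_itv/= => /andP[x0 xL].
have x0' : 0 < x by rewrite lt0r n0.
have xL' : x < L by rewrite lt_neqAle nL.
have [|_] := h1; first by rewrite lte_fin.
have d : is_derive x 1 (fun y => \int[mu]_(t in `[0, y]) c t) 0.
  apply: (@near_eq_is_derive _ _ _ (fun=> 0)) (derC 0 x).
  near=> y; rewrite F0//; near: y; exact: lt_le_nbhsr.
by rewrite (der_val d) /c cut_in// x0.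
Unshelve. all: by end_near. Qed.

(** Real weak derivatives; a complex weak derivative amounts to two of them. *)
Definition rweak f v := forall theta, smooth_per L theta ->
  \int[mu]_(x in I) (f x * (theta^`())%classic x) = - \int[mu]_(x in I) (v x * theta x).

Lemma prim_cutM f g : prim (fun x => (f \_ I) x * g x) L = \int[mu]_(x in I) (f x * g x).
Proof.
by rewrite -prim_cut; apply: prim_eq_in => [|t ht]; [exact: ltW|rewrite !cut_in].
Qed.

(** Integration by parts; the boundary terms cancel because [v] has mean zero and
    the test function is periodic. *)
Lemma rweak_prim f v c : mu.-integrable I (EFin \o v) -> prim (v \_ I) L = 0 ->
  (forall x, 0 <= x <= L -> f x = c + prim (v \_ I) x) -> rweak f v.
Proof.
move=> iv v0 fE theta st; have [dt ct] := smooth_per_der st.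
have lv := cut_locint iv; have cp := prim_continuous lv.
rewrite -[in RHS]prim_cutM (prim_by_parts (ltW L0) lv dt ct) v0 mul0r sub0r opprK.
rewrite -prim_cut (@prim_eq_in _ (fun x => c * (theta^`())%classic x +
    prim (v \_ I) x * (theta^`())%classic x)); last first.
- by move=> t ht; rewrite cut_in// fE// mulrDl.
- exact: ltW.
rewrite primD; [|by apply: cont_locint; apply: contM => //; exact: contC
  |by apply: cont_locint; exact: contM].
rewrite primZ; last exact: cont_locint.
by rewrite (prim_unique ct dt) -[L in theta L]add0r (st.1 0) subrr mulr0 add0r.
Qed.

(** A function whose weak derivative is integrable is a primitive: the difference
    has vanishing weak derivative, so its own primitive, normalized, is orthogonal to
    all trigonometric polynomials. *)
Lemma du_bois_reymond f v : mu.-integrable I (EFin \o f) -> mu.-integrable I (EFin \o v) ->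
  rweak f v -> prim (v \_ I) L = 0 /\
  exists c, f = (fun x => c + prim (v \_ I) x) %[ae mu in I].
Proof.
move=> jf jv hfv.
have lf := cut_locint jf; have lv := cut_locint jv.
have v0 : prim (v \_ I) L = 0.
  have [s1 d1] := smooth_per_cst L 1; have := hfv _ s1; rewrite d1 -!prim_cutM.
  rewrite (@prim_eq_in _ (fun=> 0)) ?ltW//; last by move=> t _; rewrite mulr0.
  rewrite prim_cst0 (@prim_eq_in (fun x => (v \_ I) x * 1) (v \_ I)) ?ltW//; last first.
    by move=> t _; rewrite mulr1.
  by move/esym/eqP; rewrite oppr_eq0 => /eqP.
split=> //.
have cV := prim_continuous lv; have lV := cont_locint cV.
pose h x := (f \_ I) x - prim (v \_ I) x.
have lh : locint h.
  have -> : h = (fun x => (f \_ I) x + -1 * prim (v \_ I) x).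
    by apply/funext => x; rewrite /h mulN1r.
  by apply: locintD => //; exact: locintZ.
pose c := prim h L / L; pose k x := h x - c.
have lk : locint k.
  by apply: locintD => //; apply: cont_locint; exact: contC.
have c1 : continuous (fun _ : R => - c) by exact: contC.
have primk x : prim k x = prim h x - c * x.
  rewrite primD//; last exact: cont_locint.
  congr (_ + _); apply: (@prim_eq _ _ (fun x => - (c * x))) => //; last by rewrite mulr0 oppr0.
  by move=> y; apply: (der_eq (derN (derScale c (derid y)))); rewrite mulr1.
have kL : prim k L = 0 by rewrite primk /c divfK ?subrr// gt_eqF.
have cK := prim_continuous lk.
have ortho theta : smooth_per L theta -> prim (fun x => k x * (theta^`())%classic x) L = 0.
  move=> st; have [dt ct] := smooth_per_der st.
  have t0 : prim ((theta^`())%classic) L = 0.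
    by rewrite (prim_unique ct dt) -[L in theta L]add0r (st.1 0) subrr.
  have e1 : prim (fun x => (f \_ I) x * (theta^`())%classic x) L =
      prim (fun x => prim (v \_ I) x * (theta^`())%classic x) L.
    rewrite prim_cutM (hfv _ st) -prim_cutM (prim_by_parts (ltW L0) lv dt ct) v0.
    by rewrite mul0r sub0r opprK.
  have -> : (fun x => k x * (theta^`())%classic x) = (fun x => (f \_ I) x * (theta^`())%classic x +
      (-1 * (prim (v \_ I) x * (theta^`())%classic x) + (- c) * (theta^`())%classic x)).
    by apply/funext => x; rewrite /k /h; ring.
  have l1 : locint (fun x => prim (v \_ I) x * (theta^`())%classic x).
    by apply: cont_locint; exact: contM.
  have l2 : locint ((theta^`())%classic) by exact: cont_locint.
  rewrite primD; [|exact: locintM|by apply: locintD; exact: locintZ].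
  rewrite primD; [|exact: locintZ|exact: locintZ].
  by rewrite !primZ// e1 t0; ring.
pose m := prim (prim k) L / L; pose J x := prim k x - m.
have cJ : continuous J by apply: contB => //; exact: contC.
have lK := cont_locint cK.
have ortho1 theta : smooth_per L theta -> prim (fun x => k x * theta x) L = 0.
  move=> st; have [dt _] := smooth_per_der st; have ct := der_contT dt.
  have [sT dT] := smooth_per_prim L0 st; have := ortho _ sT; rewrite dT.
  set a := _ / _; have -> : (fun x => k x * (theta x - a)) = (fun x => k x * theta x + (- a) * k x).
    by apply/funext => x; ring.
  rewrite primD ?primZ ?kL ?mulr0 ?addr0//; [exact: locintM|exact: locintZ].
have ortho2 x0 P Q : prim (fun x => J x * trig L x0 P Q x) L = 0.
  pose T := trig L x0 P Q.
  have sT : smooth_per L T by exact: smooth_per_trig.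
  have cT : continuous T by exact: trig_cont.
  have [s1 d1] := smooth_per_prim L0 sT; have [dt ct] := smooth_per_der s1.
  have := ortho1 _ s1; rewrite (prim_by_parts (ltW L0) lk dt ct) kL mul0r sub0r d1.
  set a := _ / _ => /eqP; rewrite oppr_eq0 => /eqP.
  have cKT : continuous (fun x => prim k x * T x) by exact: contM.
  have -> : (fun x => prim k x * (T x - a)) = (fun x => prim k x * T x + (- a) * prim k x).
    by apply/funext => x; ring.
  rewrite primD ?primZ//; [|exact: cont_locint|exact: locintZ] => e3.
  have -> : (fun x => J x * trig L x0 P Q x) = (fun x => prim k x * T x + (- m) * T x).
    by apply/funext => x; rewrite /J -/T; ring.
  have lT := cont_locint cT.
  rewrite primD ?primZ//; [|exact: cont_locint|exact: locintZ].
  have e4 : prim (prim k) L = m * L by rewrite /m divfK// gt_eqF.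
  have e5 : prim T L = a * L by rewrite /a divfK// gt_eqF.
  by move: e3; rewrite e4 e5 => e3; rewrite -[RHS]e3; ring.
have J0 x : 0 <= x <= L -> J x = 0.
  move=> hx; apply/eqP; rewrite eq_le (trig_orthogonal_npos L0 cJ ortho2 hx)/=.
  rewrite -oppr_le0; apply: (trig_orthogonal_npos L0 (f := fun x => - J x) _ _ hx).
    exact: contN.
  move=> x0 P Q; have -> : (fun x => - J x * trig L x0 P Q x) = (fun x => -1 * (J x * trig L x0 P Q x)).
    by apply/funext => y; ring.
  rewrite primZ ?ortho2 ?mulr0//; apply: cont_locint; apply: contM => //; exact: trig_cont.
have m0 : m = 0.
  have := J0 0; rewrite lexx ltW// => /(_ isT); rewrite /J prim0 sub0r => /eqP.
  by rewrite oppr_eq0 => /eqP.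
have K0 x : 0 <= x <= L -> prim k x = 0.
  by move=> /J0; rewrite /J m0 subr0.
exists c; apply: (ae_sub (prim_zero_ae lk K0)) => x hx /= xI.
have := hx xI; rewrite /k /h patchE mem_set//; lra.
Qed.

End DuBoisReymond.

(** * Square integrable functions and their real parts *)

Section SquareIntegrable.
Context {R : realType}.
Local Notation mu := (@lebesgue_measure R).
Implicit Types (f g c : R -> R) (x : R).
Variable L : R.
Hypothesis L0 : 0 < L.
Local Notation I := [set` `[0, L]].

Lemma integrable_ext f g : (forall x, 0 <= x <= L -> f x = g x) ->
  mu.-integrable I (EFin \o f) -> mu.-integrable I (EFin \o g).
Proof.
move=> h; apply: eq_integrable => // x; rewrite inE/= in_itv/= => hx.
by rewrite /= h.
Qed.

Lemma integrableMcont f c : mu.-integrable I (EFin \o f) -> continuous c ->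
  mu.-integrable I (EFin \o (fun x => f x * c x)).
Proof.
move=> /cut_locint lf cc; apply: integrable_ext (locintM lf cc 0 L) => x hx.
by rewrite cut_in.
Qed.

Lemma integrable_add f g : mu.-integrable I (EFin \o f) -> mu.-integrable I (EFin \o g) ->
  mu.-integrable I (EFin \o (fun x => f x + g x)).
Proof.
move=> /cut_locint lf /cut_locint lg; apply: integrable_ext (locintD lf lg 0 L) => x hx.
by rewrite !cut_in.
Qed.

Definition sqint f := measurable_fun setT f /\ mu.-integrable I (EFin \o (fun x => f x ^+ 2)).

Lemma sqint_int f : sqint f -> mu.-integrable I (EFin \o f).
Proof.
move=> [mf jf]; have j1 : mu.-integrable I (EFin \o (fun x => 1 + f x ^+ 2)).
  exact: integrable_add (cont_locint (@contC _ 1) 0 L) jf.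
apply: le_integrable j1 => //.
  by apply/measurable_EFinP; exact: measurable_funTS.
move=> x _ /=; rewrite lee_fin [leRHS]ger0_norm ?addr_ge0 ?sqr_ge0//.
have h1 := sqr_ge0 (f x - 1); have h2 := sqr_ge0 (f x + 1); have h3 := sqr_ge0 (f x).
by rewrite ler_norml; apply/andP; split; nra.
Qed.

Lemma sqintD f g : sqint f -> sqint g -> sqint (fun x => f x + g x).
Proof.
move=> [mf jf] [mg jg]; have mfg : measurable_fun setT (fun x => f x + g x).
  exact: measurable_funD.
split=> //.
have j2 : mu.-integrable I (EFin \o (fun x => 2 * (f x ^+ 2 + g x ^+ 2))).
  have h := integrableMcont (integrable_add jf jg) (@contC _ 2).
  by apply: integrable_ext h => x _; rewrite mulrC.
apply: le_integrable j2 => //.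
  by apply/measurable_EFinP/measurable_funTS; exact: measurable_funX.
move=> x _ /=; rewrite lee_fin !ger0_norm ?sqr_ge0 ?mulr_ge0 ?addr_ge0 ?sqr_ge0//.
by have := sqr_ge0 (f x - g x); nra.
Qed.

Lemma sqintM f c : sqint f -> continuous c -> sqint (fun x => f x * c x).
Proof.
move=> [mf jf] cc; split.
  by apply: measurable_funM => //; exact: measurable_realfun.continuous_measurable_fun.
have cc2 : continuous (fun x => c x ^+ 2) by exact: contX.
by apply: integrable_ext (integrableMcont jf cc2) => x _; rewrite exprMn.
Qed.

Lemma sqintZ f (a : R) : sqint f -> sqint (fun x => a * f x).
Proof.
move=> /(sqintM (c := fun=> a)) h; have -> : (fun x => a * f x) = (fun x => f x * a).
  by apply/funext => x; rewrite mulrC.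
by apply: h; exact: contC.
Qed.

Lemma sqint_sum (J : finType) (f : J -> R -> R) : (forall j, sqint (f j)) ->
  sqint (fun x => \sum_j f j x).
Proof.
move=> h; elim: (index_enum J) => [|j s ih].
  under eq_fun do rewrite big_nil; split; first exact: measurable_cst.
  by have := cont_locint (@contC R (0 ^+ 2)) 0 L.
by under eq_fun do rewrite big_cons; exact: sqintD.
Qed.

Lemma sqint_cont f c : measurable_fun setT f -> continuous c ->
  (forall x, 0 <= x <= L -> c x = f x) -> sqint f.
Proof.
move=> mf cc h; split=> //; have cc2 : continuous (fun x => c x ^+ 2) by exact: contX.
by apply: integrable_ext (cont_locint cc2 0 L) => x /h ->.
Qed.

(** The Cauchy-Schwarz inequality against 1, from (f - a)^2 >= 0 where [a] is the
    mean value. *)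
Lemma prim_sqint_le f x : sqint f -> 0 <= x <= L ->
  prim (f \_ I) x ^+ 2 <= L * \int[mu]_(t in I) (f t ^+ 2).
Proof.
move=> sf /andP[x0 xL]; have jf := sqint_int sf; have [mf jf2] := sf.
have lf := cut_locint jf.
pose F : R -> R := (fun s => f s ^+ 2) \_ I.
have lF : locint F by exact: cut_locint.
pose P := prim (f \_ I) x; pose S := \int[mu]_(t in I) (f t ^+ 2).
pose a := P / L.
have L0' : L != 0 by rewrite gt_eqF.
have lsq : locint (fun t => (f \_ I) t * (2 * a) + - (a ^+ 2)).
  apply: locintD; last exact: (cont_locint (@contC _ _)).
  by apply: locintM => //; exact: contC.
have h1 : prim (fun t => (f \_ I) t * (2 * a) + - (a ^+ 2)) x <= prim F x.
  rewrite !prim_pos//; apply: le_Rintegral => //.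
  move=> t /=; rewrite in_itv/= => /andP[t0 tx].
  have tI : 0 <= t <= L by rewrite t0 (le_trans tx).
  by rewrite /F !cut_in//; have := sqr_ge0 (f t - a); nra.
have h2 : prim F x <= S.
  rewrite /S -prim_cut// -/F -subr_ge0 (prim_diff lF x0 xL).
  apply: Rintegral_ge0 => t _; rewrite /F patchE; case: ifP => // _; exact: sqr_ge0.
have h3 : prim (fun t => (f \_ I) t * (2 * a) + - (a ^+ 2)) x = P * (2 * a) - a ^+ 2 * x.
  have l1 : locint (fun t => 2 * a * (f \_ I) t) by exact: locintZ.
  have -> : (fun t => (f \_ I) t * (2 * a) + - (a ^+ 2)) = (fun t => 2 * a * (f \_ I) t + - (a ^+ 2)).
    by apply/funext => t; rewrite mulrC.
  rewrite primD// ?primZ//; last exact: (cont_locint (@contC _ _)).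
  rewrite [P * _]mulrC; congr (_ + _).
  apply: (@prim_eq _ _ (fun x => - (a ^+ 2 * x))); [exact: contC| |by rewrite mulr0 oppr0].
  by move=> t; apply: (der_eq (derN (derScale (a ^+ 2) (derid t)))); rewrite mulr1.
have aL : a * L = P by rewrite /a divfK.
have h4 : a ^+ 2 * x <= a ^+ 2 * L by rewrite ler_wpM2l// sqr_ge0.
have h5 : P * (2 * a) - a ^+ 2 * L <= S by move: h1 h2; rewrite h3; lra.
rewrite -/P -/S -aL; have -> : (a * L) ^+ 2 = L * (a ^+ 2 * L) by ring.
apply: ler_wpM2l; first exact: ltW.
move: h5; rewrite -aL.
by have -> : a * L * (2 * a) - a ^+ 2 * L = a ^+ 2 * L by ring.
Qed.

End SquareIntegrable.

Section ComplexParts.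
Context {R : realType}.
Local Notation mu := (@lebesgue_measure R).
Local Open Scope complex_scope.
Local Notation normc := ComplexField.Normc.normc.
Implicit Types (f v : R -> R[i]^o) (x : R) (r : bool).
Variable L : R.
Hypothesis L0 : 0 < L.
Local Notation I := [set` `[0, L]].

Definition cpart r (z : R[i]) : R := if r then complex.Im z else complex.Re z.
Definition part r f x : R := cpart r (f x).

Lemma cpartD r (z1 z2 : R[i]) : cpart r (z1 + z2) = cpart r z1 + cpart r z2.
Proof. by case: r; case: z1 z2 => ? ? []. Qed.

Lemma cpart_real r (a : R) (z : R[i]) : cpart r (a%:C * z) = a * cpart r z.
Proof. by case: r; case: z => s t /=; rewrite mul0r ?subr0 ?addr0. Qed.

Lemma cpartM r (z1 z2 : R[i]) : cpart r (z1 * z2) =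
  if r then complex.Re z1 * cpart true z2 + complex.Im z1 * cpart false z2
  else complex.Re z1 * cpart false z2 - complex.Im z1 * cpart true z2.
Proof. by case: r; case: z1 z2 => ? ? [] ? ?. Qed.

Lemma cpart_ext (z1 z2 : R[i]) : (forall r, cpart r z1 = cpart r z2) -> z1 = z2.
Proof. by case: z1 z2 => s t [s' t'] h; have /= -> := h false; have /= -> := h true. Qed.

Lemma normc_sqr (z : R[i]) : normc z ^+ 2 = complex.Re z ^+ 2 + complex.Im z ^+ 2.
Proof. by case: z => s t; rewrite /= sqr_sqrtr// addr_ge0// sqr_ge0. Qed.

Lemma L2per_sqint f : L2per L f -> forall r, sqint L (part r f).
Proof.
move=> [_ mr mi fin] r.
have mp r' : measurable_fun setT (part r' f) by case: r'.
have j : mu.-integrable I (EFin \o (fun x => part false f x ^+ 2 + part true f x ^+ 2)).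
  apply/integrableP; split.
    apply/measurable_EFinP/measurable_funTS; apply: measurable_funD; exact: measurable_funX.
  move: fin; congr (_ < _)%E; apply: eq_integral => x _ /=.
  by rewrite normc_sqr ger0_norm// addr_ge0// sqr_ge0.
split=> //; apply: le_integrable j => //.
  by apply/measurable_EFinP/measurable_funTS; apply: measurable_funX; exact: mp.
move=> x _ /=; rewrite lee_fin !ger0_norm ?addr_ge0 ?sqr_ge0//.
by case: (r); rewrite ?lerDl ?lerDr sqr_ge0.
Qed.

Lemma sqint_L2per f : Defs.periodic L f -> (forall r, sqint L (part r f)) -> L2per L f.
Proof.
move=> pf sf; have [[mr jr] [mi ji]] := (sf false, sf true); split=> //.
have /integrableP[_] := integrable_add jr ji.
congr (_ < _)%E; apply: eq_integral => x _ /=.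
by rewrite normc_sqr ger0_norm// addr_ge0// sqr_ge0.
Qed.

Lemma cintegralE f (theta : R -> R) : cintegral L (fun x => f x * (theta x)%:C) =
  (\int[mu]_(x in I) (part false f x * theta x)) +i*
  (\int[mu]_(x in I) (part true f x * theta x)).
Proof.
by congr (_ +i* _); apply: eq_Rintegral => x _; rewrite /part;
  case: (f x) => s t /=; rewrite ?mulr0 ?subr0 ?add0r.
Qed.

Lemma weak_deriv_parts f v : weak_deriv L f v <->
  [/\ L2per L f, L2per L v & forall r, rweak L (part r f) (part r v)].
Proof.
split=> -[hf hv h]; split=> //.
  by move=> r theta st; have := h theta st; rewrite !cintegralE => -[h1 h2]; case: r.
move=> theta st; rewrite !cintegralE; have h1 := h false theta st; have h2 := h true theta st.
by rewrite h1 h2.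
Qed.

End ComplexParts.

(** * Weak solutions are classical *)

Section WaveOperator.
Context {R : realType}.
Local Notation mu := (@lebesgue_measure R).
Local Notation X := ((R -> R[i]^o) * (R -> R[i]^o))%type.
Local Open Scope complex_scope.
Implicit Types (x : R) (u g : X) (z : R[i]) (i j : bool * bool).
Variables (L b w B lam x2 : R) (phi W p p' y y' : R -> R).
Hypothesis hd : hill_data L b lam x2 W p p' y y'.
Hypothesis w_lt1 : w ^+ 2 < 1.
Hypothesis B_eq : B ^+ 2 = 2 - w * B.
Hypothesis phiW : forall x, (W x - 1) * (1 - w * B) = B ^+ 2 * phi x.
Let L0 : 0 < L := hill_L hd.
Local Notation I := [set` `[0, L]].
Local Notation T := (calL L (- b) b (- b) w phi (fun x => B * phi x)).
Local Notation Coef z := (coef b w B phi (complex.Re z) (complex.Im z)).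

(** The four real functions making up a pair of complex ones, indexed as in [coef]. *)
Definition comp u i : R -> R := part i.2 (if i.1 then u.2 else u.1).
Definition assemble (U : bool * bool -> R -> R) : X :=
  (fun x => U (false, false) x +i* U (false, true) x, fun x => U (true, false) x +i* U (true, true) x).

Lemma comp_assemble U i : comp (assemble U) i = U i.
Proof. by case: i => -[] []. Qed.

Lemma comp_shift z u g (c r : bool) x :
  comp (z *: u + g) (c, r) x =
  zmul (complex.Re z) (complex.Im z) (fun i => comp u i x) c r + comp g (c, r) x.
Proof.
by rewrite /comp /part /zmul; case: c; rewrite /= cpartD; congr (_ + _); rewrite cpartM.
Qed.

Lemma L2per2_sqint g : L2per2 L g -> forall i, sqint L (comp g i).
Proof. by move=> [h1 h2] [[] r]; apply: L2per_sqint. Qed.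

Let Coef_cont z i j : continuous (Coef z i j).
Proof. exact: (coef_cont hd). Qed.

Lemma source_sqint (G : bool * bool -> R -> R) : (forall i, sqint L (G i)) ->
  forall i, sqint L (source b w G i).
Proof.
move=> h i; pose c1 := - (if i.1 then w else 1) / (b * (1 - w ^+ 2)).
pose c2 := - (if i.1 then 1 else w) / (b * (1 - w ^+ 2)).
have -> : source b w G i = (fun x => c1 * G (false, i.2) x + c2 * G (true, i.2) x).
  by apply/funext => x; rewrite /source /c1 /c2; ring.
by apply: sqintD => //; exact: sqintZ.
Qed.

(** The equations hold almost everywhere, and there they can be solved for the second
    derivatives: the complex weak problem becomes a real weak system. *)
Lemma calL_parts z u g : L2per2 L g -> T u (z *: u + g) ->
  (forall i, sqint L (comp u i)) /\ exists V D : bool * bool -> R -> R, forall i,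
  [/\ mu.-integrable I (EFin \o V i), mu.-integrable I (EFin \o D i),
      rweak L (comp u i) (V i), rweak L (V i) (D i) &
      D i = (fun x => source b w (comp g) i x + \sum_j Coef z i j x * comp u j x) %[ae mu in I]].
Proof.
move=> hg [_ _ _ [w1 [w2 [[v1 hv1 hw1] [v2 hv2 hw2] e1 e2]]]].
have /weak_deriv_parts[u1L v1L d1] := hv1; have /weak_deriv_parts[u2L v2L d2] := hv2.
have /weak_deriv_parts[_ w1L d3] := hw1; have /weak_deriv_parts[_ w2L d4] := hw2.
split; first by apply: L2per2_sqint.
exists (comp (v1, v2)), (comp (w1, w2)) => i; split.
- by apply: sqint_int; apply: L2per2_sqint.
- by apply: sqint_int; apply: L2per2_sqint.
- by case: i => -[] r; [exact: d2|exact: d1].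
- by case: i => -[] r; [exact: d4|exact: d3].
apply: (ae_sub (ae_and e1 e2)) => x [{}e1 {}e2] xI; have {}e1 := e1 xI; have {}e2 := e2 xI.
have [_ h] := coef_calT B phi hd w_lt1 (complex.Re z) (complex.Im z) (fun i => comp u i x)
  (fun i => comp (w1, w2) i x) (comp g) x.
apply: h => r.
have s1 : comp (z *: u + g) (false, r) x = cpart r ((z *: u + g).1 x) by [].
have s2 : comp (z *: u + g) (true, r) x = cpart r ((z *: u + g).2 x) by [].
rewrite -!comp_shift s1 s2 e1 e2 !cpartD !cpart_real /comp /part /=.
by split; ring.
Qed.

Lemma calL_intro z g (U V D : bool * bool -> R -> R) : L2per2 L g ->
  (forall i, [/\ Defs.periodic L (U i), Defs.periodic L (V i) & Defs.periodic L (D i)]) ->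
  (forall i, [/\ sqint L (U i), sqint L (V i) & sqint L (D i)]) ->
  (forall i, rweak L (U i) (V i) /\ rweak L (V i) (D i)) ->
  (forall i x, D i x = source b w (comp g) i x + \sum_j Coef z i j x * U j x) ->
  T (assemble U) (z *: assemble U + g).
Proof.
move=> hg per sq rw hD.
have L2 (F : bool * bool -> R -> R) : (forall i, Defs.periodic L (F i)) ->
    (forall i, sqint L (F i)) -> L2per2 L (assemble F).
  move=> pF sF; split; apply: sqint_L2per.
  - by move=> x; rewrite /= !pF.
  - by move=> r; have := sF (false, r); rewrite -(comp_assemble F).
  - by move=> x; rewrite /= !pF.
  - by move=> r; have := sF (true, r); rewrite -(comp_assemble F).
have LU : L2per2 L (assemble U) by apply: L2 => i; have [] := per i; have [] := sq i.
have LV : L2per2 L (assemble V) by apply: L2 => i; have [] := per i; have [] := sq i.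
have LD : L2per2 L (assemble D) by apply: L2 => i; have [] := per i; have [] := sq i.
have wUV c : weak_deriv L (if c then (assemble U).2 else (assemble U).1)
    (if c then (assemble V).2 else (assemble V).1).
  apply/weak_deriv_parts; split; [by case: c LU => -[]|by case: c LV => -[]|].
  by move=> r; have := (rw (c, r)).1; rewrite -(comp_assemble U) -(comp_assemble V).
have wVD c : weak_deriv L (if c then (assemble V).2 else (assemble V).1)
    (if c then (assemble D).2 else (assemble D).1).
  apply/weak_deriv_parts; split; [by case: c LV => -[]|by case: c LD => -[]|].
  by move=> r; have := (rw (c, r)).2; rewrite -(comp_assemble V) -(comp_assemble D).
have w2 c : weak_deriv2 L (if c then (assemble U).2 else (assemble U).1)
    (if c then (assemble D).2 else (assemble D).1).
  by exists (if c then (assemble V).2 else (assemble V).1); [exact: wUV|exact: wVD].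
have Lzg : L2per2 L (z *: assemble U + g).
  have sz (c r : bool) : sqint L (comp (z *: assemble U + g) (c, r)).
    have -> : comp (z *: assemble U + g) (c, r) = (fun x =>
        (complex.Re z * comp (assemble U) (c, r) x +
        (if r then complex.Im z else - complex.Im z) * comp (assemble U) (c, ~~ r) x) + comp g (c, r) x).
      by apply/funext => x; rewrite comp_shift /zmul; case: (r); rewrite ?mulNr.
    have hU := L2per2_sqint LU; have hG := L2per2_sqint hg.
    by apply: sqintD => //; apply: sqintD; exact: sqintZ.
  have [[pU1 _ _ _] [pU2 _ _ _]] := LU; have [[pg1 _ _ _] [pg2 _ _ _]] := hg.
  split; apply: sqint_L2per.
  - have -> : (z *: assemble U + g).1 = (fun x => z * (assemble U).1 x + g.1 x) by [].
    by move=> x; rewrite pg1 pU1.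
  - by move=> r; exact: (sz false r).
  - have -> : (z *: assemble U + g).2 = (fun x => z * (assemble U).2 x + g.2 x) by [].
    by move=> x; rewrite pg2 pU2.
  - by move=> r; exact: (sz true r).
have eqs x : forall r, _ := (coef_calT B phi hd w_lt1 (complex.Re z) (complex.Im z) (fun i => U i x) (fun i => D i x) (comp g) x).1 (fun i => hD i x).
have cs (c : bool) r x : cpart r ((if c then (z *: assemble U + g).2 else (z *: assemble U + g).1) x) =
   zmul (complex.Re z) (complex.Im z) (fun i => U i x) c r + comp g (c, r) x.
  have := comp_shift z (assemble U) g c r x; rewrite /comp /part /= => ->.
  by congr (_ + _); rewrite /zmul; case: (r); rewrite -!(comp_assemble U).
split=> //; [by exists (assemble D).1; exact: (w2 false)|by exists (assemble D).2; exact: (w2 true)|].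
exists (assemble D).1, (assemble D).2; split; [exact: (w2 false)|exact: (w2 true)| |].
- apply: (aeW mu) => x _; apply: cpart_ext => r; rewrite (cs false).
  have [<- _] := eqs x r; rewrite !cpartD !cpart_real.
  by rewrite -!(comp_assemble U) -!(comp_assemble D) /comp /part /=; ring.
- apply: (aeW mu) => x _; apply: cpart_ext => r; rewrite (cs true).
  have [_ <-] := eqs x r; rewrite !cpartD !cpart_real.
  by rewrite -!(comp_assemble U) -!(comp_assemble D) /comp /part /=; ring.
Qed.

Let Coef_per z i j : Defs.periodic L (Coef z i j).
Proof. exact: (coef_per hd). Qed.

(** Regularity: a weak solution agrees almost everywhere with a solution of the
    integral equations, with matching values at the two ends of the period. *)
Lemma calL_classical z u g : L2per2 L g -> T u (z *: u + g) ->
  exists (uu vv : bool * bool -> R -> R) (al be : bool * bool -> R), [/\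
    forall i, continuous (uu i) /\ continuous (vv i),
    forall i x, 0 <= x <= L -> uu i x = al i + prim (vv i) x,
    forall i x, 0 <= x <= L -> vv i x = be i + prim (source b w (comp g) i \_ I) x +
      prim (fun t => \sum_j Coef z i j t * uu j t) x,
    forall i, uu i L = al i /\ vv i L = be i &
    forall i, comp u i = uu i %[ae mu in I]].
Proof.
move=> hg hT; have [su [V [D h]]] := calL_parts hg hT.
have lL : 0 <= L <= L by rewrite lexx ltW.
have lV i : locint (V i \_ I) by apply: cut_locint; have [] := h i.
have lD i : locint (D i \_ I) by apply: cut_locint; have [] := h i.
have hs i : sqint L (source b w (comp g) i).
  by apply: source_sqint => j; exact: L2per2_sqint.
have ls i : locint (source b w (comp g) i \_ I) by apply: cut_locint; exact: sqint_int.
have /choice[al hal] i : exists a, prim (V i \_ I) L = 0 /\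
    comp u i = (fun x => a + prim (V i \_ I) x) %[ae mu in I].
  have [jV jD r1 r2 _] := h i; have [v0 [c hc]] := du_bois_reymond L0 (sqint_int (su i)) jV r1.
  by exists c.
have /choice[be hbe] i : exists a, prim (D i \_ I) L = 0 /\
    V i = (fun x => a + prim (D i \_ I) x) %[ae mu in I].
  have [jV jD r1 r2 _] := h i; have [v0 [c hc]] := du_bois_reymond L0 jV jD r2.
  by exists c.
pose uu i x := al i + prim (V i \_ I) x.
have cuu i : continuous (uu i).
  by apply: contD; [exact: contC|exact: prim_continuous].
have cS i : continuous (fun t => \sum_j Coef z i j t * uu j t).
  by apply: cont_sum => j; exact: contM.
pose vv i x := be i + prim (source b w (comp g) i \_ I) x +
  prim (fun t => \sum_j Coef z i j t * uu j t) x.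
have cvv i : continuous (vv i).
  apply: contD; last by apply: prim_continuous; exact: cont_locint.
  by apply: contD; [exact: contC|exact: prim_continuous].
have DE i x : 0 <= x <= L -> prim (D i \_ I) x =
    prim (source b w (comp g) i \_ I) x + prim (fun t => \sum_j Coef z i j t * uu j t) x.
  move=> hx; rewrite -primD//; last exact: cont_locint.
  apply: prim_ae hx _ => //; first by apply: locintD => //; exact: cont_locint.
  have hae : {ae mu, forall t, forall j, I t -> comp u j t = uu j t}.
    have hj j := (hal j).2.
    have h2 := ae_and (ae_and (hj (false, false)) (hj (false, true)))
      (ae_and (hj (true, false)) (hj (true, true))).
    by apply: (ae_sub h2) => t [[? ?] [? ?]] [[] []].
  have [_ _ _ _ hd'] := h i.
  apply: (ae_sub (ae_and hd' hae)) => t [{}hd' {}hae] tI.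
  rewrite !patchE mem_set// hd'//; congr (_ + _); apply: eq_bigr => j _.
  by rewrite hae.
have VE i : V i = vv i %[ae mu in I].
  apply: (ae_sub (hbe i).2) => t ht tI.
  have tL : 0 <= t <= L by move: tI; rewrite /= in_itv.
  by rewrite ht// /vv -addrA DE.
exists uu, vv, al, be; split=> //.
- move=> i x hx; rewrite /uu; congr (_ + _); apply: prim_ae hx _ => //.
    exact: cont_locint.
  by apply: (ae_sub (VE i)) => t ht tI; rewrite patchE mem_set// ht.
- move=> i; split; first by rewrite /uu (hal i).1 addr0.
  by rewrite /vv -addrA -DE// (hbe i).1 addr0.
- by move=> i; exact: (hal i).2.
Qed.

Let Coef_bound z : exists C, forall i j x, `|Coef z i j x| <= C.
Proof. exact: (coef_bounded hd w_lt1 B_eq phiW). Qed.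

(** The solution of the global initial value problem with the same data agrees with
    the given one on [0, L], and is periodic because its values match at L. *)
Lemma homogeneous_classical z (uu vv : bool * bool -> R -> R) (al be : bool * bool -> R) :
  (forall i, continuous (uu i) /\ continuous (vv i)) ->
  (forall i x, 0 <= x <= L -> uu i x = al i + prim (vv i) x) ->
  (forall i x, 0 <= x <= L -> vv i x = be i + prim (fun t => \sum_j Coef z i j t * uu j t) x) ->
  (forall i, uu i L = al i /\ vv i L = be i) ->
  exists U : bool * bool -> perC2 L,
    (forall i x, c2dd (U i) x = \sum_j Coef z i j x * U j x) /\
    forall i x, 0 <= x <= L -> U i x = uu i x.
Proof.
move=> cuv eu ev bc; have [C hC] := Coef_bound z.
have lL : 0 <= L <= L by rewrite lexx ltW.
have [u [v [cu cv hu hv]]] := second_order_ivp (@Coef_cont z) hC al be.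
have cS i : continuous (fun t => \sum_j Coef z i j t * u j t).
  by apply: cont_sum => j; exact: contM.
have cSS i : continuous (fun t => \sum_j Coef z i j t * uu j t).
  by apply: cont_sum => j; apply: contM => //; exact: (cuv j).1.
have E i x : 0 <= x <= L -> u i x = uu i x /\ v i x = vv i x.
  move=> hx; pose du i x := u i x + -1 * uu i x; pose dv i x := v i x + -1 * vv i x.
  have [|||||||h1 h2] := @second_order_zero _ _ _ _ (@Coef_cont z) hC du dv 0 L _ _ _ _ _ _ i x.
  - by [].
  - exact: ltW.
  - by move=> k; apply: contD => //; apply: contM; [exact: contC|exact: (cuv k).1].
  - by move=> k; apply: contD => //; apply: contM; [exact: contC|exact: (cuv k).2].
  - move=> k t ht; rewrite /du /dv hu eu//.
    have l1 := cont_locint (cv k); have l2 := cont_locint (cuv k).2.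
    by rewrite primD ?primZ//; [ring|exact: locintZ].
  - move=> k t ht; rewrite /dv hv ev//.
    have -> : (fun s => \sum_j Coef z k j s * du j s) = (fun s => \sum_j Coef z k j s * u j s +
        -1 * \sum_j Coef z k j s * uu j s).
      by apply/funext => s; rewrite mulr_sumr -big_split; apply: eq_bigr => j _; rewrite /du/=; ring.
    have l1 := cont_locint (@cS k); have l2 := cont_locint (@cSS k).
    by rewrite primD ?primZ//; [ring|exact: locintZ].
  - by [].
  by move: h1 h2; rewrite /du /dv; split; lra.
have hv0 i x : v i x = be i + prim (fun=> 0) x + prim (fun t => \sum_j Coef z i j t * u j t) x.
  by rewrite hv prim_cst0 addr0.
have bc' i : u i L = al i /\ v i L = be i.
  by have [-> ->] := E i L lL; exact: bc.
have [U hU] := @periodic_solution R _ L _ C (@Coef_cont z) hC (@Coef_per z)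
  (fun _ _ => 0) u v al be (fun _ => @contC R 0) (fun _ _ => erefl) (fun i => conj (cu i) (cv i)) hu hv0 bc'.
exists U; split=> i x; last by move=> hx; have [-> _ _] := hU i x; have [-> _] := E i x hx.
have [_ _ ->] := hU i x; rewrite add0r; apply: eq_bigr => j _.
by have [-> _ _] := hU j x.
Qed.

Let L2per2_0 : L2per2 L 0.
Proof.
have s0 : sqint L (fun=> 0).
  by split; [exact: measurable_cst|have := cont_locint (@contC R (0 ^+ 2)) 0 L].
by split; apply: sqint_L2per => // -[]; exact: s0.
Qed.

Let source0 i : source b w (comp 0) i = (fun=> 0).
Proof.
apply/funext => x; rewrite /source.
have c0 j : comp 0 j x = 0 by case: j => -[] [].
by rewrite !c0 !mulr0 addr0 oppr0 mul0r.
Qed.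

Lemma calL_eigen z u : T u (z *: u) -> exists U : bool * bool -> perC2 L,
  (forall i x, c2dd (U i) x = \sum_j Coef z i j x * U j x) /\
  forall i, comp u i = U i %[ae mu in I].
Proof.
rewrite -[z *: u]addr0 => /(calL_classical L2per2_0)[uu [vv [al [be [cuv eu ev bc hu]]]]].
have [|U [hU UE]] := @homogeneous_classical z uu vv al be cuv eu _ bc; last first.
- exists U; split=> // i; apply: (ae_sub (hu i)) => x h xI.
  have xL : 0 <= x <= L by move: xI; rewrite /= in_itv.
  by rewrite h// UE.
move=> i x hx; rewrite ev// source0; congr (_ + _).
rewrite (@prim_eq_in _ _ (fun=> 0)) ?prim_cst0 ?addr0//; first by case/andP: hx.
by move=> t _; rewrite patchE; case: ifP.
Qed.

Lemma perC2_sqint (f : perC2 L) : [/\ sqint L f, sqint L (c2d f) & sqint L (c2dd f)].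
Proof.
have h (k : R -> R) : continuous k -> sqint L k.
  by move=> ck; apply: (sqint_cont _ ck) => //; exact: continuous_measurable_fun.
by split; apply: h; [exact: c2f_cont|exact: c2d_cont|exact: c2_cont].
Qed.

Lemma rweak_der (f f' : R -> R) : (forall x, is_derive x 1 f (f' x)) -> continuous f' ->
  Defs.periodic L f -> rweak L f f'.
Proof.
move=> df cf pf; have lL : 0 <= L <= L by rewrite lexx ltW.
have pE x : 0 <= x <= L -> prim (f' \_ I) x = f x - f 0.
  move=> /andP[x0 xL]; rewrite -(prim_unique cf df); apply: prim_eq_in => // t /andP[t0 tx].
  by rewrite cut_in// t0 (le_trans tx).
apply: (@rweak_prim _ _ L0 _ _ (f 0)); first exact: (cont_locint cf).
  by rewrite pE// -(pf 0) add0r subrr.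
by move=> x /pE ->; ring.
Qed.

Lemma eigen_calL z (U : bool * bool -> perC2 L) :
  (forall i x, c2dd (U i) x = \sum_j Coef z i j x * U j x) ->
  T (assemble (fun i => U i)) (z *: assemble (fun i => U i)).
Proof.
move=> hU; rewrite -[z *: _]addr0.
apply: (@calL_intro _ _ _ (fun i => c2d (U i)) (fun i => c2dd (U i))) => //.
- by move=> i; split; [exact: c2_per|exact: c2d_per|exact: c2dd_per].
- by move=> i; exact: perC2_sqint.
- move=> i; split; apply: rweak_der.
  + exact: c2_der.
  + exact: c2d_cont.
  + exact: c2_per.
  + exact: c2_der2.
  + exact: c2_cont.
  + exact: c2d_per.
- by move=> i x; rewrite source0 add0r.
Qed.

Lemma cont_ae_eq0 (f : R -> R) : continuous f -> f = (fun=> 0) %[ae mu in I] ->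
  forall x, 0 <= x <= L -> f x = 0.
Proof.
move=> cf h; have cf2 : continuous (fun x => f x ^+ 2) by exact: contX.
have e : prim (fun x => f x ^+ 2) L = 0.
  rewrite -[RHS](prim_cst0 L); apply: (@prim_ae _ L); [exact: cont_locint| | |].
  - by apply: cont_locint; exact: contC.
  - by rewrite lexx ltW.
  - by apply: (ae_sub h) => x {}h xI; rewrite h// expr0n.
move=> x hx; have := @prim_eq0 _ _ L L0 cf2 (fun t _ => sqr_ge0 (f t)) _ x hx.
by rewrite e lexx => /(_ isT) /eqP; rewrite sqrf_eq0 => /eqP.
Qed.

Lemma eq_L2_comp u v : eq_L2 L u v <-> forall i, comp u i = comp v i %[ae mu in I].
Proof.
split=> [[h1 h2] [[] r]|h]; [by apply: (ae_sub h2) => x h xI; rewrite /comp /part /= h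
  |by apply: (ae_sub h1) => x h xI; rewrite /comp /part /= h|].
by split; [apply: (ae_sub (ae_and (h (false, false)) (h (false, true))))
  |apply: (ae_sub (ae_and (h (true, false)) (h (true, true))))] => x [h1 h2] xI;
  apply: cpart_ext => -[]; rewrite -/(part _ _ _); [exact: h2|exact: h1|exact: h2|exact: h1].
Qed.

Lemma assemble_eq0 (U : bool * bool -> perC2 L) : eq_L2 L (assemble (fun i => U i)) 0 ->
  forall i x, U i x = 0.
Proof.
move=> /eq_L2_comp h i; apply: (periodic_eq0 L0); first exact: c2_per.
apply: cont_ae_eq0; first exact: c2f_cont.
apply: (ae_sub (h i)) => x {}h xI; move: (h xI); rewrite comp_assemble => ->.
by case: i {h} => -[] [].
Qed.

End WaveOperator.

(** * Resolvent *)

Section PeriodicExtension.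
Context {R : realType}.
Implicit Types (x : R).
Variable L : R.
Hypothesis L0 : 0 < L.

Definition wrap x : R := x - L * (Num.floor (x / L))%:~R.
(** The L-periodic function that agrees with [f] on [0, L[. *)
Definition perext (f : R -> R) x : R := f (wrap x).

Lemma perext_per f : Defs.periodic L (perext f).
Proof.
move=> x; congr (f _); rewrite /wrap.
have -> : (x + L) / L = x / L + 1 by field; rewrite gt_eqF.
by rewrite floorDrz ?rpred1// floor1 intrD; ring.
Qed.

Lemma perext_in f x : f L = f 0 -> 0 <= x <= L -> perext f x = f x.
Proof.
move=> fL /andP[x0]; rewrite le_eqVlt /perext /wrap => /predU1P[->|xL].
  by rewrite divff ?gt_eqF// floor1 mulr1 subrr.
have -> : Num.floor (x / L) = 0.
  apply: floor_def; rewrite add0r; apply/andP; split; first by rewrite divr_ge0// ltW.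
  by rewrite ltr_pdivrMr// mul1r.
by rewrite mulr0 subr0.
Qed.

Lemma perext_measurable f : continuous f -> measurable_fun setT (perext f).
Proof.
move=> cf; apply: (@measurableT_comp _ _ _ _ _ _ f _ wrap).
  exact: continuous_measurable_fun.
apply: measurable_funB; first exact: measurable_id.
apply: measurable_funM; first exact: measurable_cst.
apply: nondecreasing_measurable => // s t st; rewrite ler_int.
have h : s / L <= t / L by rewrite ler_pM2r// invr_gt0.
exact: (le_floor h).
Qed.

End PeriodicExtension.

Section Resolvent.
Context {R : realType}.
Local Notation mu := (@lebesgue_measure R).
Local Notation X := ((R -> R[i]^o) * (R -> R[i]^o))%type.
Local Open Scope complex_scope.
Implicit Types (x : R) (u g : X) (z : R[i]) (i j : bool * bool).
Variables (L b w B lam x2 : R) (phi W p p' y y' : R -> R).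
Hypothesis hd : hill_data L b lam x2 W p p' y y'.
Hypothesis w_lt1 : w ^+ 2 < 1.
Hypothesis B_eq : B ^+ 2 = 2 - w * B.
Hypothesis phiW : forall x, (W x - 1) * (1 - w * B) = B ^+ 2 * phi x.
Let L0 : 0 < L := hill_L hd.
Local Notation I := [set` `[0, L]].
Local Notation T := (calL L (- b) b (- b) w phi (fun x => B * phi x)).
Local Notation Coef z := (coef b w B phi (complex.Re z) (complex.Im z)).

Let Coef_cont z i j : continuous (Coef z i j).
Proof. exact: (coef_cont hd). Qed.

Let Coef_per z i j : Defs.periodic L (Coef z i j).
Proof. exact: (coef_per hd). Qed.

Let no_eigen z (U : bool * bool -> perC2 L) : ~ is_eigenvalue L T z ->
  (forall i x, c2dd (U i) x = \sum_j Coef z i j x * U j x) -> forall i x, U i x = 0.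
Proof.
move=> nz hU; apply: (assemble_eq0 hd); apply: contrapT => h; apply: nz.
by exists (assemble (fun i => U i)); split=> //; exact: (eigen_calL hd w_lt1).
Qed.

Lemma norm_L2_sqr u : (forall i, sqint L (comp u i)) ->
  norm_L2 L u ^+ 2 = \sum_i \int[mu]_(x in I) (comp u i x ^+ 2).
Proof.
move=> su; have lu i : mu.-integrable I (EFin \o (fun x => comp u i x ^+ 2)) := (su i).2.
rewrite /norm_L2 sqr_sqrtr; last first.
  by apply: Rintegral_ge0 => x _; rewrite addr_ge0// sqr_ge0.
rewrite (eq_bigr (fun i => \int[mu]_(x in I) (comp u (i.1, i.2) x ^+ 2))); last by move=> -[].
rewrite -(pair_bigA _ (fun c r => \int[mu]_(x in I) (comp u (c, r) x ^+ 2)))/= !big_bool/=.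
have i2 c : mu.-integrable I (EFin \o (fun x => comp u (c, true) x ^+ 2 + comp u (c, false) x ^+ 2)).
  exact: integrable_add.
rewrite -!RintegralD//; apply: eq_Rintegral => x _.
by rewrite !normc_sqr /comp /part /=; ring.
Qed.

Lemma source_sqr_le g i : (forall j, sqint L (comp g j)) ->
  \int[mu]_(x in I) (source b w (comp g) i x ^+ 2) <=
  2 * (1 + w ^+ 2) / (b * (1 - w ^+ 2)) ^+ 2 * norm_L2 L g ^+ 2.
Proof.
move=> sg; set d := b * (1 - w ^+ 2); set c := 2 * (1 + w ^+ 2) / d ^+ 2.
have c0 : 0 <= c by rewrite divr_ge0 ?sqr_ge0// mulr_ge0// addr_ge0// sqr_ge0.
have lg j : mu.-integrable I (EFin \o (fun x => comp g j x ^+ 2)) := (sg j).2.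
have l2 := integrable_add (lg (false, i.2)) (lg (true, i.2)).
have l3 := integrableMcont l2 (@contC _ c).
apply: (@le_trans _ _ (c * (\int[mu]_(x in I) (comp g (false, i.2) x ^+ 2) +
    \int[mu]_(x in I) (comp g (true, i.2) x ^+ 2)))); last first.
  apply: ler_wpM2l => //; rewrite (norm_L2_sqr sg).
  rewrite (bigD1 (false, i.2))//= (bigD1 (true, i.2))//= addrA lerDl.
  by apply: sumr_ge0 => j _; apply: Rintegral_ge0 => x _; exact: sqr_ge0.
rewrite -RintegralD// mulrC -RintegralZr//.
apply: le_Rintegral => //; first exact: (source_sqint b w sg i).2.
move=> x _; rewrite /source -/d mulrC.
have cauchy (c1 c2 d1 d2 : R) :
    (c1 * d1 + c2 * d2) ^+ 2 <= 2 * (c1 ^+ 2 + c2 ^+ 2) * (d1 ^+ 2 + d2 ^+ 2).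
  have h1 := sqr_ge0 (c1 * d2 - c2 * d1).
  have h2 : 0 <= (c1 ^+ 2 + c2 ^+ 2) * (d1 ^+ 2 + d2 ^+ 2).
    by rewrite mulr_ge0// addr_ge0// sqr_ge0.
  by nra.
rewrite exprMn sqrrN exprVn /c [leRHS]mulrC mulrAC [leLHS]mulrC; apply: ler_wpM2r.
  by rewrite invr_ge0 sqr_ge0.
by apply: le_trans (cauchy _ _ _ _) _; case: i.1; rewrite ?expr1n// [w ^+ 2 + 1]addrC.
Qed.

(** Without eigenfunctions, [resolvent_alternative] solves the integral equations with
    a bound. The solution, extended periodically from [0, L], is a weak solution;
    any other weak solution satisfies the same equations on [0, L] by regularity, so
    it is the same up to an eigenfunction and inherits the bound. *)
Lemma resolvent_of_not_eigenvalue z : ~ is_eigenvalue L T z -> resolvent_set L T z.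
Proof.
move=> nz; have lL : 0 <= L <= L by rewrite lexx ltW.
have [[U [[i [x /eqP Ux]] hU]]|[K K0 hK]] :=
    resolvent_alternative hd w_lt1 B_eq phiW (complex.Re z) (complex.Im z).
  by case: Ux; exact: (no_eigen nz hU).
pose c := L * (2 * (1 + w ^+ 2) / (b * (1 - w ^+ 2)) ^+ 2).
have c0 : 0 <= c.
  by rewrite mulr_ge0 ?(ltW L0)// divr_ge0 ?sqr_ge0// mulr_ge0// addr_ge0// sqr_ge0.
have solve g : L2per2 L g -> exists (u v : bool * bool -> R -> R) (al be : bool * bool -> R), [/\
    forall i, continuous (u i) /\ continuous (v i),
    forall i x, u i x = al i + prim (v i) x,
    forall i x, v i x = be i + prim (source b w (comp g) i \_ I) x +
      prim (fun t => \sum_j Coef z i j t * u j t) x,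
    forall i, u i L = al i /\ v i L = be i &
    forall i x, 0 <= x <= L -> `|u i x| <= K * (Num.sqrt c * norm_L2 L g)].
  move=> hg; have sg := L2per2_sqint hg; have ss := source_sqint b w sg.
  have ls i : locint (source b w (comp g) i \_ I) by apply: cut_locint; exact: sqint_int.
  have n0 : 0 <= norm_L2 L g by exact: sqrtr_ge0.
  apply: hK => [i|i|i x hx|].
  - exact: prim_continuous.
  - exact: prim0.
  - rewrite -sqrtr_sqr -[norm_L2 L g]ger0_norm// -sqrtr_sqr -sqrtrM//; apply: ler_wsqrtr.
    apply: le_trans (prim_sqint_le L0 (ss i) hx) _.
    rewrite /c -[leRHS]mulrA; apply: ler_wpM2l; first exact: ltW.
    exact: source_sqr_le.
  - by rewrite mulr_ge0// sqrtr_ge0.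
split.
- move=> g hg; have [u [v [al [be [cuv eu ev bc _]]]]] := solve g hg.
  have sg := L2per2_sqint hg; have ss := source_sqint b w sg.
  have u0 i : u i L = u i 0 by rewrite (bc i).1 eu prim0 addr0.
  have v0 i : v i L = v i 0 by rewrite (bc i).2 ev !prim0 !addr0.
  pose U i := perext L (u i); pose V i := perext L (v i).
  pose D i x := source b w (comp g) i x + \sum_j Coef z i j x * U j x.
  have UE i x : 0 <= x <= L -> U i x = u i x by apply: perext_in.
  have VE i x : 0 <= x <= L -> V i x = v i x by apply: perext_in.
  have sU i : sqint L (U i).
    apply: (sqint_cont _ (cuv i).1); last by move=> x /UE.
    exact: perext_measurable (cuv i).1.
  have sV i : sqint L (V i).
    apply: (sqint_cont _ (cuv i).2); last by move=> x /VE.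
    exact: perext_measurable (cuv i).2.
  have sCU i : sqint L (fun x => \sum_j Coef z i j x * U j x).
    apply: sqint_sum => j; under eq_fun do rewrite mulrC; exact: sqintM.
  have sD i : sqint L (D i) by exact: sqintD.
  have cS i : continuous (fun t => \sum_j Coef z i j t * u j t).
    by apply: cont_sum => j; apply: contM => //; exact: (cuv j).1.
  have pV i x : 0 <= x <= L -> prim (V i \_ I) x = prim (v i) x.
    move=> /andP[x0 xL]; apply: prim_eq_in => // t /andP[t0 tx].
    by rewrite cut_in ?VE// t0 (le_trans tx).
  have pD i x : 0 <= x <= L -> prim (D i \_ I) x = prim (source b w (comp g) i \_ I) x +
      prim (fun t => \sum_j Coef z i j t * u j t) x.
    move=> /andP[x0 xL]; rewrite -primD; first last.
    + exact: cont_locint.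
    + by apply: cut_locint; exact: sqint_int.
    apply: prim_eq_in => // t /andP[t0 tx].
    have tL : 0 <= t <= L by rewrite t0 (le_trans tx).
    rewrite !cut_in// /D; congr (_ + _); apply: eq_bigr => j _; by rewrite UE.
  exists (assemble U); apply: (@calL_intro _ _ _ _ _ _ _ _ _ _ _ _ _ hd w_lt1 z g U V D) => //.
  + move=> i; split; [exact: perext_per|exact: perext_per|].
    have [[p1 _ _ _] [p2 _ _ _]] := hg.
    have pg j : Defs.periodic L (comp g j).
      by move=> x; rewrite /comp /part; case: j => -[] r /=; rewrite ?p1 ?p2.
    move=> x; rewrite /D /source !pg; congr (_ + _); apply: eq_bigr => j _.
    by rewrite Coef_per /U (perext_per L0).
  + move=> i; split.
      apply: (rweak_prim L0 (c := al i)); first exact: sqint_int.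
        by rewrite pV//; have := (bc i).1; rewrite eu => /eqP; rewrite -subr_eq0 addrAC subrr add0r => /eqP.
      by move=> x hx; rewrite UE// pV// eu.
    apply: (rweak_prim L0 (c := be i)); first exact: sqint_int.
      rewrite pD//; have := (bc i).2; rewrite ev => /eqP.
      by rewrite -addrA -subr_eq0 addrAC subrr add0r => /eqP.
    by move=> x hx; rewrite VE// pD// ev -[LHS]addrA.
- move=> u hu; apply: contrapT => h; apply: nz; by exists u.
exists (Num.sqrt (4 * L) * (K * Num.sqrt c)) => u g hg hT.
have [u' [v' [al' [be' [cuv' eu' ev' bc' bd]]]]] := solve g hg.
have [uu [vv [al [be [cuv eu ev bc hu]]]]] := calL_classical hd w_lt1 B_eq phiW hg hT.
have [su _] := calL_parts hd w_lt1 hg hT.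
pose du i x := uu i x + -1 * u' i x; pose dv i x := vv i x + -1 * v' i x.
have cc (f f' : R -> R) : continuous f -> continuous f' -> continuous (fun x => f x + -1 * f' x).
  by move=> cf cf'; apply: contD => //; apply: contM => //; exact: contC.
have [|i x hx|i x hx|i|U [hU UE]] := @homogeneous_classical _ _ _ _ _ _ _ _ _ _ _ _ _ hd w_lt1 B_eq phiW z
    du dv (fun i => al i - al' i) (fun i => be i - be' i).
- by move=> i; split; apply: cc; case: (cuv i); case: (cuv' i).
- rewrite /du /dv eu// eu'; have l1 := cont_locint (cuv i).2; have l2 := cont_locint (cuv' i).2.
  by rewrite primD ?primZ//; [ring|exact: locintZ].
- rewrite /dv ev// ev'.
  have -> : (fun s => \sum_j Coef z i j s * du j s) = (fun s => \sum_j Coef z i j s * uu j s +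
      -1 * \sum_j Coef z i j s * u' j s).
    by apply/funext => s; rewrite mulr_sumr -big_split; apply: eq_bigr => j _; rewrite /du/=; ring.
  have l1 : locint (fun s => \sum_j Coef z i j s * uu j s).
    by apply: cont_locint; apply: cont_sum => j; apply: contM => //; exact: (cuv j).1.
  have l2 : locint (fun s => \sum_j Coef z i j s * u' j s).
    by apply: cont_locint; apply: cont_sum => j; apply: contM => //; exact: (cuv' j).1.
  by rewrite primD ?primZ//; [ring|exact: locintZ].
- by rewrite /du /dv (bc i).1 (bc i).2 (bc' i).1 (bc' i).2 !mulN1r.
have uE i x : 0 <= x <= L -> uu i x = u' i x.
  by move=> hx; have := UE i x hx; rewrite (no_eigen nz hU) /du; lra.
have n0 : 0 <= norm_L2 L g by exact: sqrtr_ge0.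
have N0 : 0 <= K * Num.sqrt c * norm_L2 L g by rewrite !mulr_ge0// sqrtr_ge0.
have L40 : 0 <= 4 * L by rewrite mulr_ge0// ltW.
rewrite -[leLHS]ger0_norm ?sqrtr_ge0// -sqrtr_sqr -[Num.sqrt (4 * L) * _ * _]mulrA.
rewrite -[K * Num.sqrt c * _]ger0_norm// -sqrtr_sqr -sqrtrM//; apply: ler_wsqrtr.
rewrite norm_L2_sqr//.
have bi i : \int[mu]_(x in I) (comp u i x ^+ 2) <= L * (K * Num.sqrt c * norm_L2 L g) ^+ 2.
  have cuu2 : continuous (fun x => uu i x ^+ 2) by apply: contX; exact: (cuv i).1.
  rewrite -(prim_cut L0) (@prim_ae _ L _ (fun x => uu i x ^+ 2))//; first last.
  + apply: (ae_sub (hu i)) => x h xI; rewrite patchE mem_set// h//.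
  + exact: cont_locint.
  + by apply: cut_locint; exact: (su i).2.
  have -> : L * (K * Num.sqrt c * norm_L2 L g) ^+ 2 = prim (fun=> (K * Num.sqrt c * norm_L2 L g) ^+ 2) L. by rewrite prim_cst mulrC.
  apply: prim_le => //; [exact: ltW|exact: contC|] => t ht.
  rewrite uE// -[u' i t ^+ 2]real_normK ?num_real// lerXn2r ?nnegrE//.
  by rewrite -mulrA; exact: bd.
apply: le_trans (ler_sum _ (fun i _ => bi i)) _.
have c4 : #|{: bool * bool}| = 4%N by rewrite card_prod card_bool.
by rewrite sumr_const c4 -[leRHS]mulrA mulr_natl.
Qed.

End Resolvent.

(** * Spectrum *)

Section Spectrum.
Context {R : realType}.
Local Notation mu := (@lebesgue_measure R).
Local Notation X := ((R -> R[i]^o) * (R -> R[i]^o))%type.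
Local Open Scope complex_scope.
Implicit Types (x : R) (u g : X) (z : R[i]) (i j : bool * bool).
Variables (L b w B lam x2 : R) (phi W p p' y y' : R -> R).
Hypothesis hd : hill_data L b lam x2 W p p' y y'.
Hypothesis w_lt1 : w ^+ 2 < 1.
Hypothesis B_eq : B ^+ 2 = 2 - w * B.
Hypothesis phiW : forall x, (W x - 1) * (1 - w * B) = B ^+ 2 * phi x.
Let L0 : 0 < L := hill_L hd.
Local Notation I := [set` `[0, L]].
Local Notation T := (calL L (- b) b (- b) w phi (fun x => B * phi x)).
Local Notation Coef z := (coef b w B phi (complex.Re z) (complex.Im z)).
Local Notation pair := (perC2 L * perC2 L)%type.
Local Notation eigenpair := (eigenpair b w B phi).
Implicit Types f h : pair.

Definition slice (U : bool * bool -> perC2 L) (r : bool) : pair := (U (false, r), U (true, r)).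
Definition join2 f h i : perC2 L :=
  if i.2 then (if i.1 then h.2 else h.1) else (if i.1 then f.2 else f.1).

Lemma coef_slice z (U : bool * bool -> perC2 L) :
  (forall i x, c2dd (U i) x = \sum_j Coef z i j x * U j x) <->
  (forall r x, calT1 b w B phi (slice U r) x = zmul (complex.Re z) (complex.Im z) (fun i => U i x) false r /\
     calT2 b w B phi (slice U r) x = zmul (complex.Re z) (complex.Im z) (fun i => U i x) true r).
Proof.
have s0 i x : source b w (fun _ _ => 0) i x = 0.
  by rewrite /source !mulr0 addr0 oppr0 mul0r.
have E x := coef_calT B phi hd w_lt1 (complex.Re z) (complex.Im z) (fun i => U i x)
  (fun i => c2dd (U i) x) (fun _ _ => 0) x.
split=> [hU r x|hU i x].
  have [|h1 h2] := (E x).1 _ r; first by move=> i; rewrite s0 add0r.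
  by rewrite /calT1 /calT2 h1 h2 !addr0.
have h := (E x).2 _ i; rewrite s0 add0r in h; apply: h => r.
by have [h1 h2] := hU r x; rewrite !addr0.
Qed.

(** The operator is symmetric, so its eigenvalues are real. *)
Lemma eigen_real z (U : bool * bool -> perC2 L) :
  (forall i x, c2dd (U i) x = \sum_j Coef z i j x * U j x) ->
  (exists i x, U i x != 0) ->
  complex.Im z = 0 /\ forall r, eigenpair (complex.Re z) (slice U r).
Proof.
move=> /coef_slice hU [[c r] [x Ux]].
set zr := complex.Re z; set zi := complex.Im z.
pose f := slice U false; pose h := slice U true.
have cip f1 f2 : continuous (fun t => f1.1 t * f2.1 t + f1.2 t * f2.2 t : R).
  by apply: contD; apply: contM; exact: c2f_cont.
have zi0 : zi = 0.
  have lip (a d : R) f1 f2 f3 f4 : prim (fun t => a * (f1.1 t * f2.1 t + f1.2 t * f2.2 t) +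
      d * (f3.1 t * f4.1 t + f3.2 t * f4.2 t)) L = a * ip f1 f2 + d * ip f3 f4.
    have l1 := cont_locint (cip f1 f2); have l2 := cont_locint (cip f3 f4).
    by rewrite primD ?primZ//; exact: locintZ.
  have e1 : form b w B phi f h = zr * ip f h + - zi * ip h h.
    rewrite -lip; congr (prim _ _); apply/funext => t.
    by have [-> ->] := hU false t; rewrite /zmul /=; ring.
  have e2 : form b w B phi h f = zr * ip h f + zi * ip f f.
    rewrite -lip; congr (prim _ _); apply/funext => t.
    by have [-> ->] := hU true t; rewrite /zmul /=; ring.
  have f0 := ip_ge0 hd f; have h0 := ip_ge0 hd h.
  have : zi * (ip f f + ip h h) = 0.
    have := formC hd B_eq phiW f h; rewrite e1 e2 (ipC h f); lra.
  move/eqP; rewrite mulf_eq0 => /orP[/eqP//|/eqP s0]; exfalso.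
  have f1 : ip f f <= 0 by lra.
  have h1 : ip h h <= 0 by lra.
  have [f11 f12] := ip_eq0 hd f1 x; have [h11 h12] := ip_eq0 hd h1 x.
  by move: Ux; case: c; case: r; rewrite ?f11 ?f12 ?h11 ?h12 eqxx.
split=> // r' t; have [-> ->] := hU r' t; rewrite /zmul -/zi zi0.
by case: r'; rewrite !mul0r ?subr0 ?addr0.
Qed.

Lemma calL_slices z u : complex.Im z = 0 -> T u (z *: u) -> exists f h,
  [/\ eigenpair (complex.Re z) f, eigenpair (complex.Re z) h & eq_L2 L u (assemble (fun i => join2 f h i))].
Proof.
move=> z0 /(calL_eigen hd w_lt1 B_eq phiW)[U [/coef_slice hU hu]].
have eU r : eigenpair (complex.Re z) (slice U r).
  by move=> t; have [-> ->] := hU r t; rewrite /zmul z0; case: r; rewrite !mul0r ?subr0 ?addr0.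
exists (slice U false), (slice U true); split=> //; apply/eq_L2_comp => i.
by rewrite comp_assemble; apply: (ae_sub (hu i)) => x h xI; rewrite h//; case: i {h} => -[] [].
Qed.

Lemma slices_calL z f h : complex.Im z = 0 -> eigenpair (complex.Re z) f ->
  eigenpair (complex.Re z) h ->
  T (assemble (fun i => join2 f h i)) (z *: assemble (fun i => join2 f h i)).
Proof.
move=> z0 ef eh; apply: (eigen_calL hd w_lt1); apply/coef_slice => r x.
have -> : slice (join2 f h) r = if r then h else f by case: r; rewrite /slice /join2 -?surjective_pairing.
by rewrite /zmul z0; case: r; rewrite !mul0r ?subr0 ?addr0; [exact: eh|exact: ef].
Qed.

Let zero : pair := (c2_cst L 0, c2_cst L 0).

Let zero_eigen s : eigenpair s zero.
Proof. by move=> x; rewrite /calT1 /calT2 /=; split; ring. Qed.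

Definition real_pair f : X := (fun x => (f.1 x)%:C, fun x => (f.2 x)%:C).

Let real_pairE f : real_pair f = assemble (fun i => join2 f zero i).
Proof. by []. Qed.

Lemma real_pair_eigenvector (s : R) f : (exists x, f.1 x != 0 \/ f.2 x != 0) ->
  eigenpair s f -> eigenvector L T s%:C (real_pair f).
Proof.
move=> [x nz] ef; split; first by rewrite real_pairE; apply: slices_calL.
rewrite real_pairE => /(assemble_eq0 hd) h0.
by case: nz; [rewrite (h0 (false, false))|rewrite (h0 (true, false))]; rewrite eqxx.
Qed.

Lemma eigenvalueP z : is_eigenvalue L T z <->
  complex.Im z = 0 /\ exists f, (exists x, f.1 x != 0 \/ f.2 x != 0) /\ eigenpair (complex.Re z) f.
Proof.
split=> [[u [hT hu]]|[z0 [f [nz ef]]]]; last first.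
  have -> : z = (complex.Re z)%:C by case: z z0 {ef} => s t /= ->.
  by exists (real_pair f); exact: real_pair_eigenvector.
have [U [hU uE]] := calL_eigen hd w_lt1 B_eq phiW hT.
have [[i [x Ux]]|nU] := pselect (exists i x, U i x != 0); last first.
  case: hu; apply/eq_L2_comp => i; apply: (ae_sub (uE i)) => x h xI; rewrite h//.
  have -> : comp 0 i x = 0 by case: i {h} => -[] [].
  by apply/eqP/negPn/negP => Ux; apply: nU; exists i, x.
have [|z0 ef] := eigen_real hU; first by exists i, x.
split=> //; exists (slice U i.2); split=> //; exists x.
by case: i Ux => -[] r; [right|left].
Qed.

(** The operator has real coefficients, so complex eigenfunctions are complex
    combinations of real ones. *)
Lemma simple_real_eigenvalue (s : R) f : (exists x, f.1 x != 0 \/ f.2 x != 0) ->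
  eigenpair s f ->
  (forall h, eigenpair s h -> exists a, forall x, h.1 x = a * f.1 x /\ h.2 x = a * f.2 x) ->
  simple_eigenvalue L T s%:C.
Proof.
move=> nz ef span; exists (real_pair f); first exact: real_pair_eigenvector.
move=> v /(@calL_slices s%:C v erefl)[h1 [h2 [/span[a1 e1] /span[a2 e2] /eq_L2_comp hv]]].
exists (a1 +i* a2); apply/eq_L2_comp => i; apply: (ae_sub (hv i)) => x h xI.
rewrite h// comp_assemble -[_ *: _]addr0.
case: i {h} => c r; rewrite comp_shift /zmul real_pairE !comp_assemble.
have -> : comp 0 (c, r) x = 0 by case: c; case: r.
have [e11 e12] := e1 x; have [e21 e22] := e2 x.
by case: c; case: r; rewrite /join2 /= ?e11 ?e12 ?e21 ?e22; ring.
Qed.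

(** The combination with vanishing trace of two eigenfunctions is zero. *)
Lemma negative_simple (s : R) f : s < 0 -> (exists x, f.1 x != 0 \/ f.2 x != 0) ->
  eigenpair s f -> simple_eigenvalue L T s%:C.
Proof.
move=> s0 nz ef; apply: (simple_real_eigenvalue nz ef) => h eh.
pose tr := @trace R L w B x2.
have trf : tr f != 0.
  apply/eqP => t0; have [x] := nz; have [-> ->] := negative_trace hd w_lt1 B_eq phiW s0 ef t0 x.
  by rewrite eqxx => -[].
exists (tr h / tr f) => x.
have e : eigenpair s (pair_lin 1 h (- (tr h / tr f)) f).
  move=> t; have [h1 h2] := eh t; have [f1 f2] := ef t.
  have e1 : calT1 b w B phi (pair_lin 1 h (- (tr h / tr f)) f) t =
      calT1 b w B phi h t - tr h / tr f * calT1 b w B phi f t by rewrite /calT1 /=; ring.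
  have e2 : calT2 b w B phi (pair_lin 1 h (- (tr h / tr f)) f) t =
      calT2 b w B phi h t - tr h / tr f * calT2 b w B phi f t by rewrite /calT2 /=; ring.
  by rewrite e1 e2 h1 h2 f1 f2 /=; split; ring.
have t0 : tr (pair_lin 1 h (- (tr h / tr f)) f) = 0.
  by rewrite /tr trace_lin mulNr divfK// mul1r subrr.
have [] := negative_trace hd w_lt1 B_eq phiW s0 e t0 x.
by rewrite /= => h1 h2; split; lra.
Qed.

Let kernel_W_cont : continuous (fun x => W x / b * p x).
Proof.
apply: contM; last exact: der_contT (hill_p_der hd).
by apply: contM; [exact: (hill_W_cont hd)|exact: contC].
Qed.

Let kernel : perC2 L := PerC2 (hill_p_der hd) (hill_p'_der hd) kernel_W_cont (hill_p_per hd).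

(** The derivative of the wave up to a factor: the mode generated by translations. *)
Definition kernel_pair (c : R) : pair := (c2_lin c kernel 0 kernel, c2_lin (B * c) kernel 0 kernel).

Lemma kernel_pairE c x : (kernel_pair c).1 x = c * p x /\ (kernel_pair c).2 x = B * (c * p x).
Proof. by rewrite /=; split; ring. Qed.

Lemma kernel_pair_eigen c : eigenpair 0 (kernel_pair c).
Proof.
move=> x; have b0 : b != 0 by rewrite gt_eqF// (hill_b hd).
have B0 : B != 0.
  by apply/eqP => B0; have := B_eq; rewrite B0; lra.
have phiE : phi x = (1 - w * B) * (W x - 1) / B ^+ 2.
  by rewrite mulrC [(1 - w * B) * _]mulrC phiW; field.
have w2 : w * B = 2 - B ^+ 2 by have := B_eq; lra.
split; rewrite /calT1 /calT2 /= phiE.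
  transitivity (c * p x * ((1 - w * B) * (1 - W x) + (W x - 1) * (1 - w * B))); last by ring.
  by field; rewrite b0 B0.
transitivity (c * p x * (W x - 1) / B * (2 - w * B - B ^+ 2)); first by field; rewrite b0 B0.
by rewrite w2; ring.
Qed.

Lemma kernel_pair_neq0 c : c != 0 -> exists x, (kernel_pair c).1 x != 0 \/ (kernel_pair c).2 x != 0.
Proof.
move=> c0; exists (L / 4); left; rewrite (kernel_pairE c _).1 mulf_neq0//.
by apply: (hill_p_neq0 hd); have l0 := L0; apply/andP; split; lra.
Qed.

(** Infinitely many points of any neighbourhood would give more eigenvalues below a
    bound than the counting lemma allows. *)
Lemma eigenvalues_discrete (S : set R[i]^o) : (forall z, S z -> is_eigenvalue L T z) ->
  limit_point S = set0.
Proof.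
move=> hS; rewrite -subset0 => z hz.
have many n : forall U, nbhs z U -> exists s : seq R[i]^o,
    [/\ size s = n, uniq s & forall t, t \in s -> S t /\ U t].
  elim: n => [|n ih] U hU; first by exists [::].
  have [t [tz St Ut]] := hz U hU.
  have d0 : 0 < `|z - t| by rewrite normr_gt0 subr_eq0 eq_sym.
  have [s [ss us hs]] := ih (U `&` ball z `|z - t|) (filterI hU (nbhsx_ballx z _ d0)).
  exists (t :: s); split; first by rewrite /= ss.
    rewrite /= us andbT; apply/negP => /hs[_ [_]]; by rewrite -ball_normE /= ltxx.
  by move=> r; rewrite inE => /orP[/eqP->//|/hs[Sr [Ur _]]].
have [n hn] := eigen_finite hd w_lt1 B_eq phiW (complex.Re z + 1).
have [s [ss us hs]] := many n _ (nbhsx_ballx z _ (ltr01 : (0 : R[i]) < 1)).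
have sI (k : 'I_n) : s`_k \in s by rewrite mem_nth// ss.
have /choice[f hf] (k : 'I_n) : exists f : pair, (exists x, f.1 x != 0 \/ f.2 x != 0) /\
    eigenpair (complex.Re s`_k) f.
  by have /eigenvalueP[_] := hS _ (hs _ (sI k)).1.
apply: (hn (fun k => complex.Re s`_k) f) => [k l e|k|k|k].
- have /eigenvalueP[ik _] := hS _ (hs _ (sI k)).1; have /eigenvalueP[il _] := hS _ (hs _ (sI l)).1.
  have e' : s`_k = s`_l.
    by move: e ik il; case: (s`_k) (s`_l) => ? ? [? ?] /= -> -> ->.
  by apply/val_inj/eqP; rewrite /= -(nth_uniq (0 : R[i]^o) _ _ us) ?ss ?ltn_ord// e' eqxx.
- have [_] := hs _ (sI k); rewrite -ball_normE /= => h.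
  have := le_lt_trans (complex.normc_ge_Re _) h; rewrite (_ : 1 = (1 : R)%:C)// ltcR.
  case: (s`_k) (z) => ? ? [? ?] /=; rewrite ltr_norml => /andP[h1 _]; lra.
- exact: (hf k).2.
- exact: (hf k).1.
Qed.

Lemma spectrum_calL (c : R) : c != 0 -> exists lambda0 : R,
  [/\ [set lambda : R | lambda < 0 /\ is_eigenvalue L T lambda%:C] = [set lambda0],
      simple_eigenvalue L T lambda0%:C,
      eigenvector L T 0 (fun x => (c * p x)%:C, fun x => (B * (c * p x))%:C),
      simple_eigenvalue L T 0 &
      let rest := spectrum L T `\` [set lambda0%:C; 0] in
      (forall z, rest z -> is_eigenvalue L T z) /\ limit_point rest = set0].
Proof.
move=> c0; have [s [f [s0 nz ef]]] := negative_exists hd w_lt1 B_eq phiW.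
exists s; have kn := kernel_pair_neq0 c0; have ke := kernel_pair_eigen c.
have rest z : (spectrum L T `\` [set s%:C; 0]) z -> is_eigenvalue L T z.
  by move=> [sz _]; apply: contrapT => /(resolvent_of_not_eigenvalue hd w_lt1 B_eq phiW).
split.
- apply/seteqP; split=> [t [t0 /eigenvalueP[_ [h [nh eh]]]]|t ->] /=.
    exact: (negative_unique hd w_lt1 B_eq phiW t0 s0 eh ef).
  by split=> //; apply/eigenvalueP; split=> //; exists f.
- exact: negative_simple ef.
- have := real_pair_eigenvector kn ke; rewrite /real_pair.
  by congr (eigenvector _ _ _ (_, _)); apply/funext => x; have [e1 e2] := kernel_pairE c x; rewrite ?e1 ?e2.
- apply: (simple_real_eigenvalue kn ke) => h /(kernel_spanned hd w_lt1 B_eq phiW)[a ha].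
  exists (a / c) => x; have [-> ->] := ha x; have [-> ->] := kernel_pairE c x.
  by split; field.
- by split=> //; exact: eigenvalues_discrete.
Qed.

End Spectrum.

(** * The cnoidal wave *)

Section CnoidalWave.
Context {R : realType}.
Implicit Types x : R.
Variables (L b w k B : R) (s d : R -> R).
Hypotheses (L0 : 0 < L) (b0 : 0 < b) (w_lt1 : w ^+ 2 < 1) (k0 : 0 < k).
Hypothesis B_eq : B ^+ 2 = 2 - w * B.
Hypothesis jt : jacobi_triple k (ellipticK k) s (fun u => jacobi_cn u k) d.
Local Notation phi := (wave L b w k B).
Local Notation W := (lame_potential k (ellipticK k) L b s).
Local Notation p := (lame_kernel (ellipticK k) L s (fun u => jacobi_cn u k) d).

Let B0 : B != 0.
Proof. by apply/eqP => h; have := B_eq; rewrite h; lra. Qed.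

Let Bw0 : B * w - 1 != 0.
Proof.
apply/eqP => h; have Bw : B * w = 1 by lra.
have B2 : B ^+ 2 = 1 by have := B_eq; rewrite [w * B]mulrC Bw; lra.
have : (B * w) ^+ 2 = 1 by rewrite Bw expr1n.
by rewrite exprMn B2 mul1r; have := w_lt1; lra.
Qed.

(** With B^2 = 2 - w B the two constants of the wave make the potential 1 + mu phi of
    the first component exactly the shifted Lame potential. *)
Lemma wave_lame x : (W x - 1) * (1 - w * B) = B ^+ 2 * phi x.
Proof.
have L0' : L != 0 by rewrite gt_eqF.
have w2 : (w ^+ 2 + 1 / 2) * B ^+ 2 - 3 / 2 * w * B = (B * w - 1) ^+ 2.
  by rewrite mulrDl sqrrB1 exprMn {2}B_eq; have := B_eq; lra.
rewrite /wave (jacobi_sc jt) /lame_potential.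
set S := s _ ^+ 2; set Kk := ellipticK k.
have e1 : B ^+ 2 * wave_b2 L b w k B = 48 * b * k ^+ 2 * (B * w - 1) * Kk ^+ 2 / L ^+ 2.
  by rewrite /wave_b2 -/Kk; field; rewrite L0' B0.
have e2 : B ^+ 2 * wave_b0 L b w k B =
    - 32 * (B * w - 1) * b * (k ^+ 2 - 1 / 2) * Kk ^+ 2 / L ^+ 2 + (B * w - 1).
  have -> : B ^+ 2 * wave_b0 L b w k B = - 32 * (B * w - 1) * b * (k ^+ 2 - 1 / 2) * Kk ^+ 2 / L ^+ 2 +
      ((w ^+ 2 + 1 / 2) * B ^+ 2 - 3 / 2 * w * B) / (B * w - 1).
    by rewrite /wave_b0 -/Kk; field; rewrite L0' B0 Bw0.
  by rewrite w2 expr2 mulfK.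
by rewrite [RHS]mulrDr e2 mulrA e1; field.
Qed.

Lemma wave_der x : ((phi)^`())%classic x = - 4 * wave_b2 L b w k B * ellipticK k / L * p x.
Proof.
apply: der_val; pose kap : R := 2 * ellipticK k / L.
have dl : is_derive x 1 (fun t => kap * t) kap.
  by apply: (der_eq (derScale kap (derid x))); rewrite mulr1.
have dc := @dercomp _ (fun u => jacobi_cn u k) (fun t => kap * t) x _ _ (jacobi_der_c jt _) dl.
have dd := derD (derC (wave_b0 L b w k B) x) (derScale (wave_b2 L b w k B) (derX 2 dc)).
apply: (der_eq dd); rewrite /lame_kernel -/kap /kap /= expr1; ring.
Qed.

Lemma wave_b2_neq0 : - 4 * wave_b2 L b w k B * ellipticK k / L != 0.
Proof.
have K0 : ellipticK k != 0 by rewrite gt_eqF// (jacobi_K_gt0 jt).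
have n48 : (48 : R) != 0 by rewrite pnatr_eq0.
have n4 : (4 : R) != 0 by rewrite pnatr_eq0.
by rewrite /wave_b2 !mulf_neq0 ?invr_neq0 ?mulf_neq0 ?oppr_eq0 ?expf_neq0 ?B0 ?Bw0// gt_eqF.
Qed.

End CnoidalWave.

Local Open Scope complex_scope.

Theorem proposition4p8 (R : realType) (L a b c d omega k B : R)
    (phi psi : R -> R)
    (hL : 0 < L) (hb : 0 < b) (homega : -1 < omega < 1)
    (hk : 0 < k < 1 / Num.sqrt 2)
    (ha : a = - b) (hc : c = - b) (hd : d = b)
    (hB : B = - (omega / 2) + 1 / 2 * Num.sqrt (omega ^+ 2 + 8) \/
          B = - (omega / 2) - 1 / 2 * Num.sqrt (omega ^+ 2 + 8))
    (hphi : phi = wave L b omega k B)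
    (hpsi : psi = fun x => B * phi x) :
  let T := calL L a b c omega phi psi in
  exists lambda0 : R,
  [/\ [set lambda : R | lambda < 0 /\ is_eigenvalue L T lambda%:C]
        = [set lambda0],
      simple_eigenvalue L T lambda0%:C,
      eigenvector L T 0
        (fun x => (phi^`()%classic x)%:C, fun x => (B * phi^`()%classic x)%:C),
      simple_eigenvalue L T 0 &
      let rest := spectrum L T `\` [set lambda0%:C; 0] in
      (forall z, rest z -> is_eigenvalue L T z) /\ limit_point rest = set0].
Proof.
have w_lt1 : omega ^+ 2 < 1 by case/andP: homega => h1 h2; nra.
have B_eq : B ^+ 2 = 2 - omega * B.
  have w8 : 0 <= omega ^+ 2 + 8 by rewrite addr_ge0// sqr_ge0.
  by case: hB => ->; have := sqr_sqrtr w8; move: (Num.sqrt _) => r h; nra.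
have [k0 k2] : 0 < k /\ k ^+ 2 < 1 / 2.
  case/andP: hk => k0 k1; split=> //.
  have s0 : 0 < Num.sqrt (2 : R) by rewrite sqrtr_gt0.
  have -> : 1 / 2 = (1 / Num.sqrt 2) ^+ 2 :> R by rewrite expr_div_n expr1n sqr_sqrtr.
  by rewrite ltr_pXn2r// ?nnegrE// ltW// divr_gt0.
have k2_lt1 : k ^+ 2 < 1 by lra.
have [s [dn jt]] := jacobi_triple_am k2_lt1.
have [p' [y [y' [x2 [lam hill]]]]] := lame_hill_data jt hL hb k0 k2.
have phiW := @wave_lame R L b omega k B s dn hL w_lt1 B_eq jt.
have := spectrum_calL hill w_lt1 B_eq phiW (wave_b2_neq0 hL hb w_lt1 k0 B_eq jt).
have dphi : phi^`()%classic = (fun x => - 4 * wave_b2 L b omega k B * ellipticK k / L *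
    lame_kernel (ellipticK k) L s (fun u => jacobi_cn u k) dn x).
  by apply/funext => x; rewrite hphi; exact: wave_der jt x.
by rewrite /= ha hc hpsi dphi hphi.
Qed.
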